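(* Let $\Lambda_0$ be an ordered abelian group and put $\Lambda=\mathbb{Z}\times\Lambda_0$. Suppose that (A1) $\Gamma$ is a group; (A2) $\beta:\Gamma\to\mathrm{Aut}^+(\Lambda)$ is a homomorphism, where $\beta_g(1,\lambda_0)=(1,\theta_g(\lambda_0)+\mu_g)$ with $\theta_g\in\mathrm{Aut}^+(\Lambda_0)$, $\mu_g\in\Lambda_0$; (A3) $X$ is a $\Lambda$-tree; (A4) a $\beta$-affine action of $\Gamma$ on $X$ is given for which the induced action on $X^*=\mathbb{Z}\otimes_\Lambda X$ is without inversions. Then one can obtain (as a signature of the action, in the sense of the context) the following data: (S1) a graph of groups $(\mathcal{G},Y^*,T^* )$ with vertex groups $\mathcal{G}(x^* )$ ($x^*\in Y^*$), edge groups $\mathcal{G}(e)$, edge group embeddings $\alpha_e:\mathcal{G}(e)\to\mathcal{G}(\partial_0^{Y^*}e)$ and elements $g_e\in\Gamma$ ($e\in E(Y^* )$), Bass–Serre tree $X^*$, and $T_0^*\subseteq S^*\subseteq X^*$, where $T_0^*$ is a tree of vertex representatives isomorphic to $T^*$ and $S^*$ is a tree of edge representatives; the fundamental group $\pi_1(\mathcal{G})\cong\Gamma$ has the presentation with generators the groups $\mathcal{G}(x^* )$ ($x^*\in Y^*$) and the elements $g_e$ ($e\in E(Y^* )$), and relations (besides those of the groups $\mathcal G(x^* )$) $g_e\alpha_e(s)g_e^{-1}=g_{\bar e}\alpha_{\bar e}(s)g_{\bar e}^{-1}$ ($e\in E(Y^* )$, $s\in\mathcal{G}(e)$) and $g_e=1$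 whenever $\partial_0^{X^*}e\in T_0^*$; moreover $g_e^{-1}\partial_0^{X^*}e\in T_0^*$ for $e\in E(S^* )$; (S2) elements $\theta_{g_e}\in\mathrm{Aut}^+(\Lambda_0)$ and $\mu_{g_e}\in\Lambda_0$ ($e\in E(Y^* )$), homomorphisms $\theta^{x^*}:\mathcal{G}(x^* )\to\mathrm{Aut}^+(\Lambda_0)$ and functions $\mu^{x^*}:\mathcal{G}(x^* )\to\Lambda_0$ ($x^*\in Y^*$); (S3) $\Lambda_0$-trees $X(x^* )$ ($x^*\in Y^*$); (S4) $\theta^{x^*}$-affine actions of $\mathcal{G}(x^* )$ on $X(x^* )$ ($x^*\in Y^*$); (S5) ends $\epsilon_e$ of $X(\partial_0^{Y^*}e)$ and end maps $\delta_e=\delta_e^{Y^*}:X(\partial_0^{Y^*}e)\to\Lambda_0$ towards $\epsilon_e$ ($e\in E(Y^* )$). These data satisfy: (C1) $\epsilon_e$ is of full $\Lambda_0$-type and $(\mathcal{G}(x^* ))_{\epsilon_e}=\alpha_e\mathcal{G}(e)$ for $e\in E(Y^* )$ with $\partial_0^{Y^*}e=x^*$; (C2) if $e,f\in E(Y^* )$ with $x^*=\partial_0^{Y^*}e=\partial_0^{Y^*}f$ then $\epsilon_e$ and $\epsilon_f$ are in distinct $\mathcal{G}(x^* )$-orbits unless $e=f$; (C3) $\theta_{g_e}\theta_{\alpha_e(s)}\theta_{g_e}^{-1}=\theta_{g_{\bar e}}\theta_{\alpha_{\bar e}(s)}\theta_{g_{\bar e}}^{-1}$ for $e\in E(Y^*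 )$, $s\in\mathcal{G}(e)$, and $\theta_{g_e}=1$ if $g_e=1$; (C4) $\mu_{g_e}+\theta_{g_e}\mu_{\alpha_e(s)}-\theta_{g_e}\theta_{\alpha_e(s)}\theta_{g_e}^{-1}\mu_{g_e}=\mu_{\alpha_{|e|}(s)}$ for $e\in E(Y^* )$, $s\in\mathcal{G}(e)$; also $\mu_{gh}=\mu_g+\theta_g\mu_h$ for $g,h\in\mathcal{G}(x^* )$, $x^*\in Y^*$, and $\mu_{g_e}=0$ if $g_e=1$; (C5) $\theta_{g_e}\left[\theta_{\alpha_e(s)}\delta_e(x)-\delta_e(\alpha_e(s)x)\right]+\theta_{g_{\bar e}}\left[\theta_{\alpha_{\bar e}(s)}\delta_{\bar e}(y)-\delta_{\bar e}(\alpha_{\bar e}(s)y)\right]=\mu_{\alpha_{|e|}(s)}$ for all $x\in X(\partial_0^{Y^*}e)$, $y\in X(\partial_0^{Y^*}\bar e)$, $s\in\mathcal{G}(e)$, $e\in E(Y^* )$. Here $\theta_{\alpha_e(s)}=\theta^{\partial_0^{Y^*}e}_{\alpha_e(s)}$, $\mu_{\alpha_e(s)}=\mu^{\partial_0^{Y^*}e}_{\alpha_e(s)}$, and similarly for $\bar e$.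
   Context: Ordered abelian groups are linearly ordered; products are lexicographically ordered, first coordinate dominant; $\mathrm{Aut}^+$ denotes the group of order-preserving group automorphisms. The formula for $\beta_g(1,\lambda_0)$ determines $\beta_g$: $\beta_g(m,\lambda_0)=(m,\theta_g\lambda_0+m\mu_g)$. Trees. A $\Lambda$-metric space is a set with a $\Lambda$-valued function $d$ satisfying the metric axioms; a segment is an isometric image of an interval $[a,b]_\Lambda$; a $\Lambda$-tree is a $\Lambda$-metric space in which any two points are endpoints of a segment, two segments with a common endpoint meet in a segment, and two segments meeting in exactly one point, an endpoint of both, have union a segment. An action is $\beta$-affine if $d(gx,gy)=\beta_gd(x,y)$ for all $g,x,y$. Ends. An $X$-ray from $x$ is a linear subtree with $x$ as an endpoint, maximal among such; two rays are equivalent if their intersection is a ray from some point; ends are equivalence classes; $[x,\epsilon)$ is the ray from $x$ in the class $\epsilon$. An end $\epsilon$ of a $\Lambda_0$-tree is of full $\Lambda_0$-type if $\{d(x,y):y\in[x,\epsilon)\}=[0,\infty)_{\Lambda_0}$. An end map towards $\epsilon$ is a function $\delta$ to $\Lambda_0$ with $\delta(y)-\delta(x)=d(x,y)$ whenever $y\in[x,\epsilon)$. $G_\epsilon$ denotes the stabiliser of $\epsilon$ in $G$. The tree $X^*$. For $\Lambda=\mathbb{Z}\times\Lambda_0$ and a $\Lambda$-tree $X$, $X^*=\mathbb{Z}\otimes_\Lambda X$ is the quotient of $X$ identifying points whose distance lies in $0\times\Lambda_0$; it is a $\mathbb{Z}$-tree, viewed as an ordinary (simplicial) tree. The fibre $X(x^*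 )$ over $x^*\in X^*$ is a $\Lambda_0$-tree with metric $d_{x^*}$ given by $d(x,y)=(0,d_{x^*}(x,y))$. Graphs. $E(Y)$ is the set of oriented edges of a graph $Y$; $\bar e$ is the reverse of $e$ and $\partial_0e$ the origin of $e$; $Y$ also denotes the vertex set. If $\Gamma$ acts on a tree $X^*$ without inversions with quotient $Y^*$, a tree of vertex representatives is a subtree $T_0^*\subseteq X^*$ mapping isomorphically onto a maximal subtree $T^*$ of $Y^*$; a tree of edge representatives is a subtree $S^*\supseteq T_0^*$ such that $E(S^* )\to E(Y^* )$ is a bijection (each edge of $S^*$ has at least one endpoint in $T_0^*$). Vertices of $Y^*$ are identified with those of $T_0^*$, and $E(Y^* )$ with $E(S^* )$; $\partial_0^{X^*}e$ is the origin in $X^*$ of $e\in E(S^* )$, and $\partial_0^{Y^*}e$ its origin in $Y^*$ (identified with a vertex of $T_0^*$). If $\partial_0^{X^*}e\in T_0^*$ and $\partial_0^{X^*}\bar e\notin T_0^*$ put $|e|=|\bar e|=e$; if both lie in $T_0^*$, $|e|=|\bar e|$ denotes a fixed choice of one of $e,\bar e$ (then $\alpha_e(s)$ and $\alpha_{\bar e}(s)$ are identified in $\Gamma$). Signature of an action. Given a group $\Gamma$, a homomorphism $\beta:\Gamma\to\mathrm{Aut}^+(\Lambda)$ with $\beta_g(1,\lambda_0)=(1,\theta_g(\lambda_0)+\mu_g)$, and a $\beta$-affine action of $\Gamma$ on a $\Lambda$-tree $X$ whose induced action on $X^*$ is without inversions, with quotient graph $Y^*$, a signature consists of data obtained as follows.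 Choose a tree of vertex representatives $T_0^*\subseteq X^*$ (a subtree mapping isomorphically onto a maximal subtree $T^*$ of $Y^*$) and a tree of edge representatives $S^*$ with $T_0^*\subseteq S^*\subseteq X^*$ (a subtree such that $E(S^* )\to E(Y^* )$ is a bijection), and $g_e\in\Gamma$ ($e\in E(S^* )$) with $g_e^{-1}\partial_0^{X^*}e\in T_0^*$ and $g_e=1$ if $\partial_0^{X^*}e\in T_0^*$; thus $\partial_0^{Y^*}e=g_e^{-1}\partial_0^{X^*}e$. Put $\mathcal{G}(x^* )=\Gamma_{x^*}$, $\mathcal{G}(e)=\Gamma_e$ (stabilisers), $\alpha_e(s)=g_e^{-1}sg_e$; $\theta^{x^*},\mu^{x^*}$ are the restrictions to $\mathcal{G}(x^* )$ of $g\mapsto\theta_g$, $g\mapsto\mu_g$; $\theta_{g_e},\mu_{g_e}$ are the values at $g_e$; $X(x^* )$ is the fibre with metric $d_{x^*}$ and the restricted action. For $e\in E(S^* )$, $\epsilon_e=g_e^{-1}\epsilon_e^{X^*}$, where $\epsilon_e^{X^*}$ is the end of $X(\partial_0^{X^*}e)$ with $[x,y]\cap X(\partial_0^{X^*}e)=[x,\epsilon_e^{X^*})$ for $x\in X(\partial_0^{X^*}e)$, $y\in X(\partial_0^{X^*}\bar e)$. The $\delta_e$ are end maps towards $\epsilon_e$ such that $d(x,y)=\bigl(1,-\theta_{g_e}\delta_e(g_e^{-1}x)-\theta_{g_{\bar e}}\delta_{\bar e}(g_{\bar e}^{-1}y)\bigr)$ for all $e\in E(S^* )$, $x\in X(\partial_0^{X^*}e)$,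 $y\in X(\partial_0^{X^*}\bar e)$.
   Formalization: Λ0 is assumed nontrivial (for Λ0 = 0, C1 and C2 fail), Λ-trees are nonempty, and two rays count as equivalent only if their intersection is a ray that is a final part of both, since the condition as worded is not transitive when there are terminal points. *)

(* Defs.v *)
From HB Require Import structures.
From mathcomp Require Import all_boot all_order all_algebra generic_quotient.
From mathcomp Require Import boolp classical_sets functions.

Set Implicit Arguments.
Unset Strict Implicit.
Unset Printing Implicit Defensive.
Import Order.TTheory GRing.Theory.
Local Open Scope classical_set_scope.
Local Open Scope ring_scope.

Record oagType := OAG {
  oag_sort :> porderZmodType;
  oag_total : total (<=%O : rel oag_sort);
  oag_leD2r : forall x y z : oag_sort, x <= y -> x + z <= y + z
}.

Definition oabs (L : oagType) (x : L) : L := Order.max x (- x).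

Definition zlex_type (L : oagType) : Type := (int *lexi[ring_display] L)%type.

Section ZLex.
Variable L : oagType.

HB.instance Definition _ := Order.POrder.copy (zlex_type L)
  (int *lexi[ring_display] L)%type.
HB.instance Definition _ := GRing.Zmodule.copy (zlex_type L) (int * L)%type.

Lemma zlex_leE (x y : zlex_type L) :
  (x <= y) = (x.1 <= y.1) && ((y.1 <= x.1) ==> (x.2 <= y.2)).
Proof. by []. Qed.

Fact zlex_total : total (<=%O : rel (zlex_type L)).
Proof.
move=> x y; rewrite !zlex_leE.
case: (ltgtP x.1 y.1) => //= _; exact: oag_total.
Qed.

Fact zlex_leD2r (x y z : zlex_type L) : x <= y -> x + z <= y + z.
Proof.
rewrite !zlex_leE /= !Num.Theory.lerD2r => /andP[-> /=].
by case: (y.1 <= x.1) => //=; exact: oag_leD2r.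
Qed.

Canonical zlex : oagType := OAG zlex_total zlex_leD2r.

Definition zpair (n : int) (l : L) : zlex := (n, l).

End ZLex.

Record oaut (L : oagType) := OAut {
  oaut_fun :> L -> L;
  oaut_inv : L -> L;
  oautK : cancel oaut_fun oaut_inv;
  oautVK : cancel oaut_inv oaut_fun;
  oautD : {morph oaut_fun : x y / x + y};
  oaut_le : {homo oaut_fun : x y / x <= y}
}.

Section OAut.
Variable L : oagType.
Implicit Types f g h : oaut L.

Lemma oautP f g : f =1 g -> f = g.
Proof.
case: f g => [f f' fK f'K fD fle] [g g' gK g'K gD gle] /= /funext efg.
rewrite -efg in gK g'K gD gle *.
have ef' : f' = g' by apply/funext => x; rewrite -[in LHS](g'K x) fK.
rewrite -ef' in gK g'K *.
by rewrite (Prop_irrelevance fK gK) (Prop_irrelevance f'K g'K)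
  (Prop_irrelevance fD gD) (Prop_irrelevance fle gle).
Qed.

Definition oaut_one : oaut L :=
  @OAut L id id (fun=> erefl) (fun=> erefl) (fun _ _ => erefl) (fun _ _ => id).

Fact oaut_mulD f g : {morph f \o g : x y / x + y}.
Proof. by move=> x y /=; rewrite !oautD. Qed.

Fact oaut_mul_le f g : {homo f \o g : x y / x <= y}.
Proof. by move=> x y /= xy; do 2!apply: oaut_le. Qed.

Definition oaut_mul f g : oaut L := OAut (can_comp (@oautK _ f) (@oautK _ g))
  (can_comp (@oautVK _ g) (@oautVK _ f)) (@oaut_mulD f g) (@oaut_mul_le f g).

Fact oaut_invD f : {morph oaut_inv f : x y / x + y}.
Proof.
by move=> x y; rewrite -{1}(oautVK f x) -{1}(oautVK f y) -oautD oautK.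
Qed.

Fact oaut_inv_le f : {homo oaut_inv f : x y / x <= y}.
Proof.
move=> x y xy; case/orP: (oag_total (oaut_inv f x) (oaut_inv f y)) => // yx.
have /= := oaut_le f yx; rewrite !oautVK => yx'.
by rewrite (@le_anti _ _ x y) ?xy.
Qed.

Definition oaut_V f : oaut L :=
  OAut (@oautVK _ f) (@oautK _ f) (@oaut_invD f) (@oaut_inv_le f).

HB.instance Definition _ := gen_eqMixin (oaut L).
HB.instance Definition _ := gen_choiceMixin (oaut L).

Fact oaut_mulA : associative oaut_mul.
Proof. by move=> f g h; apply: oautP. Qed.
Fact oaut_mul1 : left_id oaut_one oaut_mul.
Proof. by move=> f; apply: oautP. Qed.
Fact oaut_mulr1 : right_id oaut_one oaut_mul.
Proof. by move=> f; apply: oautP. Qed.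
Fact oaut_mulV : left_inverse oaut_one oaut_V oaut_mul.
Proof. by move=> f; apply: oautP => x /=; exact: oautK. Qed.
Fact oaut_mulrV : right_inverse oaut_one oaut_V oaut_mul.
Proof. by move=> f; apply: oautP => x /=; exact: oautVK. Qed.

HB.instance Definition _ := isGroup.Build (oaut L)
  oaut_mulA oaut_mul1 oaut_mulr1 oaut_mulV oaut_mulrV.

Lemma oaut0 f : f 0 = 0.
Proof. by apply: (@addIr _ (f 0)); rewrite -oautD !add0r. Qed.

Lemma oautN f x : f (- x) = - f x.
Proof. by apply: (@addIr _ (f x)); rewrite -oautD !addNr oaut0. Qed.

Lemma oautMn f x n : f (x *+ n) = f x *+ n.
Proof. by elim: n => [|n IHn]; rewrite ?mulr0n ?oaut0 // !mulrS oautD IHn. Qed.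

End OAut.

Section OAutZLex.
Variables (L : oagType) (b : oaut (zlex L)).

(* $0\times\Lambda_0$ is the largest proper convex subgroup, so it is preserved
   and $\mathbb{Z}$ only has the trivial order-preserving automorphism. *)
Let fstM (x : zlex L) n : (x *+ n).1 = x.1 *+ n.
Proof. by elim: n => // n IHn; rewrite !mulrS /= IHn. Qed.

Let sndM (x : zlex L) n : (x *+ n).2 = x.2 *+ n.
Proof. by elim: n => // n IHn; rewrite !mulrS /= IHn. Qed.

Let zlexP (x y : zlex L) : x.1 = y.1 -> x.2 = y.2 -> x = y.
Proof. by case: x y => [? ?] [? ?] /= -> ->. Qed.

Let fst0_ge0 (l : L) : 0 <= l -> (b (zpair 0 l)).1 = 0.
Proof.
move=> l0; set x := zpair 0 l; set K := (b (zpair 1 0)).1.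
have : (0 : zlex L) <= x by rewrite zlex_leE /= l0.
move=> /(oaut_le b); rewrite oaut0 zlex_leE => /andP[/= bx0 _].
apply/eqP; rewrite eq_le bx0 andbT; apply: contraT; rewrite -Order.TotalTheory.ltNge => bx1.
have : x *+ (absz K).+1 <= zpair 1 0 by rewrite zlex_leE fstM /= mul0rn.
move=> /(oaut_le b); rewrite oautMn zlex_leE fstM => /andP[+ _]; rewrite -/K.
rewrite leNgt => /negP; case; rewrite -/x.
apply: (@lt_le_trans _ _ (`|K|.+1%:Z)); last first.
  by rewrite -mulr_natr mulrC -{1}[_%:Z]mulr1 natz Num.Theory.ler_wpM2l.
by rewrite (le_lt_trans (Num.Theory.ler_norm K)) // -abszE ltz_nat.
Qed.

Let fst0 (l : L) : (b (zpair 0 l)).1 = 0.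
Proof.
case/orP: (oag_total 0 l) => [|l0]; first exact: fst0_ge0.
have -> : zpair 0 l = - zpair 0 (- l) by apply: zlexP; rewrite /= ?oppr0 ?opprK.
rewrite oautN /= fst0_ge0 ?oppr0 //.
by have := oag_leD2r (- l) l0; rewrite subrr add0r.
Qed.

Let fstE (x : zlex L) : (b x).1 = (b (zpair 1 0)).1 * x.1.
Proof.
have -> : x = zpair x.1 0 + zpair 0 x.2.
  by apply: zlexP; rewrite /= ?addr0 ?add0r.
rewrite oautD /= fst0 !addr0.
have P n : (b (zpair n%:Z 0)).1 = (b (zpair 1 0)).1 * n%:Z.
  have -> : zpair n%:Z (0 : L) = zpair 1 0 *+ n.
    by apply: zlexP; rewrite ?fstM ?sndM /= ?mul0rn ?natz.
  by rewrite oautMn fstM -mulr_natr natz.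
move: (x.1) => m; case: m => n; first exact: P.
rewrite NegzE.
have -> : zpair (- n.+1%:Z) (0 : L) = - zpair n.+1%:Z (0 : L).
  by apply: zlexP => //=; rewrite oppr0.
rewrite oautN.
have -> : (- b (zpair n.+1%:Z 0)).1 = - (b (zpair n.+1%:Z 0)).1 by [].
by rewrite P mulrN.
Qed.

Lemma oaut_zlex_fst (x : zlex L) : (b x).1 = x.1.
Proof.
rewrite fstE; set k := (b _).1.
have k0 : 0 <= k.
  have : (0 : zlex L) <= zpair 1 0 by rewrite zlex_leE.
  by move=> /(oaut_le b); rewrite oaut0 zlex_leE => /andP[].
have /esym : (b (oaut_inv b (zpair 1 0))).1 = 1 by rewrite oautVK.
rewrite fstE -/k; case: (k) k0 => // n _ nE.
suff -> : n = 1%N by rewrite mul1r.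
have /(congr1 absz) := nE; rewrite abszM /= => /esym/eqP.
by rewrite muln_eq1 => /andP[/eqP].
Qed.

End OAutZLex.

(* Everything is relative to a subset [A] of an ambient type, on which alone the
   values of [d] matter, so that a fibre of [X] is just a subset of [X]. *)
Section Trees.
Variables (L : oagType) (X : Type) (A : set X) (d : X -> X -> L).
Implicit Types (S B : set X) (x y z : X).

Record is_lmetric : Prop := IsLMetric {
  lmetric_neq0 : A !=set0;
  lmetric_ge0 : forall x y, A x -> A y -> 0 <= d x y;
  lmetric_eq0 : forall x y, A x -> A y -> (d x y = 0 <-> x = y);
  lmetric_sym : forall x y, A x -> A y -> d x y = d y x;
  lmetric_triangle : forall x y z, A x -> A y -> A z -> d x z <= d x y + d y z
}.

Definition segment_between x y S : Prop :=
  exists (a b : L) (f : L -> X), let I := [set t | a <= t <= b] in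
    [/\ a <= b, f @` I `<=` A,
        forall s t, I s -> I t -> d (f s) (f t) = oabs (s - t),
        f a = x /\ f b = y & S = f @` I].

Definition is_segment S : Prop := exists x y, segment_between x y S.

Record is_ltree : Prop := IsLTree {
  ltree_metric : is_lmetric;
  ltree_segment : forall x y, A x -> A y -> exists S, segment_between x y S;
  ltree_meet : forall x y z S S', segment_between x y S ->
    segment_between x z S' -> is_segment (S `&` S');
  ltree_join : forall x y z S S', segment_between x y S ->
    segment_between x z S' -> S `&` S' = [set x] -> is_segment (S `|` S')
}.

(* In a tree the segment with given endpoints is unique. *)
Definition seg x y : set X := [set z | exists2 S, segment_between x y S & S z].

Definition ltree_subtree B : Prop :=
  [/\ B `<=` A, B !=set0 & forall x y, B x -> B y -> seg x y `<=` B].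

Definition linear B : Prop :=
  exists phi : X -> L, forall x y, B x -> B y -> d x y = oabs (phi x - phi y).

Definition endpoint B x : Prop :=
  B x /\ forall y z, B y -> B z -> seg y z x -> x = y \/ x = z.

Definition linear_from x B : Prop := [/\ ltree_subtree B, linear B & endpoint B x].

Definition is_ray x B : Prop :=
  linear_from x B /\ forall C, linear_from x C -> B `<=` C -> C = B.

(* A ray is represented by its origin together with its underlying set. *)
Definition ray_tail (r : X * set X) w : set X := [set z | r.2 z /\ seg r.1 z w].

(* The common ray must be a final part of both rays.  This only matters when an
   origin is a terminal point of the tree: a segment joining two terminal
   points is, as a set, a ray from each of them, and these are to define
   different ends. *)
Definition ray_equiv (r s : X * set X) : Prop :=
  exists w, [/\ is_ray w (r.2 `&` s.2), r.2 `&` s.2 = ray_tail r w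
              & r.2 `&` s.2 = ray_tail s w].

Definition is_end (eps : set (X * set X)) : Prop :=
  exists r, is_ray r.1 r.2 /\ eps = [set s | is_ray s.1 s.2 /\ ray_equiv r s].

End Trees.

Section Ends.
Variables (L : oagType) (X : Type) (A : set X) (d : X -> X -> L).

(* $[x,\epsilon)$ *)
Definition ray_to (eps : set (X * set X)) (x : X) : set X :=
  [set y | exists2 B, eps (x, B) & B y].

Definition full_type (eps : set (X * set X)) : Prop :=
  forall x, A x -> d x @` ray_to eps x = [set l | 0 <= l].

Definition is_end_map (eps : set (X * set X)) (delta : X -> L) : Prop :=
  forall x y, A x -> ray_to eps x y -> delta y - delta x = d x y.

Definition end_image (f : X -> X) (eps : set (X * set X)) : set (X * set X) :=
  (fun r => (f r.1, f @` r.2)) @` eps.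

End Ends.

Record ltree (L : oagType) := LTree {
  ltree_pt :> Type;
  dist : ltree_pt -> ltree_pt -> L;
  ltreeP : is_ltree [set: ltree_pt] dist
}.

Record affine_action (L : oagType) (Gamma : groupType)
    (beta : {multiplicative Gamma -> oaut L}) (X : ltree L) := AffineAction {
  aact :> Gamma -> X -> X;
  aact1 : forall x, aact 1%g x = x;
  aactM : forall g h x, aact (g * h)%g x = aact g (aact h x);
  aact_affine : forall g x y, dist (aact g x) (aact g y) = beta g (dist x y)
}.

Record graph := Graph {
  vert : Type;
  edge : Type;
  orig : edge -> vert;
  erev : edge -> edge;
  erevK : involutive erev;
  erev_neq : forall e, erev e <> e
}.
Arguments orig {g} e.
Arguments erev {g} e.

Record subgraph (Y : graph) := Subgraph {
  sv : set (vert Y);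
  se : set (edge Y);
  se_orig : forall e, se e -> sv (orig e);
  se_rev : forall e, se e -> se (erev e)
}.

Section GraphTrees.
Variable Y : graph.
Implicit Types T : subgraph Y.

Definition full_subgraph : subgraph Y :=
  @Subgraph Y setT setT (fun _ _ => I) (fun _ _ => I).

Definition sub_subgraph T T' : Prop := sv T `<=` sv T' /\ se T `<=` se T'.

Fixpoint walk T (u : vert Y) (p : seq (edge Y)) (w : vert Y) : Prop :=
  if p is e :: p' then [/\ se T e, orig e = u & walk T (orig (erev e)) p' w]
  else sv T u /\ u = w.

Definition reduced (p : seq (edge Y)) : Prop :=
  forall p1 e p2, p <> p1 ++ [:: e; erev e] ++ p2.

Definition is_subtree T : Prop :=
  [/\ sv T !=set0,
      forall u w, sv T u -> sv T w -> exists p, walk T u p w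
    & forall u p, reduced p -> walk T u p u -> p = [::]].

Definition maximal_subtree T : Prop :=
  is_subtree T /\ forall T', is_subtree T' -> sub_subgraph T T' -> sub_subgraph T' T.

End GraphTrees.

Definition is_tree (Y : graph) : Prop := is_subtree (full_subgraph Y).

Record gaction (Gamma : groupType) (Y : graph) := GAction {
  vact : Gamma -> vert Y -> vert Y;
  eact : Gamma -> edge Y -> edge Y;
  vact1 : forall v, vact 1%g v = v;
  vactM : forall g h v, vact (g * h)%g v = vact g (vact h v);
  eact1 : forall e, eact 1%g e = e;
  eactM : forall g h e, eact (g * h)%g e = eact g (eact h e);
  eact_orig : forall g e, orig (eact g e) = vact g (orig e);
  eact_rev : forall g e, erev (eact g e) = eact g (erev e)
}.

Section QuotientGraph.
Variables (Gamma : groupType) (Y : graph) (a : gaction Gamma Y).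

Definition without_inversions : Prop := forall g e, eact a g e <> erev e.

Hypothesis a_wi : without_inversions.

Definition vorbit (v : vert Y) : set (vert Y) := range (vact a ^~ v).
Definition eorbit (e : edge Y) : set (edge Y) := range (eact a ^~ e).

Definition qvert : Type := {O : set (vert Y) | exists v, O = vorbit v}.
Definition qedge : Type := {O : set (edge Y) | exists e, O = eorbit e}.

Definition vproj (v : vert Y) : qvert := exist _ (vorbit v) (ex_intro _ v erefl).
Definition eproj (e : edge Y) : qedge := exist _ (eorbit e) (ex_intro _ e erefl).

Fact orig_eorbit e : orig @` eorbit e = vorbit (orig e).
Proof.
apply/seteqP; split=> [_ [_ [g _ <-] <-]|_ [g _ <-]].
  by exists g => //; rewrite eact_orig.
by exists (eact a g e); [exists g | rewrite eact_orig].
Qed.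

Fact rev_eorbit e : erev @` eorbit e = eorbit (erev e).
Proof.
apply/seteqP; split=> [_ [_ [g _ <-] <-]|_ [g _ <-]].
  by exists g => //; rewrite eact_rev.
by exists (eact a g e); [exists g | rewrite eact_rev].
Qed.

Fact qorig_subproof (E : qedge) : exists v, orig @` sval E = vorbit v.
Proof. by case: E => O [e eO]; exists (orig e); rewrite /= eO orig_eorbit. Qed.

Fact qrev_subproof (E : qedge) : exists e, erev @` sval E = eorbit e.
Proof. by case: E => O [e eO]; exists (erev e); rewrite /= eO rev_eorbit. Qed.

Definition qorig (E : qedge) : qvert := exist _ _ (qorig_subproof E).
Definition qrev (E : qedge) : qedge := exist _ _ (qrev_subproof E).

Fact qrevK : involutive qrev.
Proof.
case=> O [e eO]; apply: eq_exist => /=.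
by rewrite eO !rev_eorbit erevK.
Qed.

Fact qrev_neq E : qrev E <> E.
Proof.
case: E => O [e eO] /(congr1 sval) /=; rewrite eO rev_eorbit => /seteqP[+ _].
move=> /(_ (erev e)) []; first by exists 1%g; rewrite ?eact1.
by move=> g _ /a_wi.
Qed.

Definition quotient_graph : graph := Graph qorig qrevK qrev_neq.

End QuotientGraph.

(* The letter [(a, false)] stands for the generator [a], [(a, true)] for its
   inverse. *)
Definition word (A : Type) : Type := seq (A * bool).
HB.instance Definition _ (A : Type) := gen_eqMixin (word A).
HB.instance Definition _ (A : Type) := gen_choiceMixin (word A).

Section Presentation.
Variables (A : Type) (R : word A -> word A -> Prop).
Implicit Types u v w : word A.

Inductive pres_eq : word A -> word A -> Prop :=
| pres_refl u : pres_eq u u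
| pres_sym u v : pres_eq u v -> pres_eq v u
| pres_trans u v w : pres_eq u v -> pres_eq v w -> pres_eq u w
| pres_cat u u' v v' : pres_eq u u' -> pres_eq v v' -> pres_eq (u ++ v) (u' ++ v')
| pres_cancel a b : pres_eq [:: (a, b); (a, ~~ b)] [::]
| pres_rel u v : R u v -> pres_eq u v.

Definition pres_eqb : rel (word A) := fun u v => `[< pres_eq u v >].

Fact pres_eqb_equiv : equiv_class_of pres_eqb.
Proof.
split=> [u|u v|v u w]; first exact/asboolP/pres_refl.
  by apply/asbool_equiv_eq; split; apply: pres_sym.
by move=> /asboolP uv /asboolP vw; apply/asboolP; apply: pres_trans uv vw.
Qed.

Canonical pres_equiv := EquivRelPack pres_eqb_equiv.

Definition presented : Type := {eq_quot pres_equiv}%qT.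
HB.instance Definition _ := Choice.on presented.

Definition pcls (u : word A) : presented := (\pi_({eq_quot pres_equiv}) u)%qT.

Lemma pclsP u v : pcls u = pcls v <-> pres_eq u v.
Proof.
split=> [/eqquotP/asboolP//|uv]; exact/eqquotP/asboolP.
Qed.

Definition prepr (p : presented) : word A := repr (p : {eq_quot pres_equiv}%qT).

Lemma preprK p : pcls (prepr p) = p. Proof. exact: reprK. Qed.

Lemma prepr_eq u : pres_eq (prepr (pcls u)) u.
Proof. by apply/pclsP; rewrite preprK. Qed.

Definition winv u : word A := [seq (l.1, ~~ l.2) | l <- rev u].

Lemma winv_cat u v : winv (u ++ v) = winv v ++ winv u.
Proof. by rewrite /winv rev_cat map_cat. Qed.

Lemma winvK : involutive winv.
Proof.
elim=> [|[a b] u IHu] //; rewrite -cat1s winv_cat winv_cat IHu.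
by rewrite /winv /= negbK.
Qed.

Lemma pres_mulwV u : pres_eq (u ++ winv u) [::].
Proof.
elim: u => [|[a b] u IHu]; first exact: pres_refl.
rewrite -cat1s winv_cat -catA (catA u).
apply: (@pres_trans _ ([:: (a, b)] ++ [::] ++ winv [:: (a, b)])).
  by apply: pres_cat (pres_refl _) (pres_cat IHu (pres_refl _)).
exact: pres_cancel.
Qed.

Lemma pres_mulVw u : pres_eq (winv u ++ u) [::].
Proof. by rewrite -{2}(winvK u); exact: pres_mulwV. Qed.

Lemma pres_winv u v : pres_eq u v -> pres_eq (winv u) (winv v).
Proof.
move=> uv; have e0 : pres_eq (winv u ++ (v ++ winv v)) (winv u).
  by rewrite -[X in pres_eq _ X]cats0; apply: pres_cat (pres_mulwV v); exact: pres_refl.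
apply: pres_trans (pres_sym e0) _; rewrite catA -[X in pres_eq _ X]cat0s.
apply: pres_cat (pres_refl _); apply: pres_trans (pres_mulVw u).
by apply: pres_cat (pres_sym uv); exact: pres_refl.
Qed.

Definition pres_one : presented := pcls [::].
Definition pres_mul p q : presented := pcls (prepr p ++ prepr q).
Definition pres_inv p : presented := pcls (winv (prepr p)).

Lemma pcls_cat u v : pcls (u ++ v) = pres_mul (pcls u) (pcls v).
Proof.
by apply/pclsP/pres_sym; apply: pres_cat; exact: prepr_eq.
Qed.

Lemma pcls_winv u : pcls (winv u) = pres_inv (pcls u).
Proof. by apply/pclsP/pres_sym; apply: pres_winv; exact: prepr_eq. Qed.

Lemma presW (P : presented -> Prop) : (forall u, P (pcls u)) -> forall p, P p.
Proof. by move=> Pu p; rewrite -[p]preprK. Qed.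

Fact pres_mulA : associative pres_mul.
Proof.
by elim/presW=> u; elim/presW=> v; elim/presW=> w; rewrite -!pcls_cat catA.
Qed.
Fact pres_mul1 : left_id pres_one pres_mul.
Proof. by elim/presW=> u; rewrite -pcls_cat. Qed.
Fact pres_mulr1 : right_id pres_one pres_mul.
Proof. by elim/presW=> u; rewrite -pcls_cat cats0. Qed.
Fact pres_mulV : left_inverse pres_one pres_inv pres_mul.
Proof.
by elim/presW=> u; rewrite -pcls_winv -pcls_cat; apply/pclsP/pres_mulVw.
Qed.
Fact pres_mulrV : right_inverse pres_one pres_inv pres_mul.
Proof.
by elim/presW=> u; rewrite -pcls_winv -pcls_cat; apply/pclsP/pres_mulwV.
Qed.

HB.instance Definition _ := isGroup.Build presented
  pres_mulA pres_mul1 pres_mulr1 pres_mulV pres_mulrV.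

Definition pgen (a : A) : presented := pcls [:: (a, false)].

End Presentation.

Definition is_subgroup (Gamma : groupType) (H : set Gamma) : Prop :=
  [/\ H 1%g, forall s t, H s -> H t -> H (s * t)%g & forall s, H s -> H (s^-1)%g].

Definition lcos (P : groupType) (w : P) (C : set P) : set P :=
  [set (w * c)%g | c in C].

Lemma lcosM (P : groupType) (v w : P) C : lcos (v * w)%g C = lcos v (lcos w C).
Proof.
apply/seteqP; split=> [_ [c Cc <-]|_ [_ [c Cc <-] <-]].
  by rewrite -mulgA; exists (w * c)%g => //; exists c.
by exists c; rewrite ?mulgA.
Qed.

Lemma lcos1 (P : groupType) (C : set P) : lcos 1%g C = C.
Proof.
apply/seteqP; split=> [_ [c Cc <-]|c Cc]; first by rewrite mul1g.
by exists c; rewrite ?mul1g.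
Qed.

(* The vertex and edge groups are subgroups of an ambient group.  The
   embeddings are only meaningful on the edge groups. *)
Record graph_of_groups (Gamma : groupType) (Y : graph) := GraphOfGroups {
  vgrp : vert Y -> set Gamma;
  egrp : edge Y -> set Gamma;
  gemb : edge Y -> Gamma -> Gamma;
  vgrp_subgroup : forall x, is_subgroup (vgrp x);
  egrp_subgroup : forall e, is_subgroup (egrp e);
  egrp_rev : forall e, egrp (erev e) = egrp e;
  gemb_in : forall e s, egrp e s -> vgrp (orig e) (gemb e s);
  gembM : forall e s t, egrp e s -> egrp e t ->
    gemb e (s * t)%g = (gemb e s * gemb e t)%g;
  gemb_inj : forall e s t, egrp e s -> egrp e t -> gemb e s = gemb e t -> s = t
}.

Section FundamentalGroup.
Variables (Gamma : groupType) (Y : graph) (G : graph_of_groups Gamma Y).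
(* The edges whose generator is made trivial in the fundamental group. *)
Variable triv : set (edge Y).

Definition pi1_gen : Type :=
  ({p : vert Y * Gamma | vgrp G p.1 p.2} + edge Y)%type.

Definition vgen (x : vert Y) (s : Gamma) (xs : vgrp G x s) : pi1_gen :=
  inl (exist (fun p : vert Y * Gamma => vgrp G p.1 p.2) (x, s) xs).

Definition egen (e : edge Y) : pi1_gen := inr e.

Inductive pi1_rel : word pi1_gen -> word pi1_gen -> Prop :=
| pi1_rel_vgrp x s t (xs : vgrp G x s) (xt : vgrp G x t)
    (xst : vgrp G x (s * t)%g) :
    pi1_rel [:: (vgen xs, false); (vgen xt, false)] [:: (vgen xst, false)]
| pi1_rel_edge e s (es : vgrp G (orig e) (gemb G e s))
    (fs : vgrp G (orig (erev e)) (gemb G (erev e) s)) : egrp G e s ->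
    pi1_rel [:: (egen e, false); (vgen es, false); (egen e, true)]
      [:: (egen (erev e), false); (vgen fs, false); (egen (erev e), true)]
| pi1_rel_triv e : triv e -> pi1_rel [:: (egen e, false)] [::].

Definition pi1 : groupType := presented pi1_rel.

Definition pi1_vgrp x s (xs : vgrp G x s) : pi1 := pgen pi1_rel (vgen xs).
Definition pi1_edge e : pi1 := pgen pi1_rel (egen e).

Lemma pi1_vgrpM x s t (xs : vgrp G x s) (xt : vgrp G x t)
    (xst : vgrp G x (s * t)%g) :
  (pi1_vgrp xs * pi1_vgrp xt)%g = pi1_vgrp xst.
Proof.
rewrite -[LHS](pcls_cat pi1_rel [:: (vgen xs, false)] [:: (vgen xt, false)]).
by apply/pclsP/pres_rel; exact: pi1_rel_vgrp.
Qed.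

Lemma pi1_vgrp_eq x s t (xs : vgrp G x s) (xt : vgrp G x t) :
  s = t -> pi1_vgrp xs = pi1_vgrp xt.
Proof. by move=> st; case: _ / st xt => xt; rewrite (Prop_irrelevance xs xt). Qed.

Lemma pi1_vgrp1 x (x1 : vgrp G x 1%g) : pi1_vgrp x1 = 1%g.
Proof.
have x11 : vgrp G x (1 * 1)%g by rewrite mul1g.
apply: (@mulgI _ (pi1_vgrp x1)); rewrite mulg1 (pi1_vgrpM _ _ x11).
by apply: pi1_vgrp_eq; rewrite mul1g.
Qed.

Lemma pi1_edgeP e s (es : vgrp G (orig e) (gemb G e s))
    (fs : vgrp G (orig (erev e)) (gemb G (erev e) s)) : egrp G e s ->
  (pi1_edge e * pi1_vgrp es * (pi1_edge e)^-1 =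
   pi1_edge (erev e) * pi1_vgrp fs * (pi1_edge (erev e))^-1)%g.
Proof.
move=> Ges; pose c := @pcls _ pi1_rel.
have E f (k : vgrp G (orig f) (gemb G f s)) :
    (pi1_edge f * pi1_vgrp k * (pi1_edge f)^-1 : pi1)%g =
    c [:: (egen f, false); (vgen k, false); (egen f, true)].
  have -> : ((pi1_edge f)^-1)%g = c [:: (egen f, true)].
    by apply/esym; exact: (pcls_winv pi1_rel [:: (egen f, false)]).
  have -> : (pi1_edge f * pi1_vgrp k)%g = c [:: (egen f, false); (vgen k, false)].
    by apply/esym; exact: (pcls_cat pi1_rel [:: (egen f, false)]).
  by apply/esym; exact: (pcls_cat pi1_rel [:: (egen f, false); (vgen k, false)]).
by rewrite !E; apply/pclsP/pres_rel; exact: pi1_rel_edge.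
Qed.

Definition pi1_vsub x : set pi1 :=
  [set w | exists s (xs : vgrp G x s), w = pi1_vgrp xs].

(* The edge group of [e], embedded through either end of [e]. *)
Definition pi1_esub e : set pi1 :=
  [set w | exists s (es : egrp G e s),
     w = (pi1_edge e * pi1_vgrp (gemb_in es) * (pi1_edge e)^-1)%g].

Lemma pi1_esub_rev e : pi1_esub (erev e) = pi1_esub e.
Proof.
have sub f : pi1_esub f `<=` pi1_esub (erev f).
  move=> _ [s [fs ->]]; have fs' : egrp G (erev f) s by rewrite egrp_rev.
  by exists s, fs'; exact: pi1_edgeP.
by apply/seteqP; split; [rewrite -{2}(erevK e)|]; exact: sub.
Qed.

(* The vertices and edges of the Bass-Serre graph are the left cosets of the
   vertex and edge groups in the fundamental group; the edge $w\mathcal{G}(e)$ has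
   origin $wg_e\mathcal{G}(\partial_0e)$ and reverse $w\mathcal{G}(\bar e)$. *)
Definition bs_vert : Type :=
  {p : vert Y * set pi1 | exists w, p.2 = lcos w (pi1_vsub p.1)}.
Definition bs_edge : Type :=
  {p : edge Y * set pi1 | exists w, p.2 = lcos w (pi1_esub p.1)}.

Definition bs_orig_coset (e : edge Y) (C : set pi1) : set pi1 :=
  [set (c * pi1_edge e * k)%g | c in C & k in pi1_vsub (orig e)].

Fact bs_orig_cosetE e w :
  bs_orig_coset e (lcos w (pi1_esub e)) =
  lcos (w * pi1_edge e)%g (pi1_vsub (orig e)).
Proof.
apply/seteqP; split=> [_ [_ [_ [s [es ->] <-]] [_ [t [xt ->]]] <-]|].
  have [_ /(_ _ _ (gemb_in es) xt) xst _] := vgrp_subgroup G (orig e).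
  exists (pi1_vgrp xst); first by exists (gemb G e s * t)%g, xst.
  by rewrite -(pi1_vgrpM (gemb_in es) xt) !mulgA mulgVK.
move=> _ [_ [t [xt ->]] <-].
have [e1 _ _] := egrp_subgroup G e.
have g1 : gemb G e 1%g = 1%g.
  by apply: (@mulgI _ (gemb G e 1%g)); rewrite -gembM // !mulg1.
exists w; last by exists (pi1_vgrp xt) => //; exists t, xt.
exists 1%g; last by rewrite mulg1.
exists 1%g, e1.
have x1 : vgrp G (orig e) 1%g by rewrite -g1; exact: gemb_in.
by rewrite (pi1_vgrp_eq (gemb_in e1) x1 g1) pi1_vgrp1 mulg1 mulgV.
Qed.

Fact bs_orig_subproof (E : bs_edge) :
  exists w, bs_orig_coset (sval E).1 (sval E).2 =
            lcos w (pi1_vsub (orig (sval E).1)).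
Proof.
case: E => [[e C]] /= [w ->]; exists (w * pi1_edge e)%g.
exact: bs_orig_cosetE.
Qed.

Definition bs_orig (E : bs_edge) : bs_vert :=
  exist (fun p : vert Y * set pi1 => exists w, p.2 = lcos w (pi1_vsub p.1))
    (orig (sval E).1, bs_orig_coset (sval E).1 (sval E).2) (bs_orig_subproof E).

Fact bs_rev_subproof (E : bs_edge) :
  exists w, (sval E).2 = lcos w (pi1_esub (erev (sval E).1)).
Proof. by case: E => [[e C]] /= [w ->]; exists w; rewrite pi1_esub_rev. Qed.

Definition bs_rev (E : bs_edge) : bs_edge :=
  exist (fun p : edge Y * set pi1 => exists w, p.2 = lcos w (pi1_esub p.1))
    (erev (sval E).1, (sval E).2) (bs_rev_subproof E).

Fact bs_revK : involutive bs_rev.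
Proof. by case=> [[e C] wC]; apply: eq_exist => /=; rewrite erevK. Qed.

Fact bs_rev_neq E : bs_rev E <> E.
Proof. by case: E => [[e C] wC] /(congr1 (fun F => (sval F).1)) /= /erev_neq. Qed.

Definition bs_graph : graph := Graph bs_orig bs_revK bs_rev_neq.

Fact bs_vact_subproof (w : pi1) (v : bs_vert) :
  exists w', lcos w (sval v).2 = lcos w' (pi1_vsub (sval v).1).
Proof. by case: v => [[x C]] /= [u ->]; exists (w * u)%g; rewrite lcosM. Qed.

Definition bs_vact (w : pi1) (v : bs_vert) : bs_vert :=
  exist (fun p : vert Y * set pi1 => exists w, p.2 = lcos w (pi1_vsub p.1))
    ((sval v).1, lcos w (sval v).2) (bs_vact_subproof w v).

Fact bs_eact_subproof (w : pi1) (E : bs_edge) :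
  exists w', lcos w (sval E).2 = lcos w' (pi1_esub (sval E).1).
Proof. by case: E => [[e C]] /= [u ->]; exists (w * u)%g; rewrite lcosM. Qed.

Definition bs_eact (w : pi1) (E : bs_edge) : bs_edge :=
  exist (fun p : edge Y * set pi1 => exists w, p.2 = lcos w (pi1_esub p.1))
    ((sval E).1, lcos w (sval E).2) (bs_eact_subproof w E).

Fact bs_vact1 v : bs_vact 1%g v = v.
Proof. by case: v => [[x C] ?]; apply: eq_exist; rewrite /= lcos1. Qed.
Fact bs_vactM g h v : bs_vact (g * h)%g v = bs_vact g (bs_vact h v).
Proof. by apply: eq_exist; rewrite /= lcosM. Qed.
Fact bs_eact1 E : bs_eact 1%g E = E.
Proof. by case: E => [[e C] ?]; apply: eq_exist; rewrite /= lcos1. Qed.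
Fact bs_eactM g h E : bs_eact (g * h)%g E = bs_eact g (bs_eact h E).
Proof. by apply: eq_exist; rewrite /= lcosM. Qed.
Fact bs_eact_orig g E : bs_orig (bs_eact g E) = bs_vact g (bs_orig E).
Proof.
apply: eq_exist => /=; congr pair.
apply/seteqP; split=> [_ [_ [c Cc <-] [k Kk <-]]|_ [_ [c Cc [k Kk <-]] <-]].
  exists (c * pi1_edge (sval E).1 * k)%g; last by rewrite !mulgA.
  by exists c => //; exists k.
by exists (g * c)%g; [exists c | exists k => //; rewrite !mulgA].
Qed.
Fact bs_eact_rev g E : bs_rev (bs_eact g E) = bs_eact g (bs_rev E).
Proof. exact: eq_exist. Qed.

Definition bs_action : gaction pi1 bs_graph :=
  @GAction pi1 bs_graph bs_vact bs_eact bs_vact1 bs_vactM bs_eact1 bs_eactM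
    bs_eact_orig bs_eact_rev.

Fact bs_vbase_subproof x : exists w, pi1_vsub x = lcos w (pi1_vsub x).
Proof. by exists 1%g; rewrite lcos1. Qed.
Fact bs_ebase_subproof e : exists w, pi1_esub e = lcos w (pi1_esub e).
Proof. by exists 1%g; rewrite lcos1. Qed.

Definition bs_vbase (x : vert Y) : vert bs_graph :=
  exist (fun p : vert Y * set pi1 => exists w, p.2 = lcos w (pi1_vsub p.1))
    (x, pi1_vsub x) (bs_vbase_subproof x).
Definition bs_ebase (e : edge Y) : edge bs_graph :=
  exist (fun p : edge Y * set pi1 => exists w, p.2 = lcos w (pi1_esub p.1))
    (e, pi1_esub e) (bs_ebase_subproof e).

(* [Phi] identifies the fundamental group with [Gamma] through the given
   generators, and [Z] is equivariantly isomorphic to the Bass-Serre graph, the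
   base cosets corresponding to the chosen representatives in [Z]. *)
Definition is_bass_serre_tree (g : edge Y -> Gamma) (Z : graph)
    (a : gaction Gamma Z) (vrep : vert Y -> vert Z) (erep : edge Y -> edge Z) : Prop :=
  exists Phi : {multiplicative pi1 -> Gamma},
    [/\ bijective Phi,
        forall x s (xs : vgrp G x s), Phi (pi1_vgrp xs) = s,
        forall e, Phi (pi1_edge e) = g e
      & exists (Pv : vert bs_graph -> vert Z) (Pe : edge bs_graph -> edge Z),
        [/\ bijective Pv /\ bijective Pe,
            forall E, orig (Pe E) = Pv (orig E) /\ erev (Pe E) = Pe (erev E),
            forall w v, Pv (vact bs_action w v) = vact a (Phi w) (Pv v),
            forall w E, Pe (eact bs_action w E) = eact a (Phi w) (Pe E)
          & (forall x, Pv (bs_vbase x) = vrep x) /\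
            (forall e, Pe (bs_ebase e) = erep e)]].

End FundamentalGroup.

Section Xstar.
Variables (L0 : oagType) (X : ltree (zlex L0)).

(* A vertex of $\mathbb{Z}\otimes_\Lambda X$ is a class of points of [X] at
   distance in $0\times\Lambda_0$, so it is also the fibre over itself; the edges
   are the ordered pairs of vertices at distance 1. *)
Definition fibre (x : X) : set X := [set y | (dist x y).1 = 0].

Lemma dist1_triangle (x y z : X) :
  (dist x z).1 <= (dist x y).1 + (dist y z).1.
Proof.
have := lmetric_triangle (ltree_metric (ltreeP X)) (I : setT x) (I : setT y) (I : setT z).
by rewrite zlex_leE => /andP[].
Qed.

Lemma dist1_sym (x y : X) : (dist x y).1 = (dist y x).1.
Proof. by rewrite (lmetric_sym (ltree_metric (ltreeP X))). Qed.

Lemma dist1_refl (x : X) : (dist x x).1 = 0.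
Proof.
by have [_ ->] := lmetric_eq0 (ltree_metric (ltreeP X)) (I : setT x) (I : setT x).
Qed.

Definition xs_vert : Type := {v : set X | exists x, v = fibre x}.

Definition xs_proj (x : X) : xs_vert :=
  exist _ (fibre x) (ex_intro _ x erefl).

Definition xs_repr (v : xs_vert) : X :=
  sval (cid (svalP v)).

Definition xs_dist (v w : xs_vert) : int := (dist (xs_repr v) (xs_repr w)).1.

Lemma xs_dist_same (v : xs_vert) (x y : X) : sval v x -> sval v y -> (dist x y).1 = 0.
Proof.
case: v => _ /= [z ->]; rewrite /fibre /= => zx zy; apply/eqP; rewrite eq_le.
have := dist1_triangle x z y; rewrite (dist1_sym x z) zx zy addr0 => ->.
have := lmetric_ge0 (ltree_metric (ltreeP X)) (I : setT x) (I : setT y).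
by rewrite zlex_leE => /andP[].
Qed.

Lemma xs_repr_in (v : xs_vert) : sval v (xs_repr v).
Proof.
rewrite /xs_repr; case: (cid _) => x /= vx.
by rewrite vx /fibre /= dist1_refl.
Qed.

Lemma xs_distE (v w : xs_vert) (x y : X) : sval v x -> sval w y -> xs_dist v w = (dist x y).1.
Proof.
move=> vx wy; apply/eqP; rewrite eq_le /xs_dist.
set x' := xs_repr v; set y' := xs_repr w.
have xx' : (dist x x').1 = 0 by apply: xs_dist_same vx (xs_repr_in v).
have yy' : (dist y y').1 = 0 by apply: xs_dist_same wy (xs_repr_in w).
apply/andP; split.
  apply: le_trans (dist1_triangle x' x y') _; rewrite dist1_sym xx' add0r.
  by apply: le_trans (dist1_triangle x y y') _; rewrite yy' addr0.
apply: le_trans (dist1_triangle x x' y) _; rewrite xx' add0r.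
by apply: le_trans (dist1_triangle x' y' y) _; rewrite (dist1_sym y') yy' addr0.
Qed.

Definition xs_edge : Type := {p : xs_vert * xs_vert | xs_dist p.1 p.2 = 1}.

Definition xs_orig (e : xs_edge) : xs_vert := (sval e).1.

Fact xs_rev_subproof (e : xs_edge) : xs_dist (sval e).2 (sval e).1 = 1.
Proof. by case: e => [[v w]] /=; rewrite /xs_dist dist1_sym. Qed.

Definition xs_rev (e : xs_edge) : xs_edge :=
  exist (fun p : xs_vert * xs_vert => xs_dist p.1 p.2 = 1)
    ((sval e).2, (sval e).1) (xs_rev_subproof e).

Fact xs_revK : involutive xs_rev.
Proof. by case=> [[v w] vw]; exact: eq_exist. Qed.

Fact xs_rev_neq e : xs_rev e <> e.
Proof.
case: e => [[v w] vw] /(congr1 (fun e => (sval e).1)) /= wv.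
by move: vw; rewrite wv /= /xs_dist dist1_refl.
Qed.

Definition xs_graph : graph := Graph xs_orig xs_revK xs_rev_neq.

Variables (Gamma : groupType) (beta : {multiplicative Gamma -> oaut (zlex L0)}).
Variable a : affine_action beta X.

Lemma aactK g : cancel (a g) (a g^-1%g).
Proof. by move=> x; rewrite -aactM mulVg aact1. Qed.

Lemma aactVK g : cancel (a g^-1%g) (a g).
Proof. by move=> x; rewrite -aactM mulgV aact1. Qed.

Lemma aact_dist1 g (x y : X) : (dist (a g x) (a g y)).1 = (dist x y).1.
Proof. by rewrite aact_affine oaut_zlex_fst. Qed.

Fact xs_vact_subproof g (v : xs_vert) : exists x, a g @` sval v = fibre x.
Proof.
case: v => V [x Vx]; exists (a g x); rewrite /= Vx /fibre.
apply/seteqP; split=> [_ [y /= xy <-]|y /= xy]; first by rewrite /= aact_dist1.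
exists (a g^-1%g y); last exact: aactVK.
by rewrite /= -(aact_dist1 g) aactVK.
Qed.

Definition xs_vact g (v : xs_vert) : xs_vert := exist _ _ (xs_vact_subproof g v).

Lemma xs_dist_act g v w : xs_dist (xs_vact g v) (xs_vact g w) = xs_dist v w.
Proof.
have im u : sval (xs_vact g u) (a g (xs_repr u)).
  by exists (xs_repr u) => //; exact: xs_repr_in.
by rewrite (xs_distE (im v) (im w)) aact_dist1.
Qed.

Fact xs_eact_subproof g (e : xs_edge) :
  xs_dist (xs_vact g (sval e).1) (xs_vact g (sval e).2) = 1.
Proof. by rewrite xs_dist_act (svalP e). Qed.

Definition xs_eact g (e : xs_edge) : xs_edge :=
  exist (fun p : xs_vert * xs_vert => xs_dist p.1 p.2 = 1)
    (xs_vact g (sval e).1, xs_vact g (sval e).2) (xs_eact_subproof g e).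

Fact xs_vact1 v : xs_vact 1%g v = v.
Proof.
case: v => V vx; apply: eq_exist => /=.
by rewrite (_ : a 1%g = id) ?image_id //; apply/funext => x; rewrite aact1.
Qed.

Fact xs_vactM g h v : xs_vact (g * h)%g v = xs_vact g (xs_vact h v).
Proof.
apply: eq_exist => /=; rewrite image_comp; congr (_ @` _).
by apply/funext => x /=; rewrite aactM.
Qed.

Fact xs_eact1 e : xs_eact 1%g e = e.
Proof. by case: e => [[v w] vw]; apply: eq_exist; rewrite /= !xs_vact1. Qed.

Fact xs_eactM g h e : xs_eact (g * h)%g e = xs_eact g (xs_eact h e).
Proof. by apply: eq_exist; rewrite /= !xs_vactM. Qed.

Fact xs_eact_orig g e : xs_orig (xs_eact g e) = xs_vact g (xs_orig e).
Proof. by []. Qed.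

Fact xs_eact_rev g e : xs_rev (xs_eact g e) = xs_eact g (xs_rev e).
Proof. exact: eq_exist. Qed.

Definition xs_action : gaction Gamma xs_graph :=
  @GAction Gamma xs_graph xs_vact xs_eact xs_vact1 xs_vactM xs_eact1 xs_eactM
    xs_eact_orig xs_eact_rev.

End Xstar.

Section Signature.
Variables (L0 : oagType) (Gamma : groupType).
Variable beta : {multiplicative Gamma -> oaut (zlex L0)}.
Variables (theta : Gamma -> oaut L0) (mu : Gamma -> L0).
Variables (X : ltree (zlex L0)) (a : affine_action beta X).
Hypothesis a_wi : without_inversions (xs_action a).

Local Notation Xs := (xs_graph X).
Local Notation act := (xs_action a).
Local Notation Ys := (quotient_graph a_wi).

(* [vrep] and [erep] are the identifications of the vertices and edges of the
   quotient graph with those of [sT0] and [sS].  Functions defined on a vertex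
   group, an edge group or a fibre are represented by functions on the ambient
   type, whose other values are irrelevant. *)
Record sig_data := SigData {
  sT : subgraph Ys;
  sT0 : subgraph Xs;
  sS : subgraph Xs;
  vrep : vert Ys -> vert Xs;
  erep : edge Ys -> edge Xs;
  sG : graph_of_groups Gamma Ys;
  sg : edge Ys -> Gamma;
  eabs : edge Ys -> edge Ys;
  theta_e : edge Ys -> oaut L0;
  mu_e : edge Ys -> L0;
  theta_v : vert Ys -> Gamma -> oaut L0;
  mu_v : vert Ys -> Gamma -> L0;
  sX : vert Ys -> set X;
  sdist : vert Ys -> X -> X -> L0;
  sact : vert Ys -> Gamma -> X -> X;
  seps : edge Ys -> set (X * set X);
  sdelta : edge Ys -> X -> L0
}.

Definition vertex_reps (T : subgraph Ys) (T0 : subgraph Xs) : Prop :=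
  [/\ is_subtree T0, set_bij (sv T0) (sv T) (vproj act)
    & set_bij (se T0) (se T) (eproj act)].

Definition edge_reps (T0 S : subgraph Xs) : Prop :=
  [/\ is_subtree S, sub_subgraph T0 S, set_bij (se S) [set: edge Ys] (eproj act)
    & forall e, se S e -> sv T0 (orig e) \/ sv T0 (orig (erev e))].

Definition fibre_dist (x y : X) : L0 := (dist x y).2.

(* The end of the fibre over the origin of [e] defined by the edge [e]. *)
Definition is_edge_end (e : edge Xs) (eps : set (X * set X)) : Prop :=
  is_end (sval (orig e)) fibre_dist eps /\
  forall x y, sval (orig e) x -> sval (orig (erev e)) y ->
    seg [set: X] (@dist _ X) x y `&` sval (orig e) = ray_to eps x.

Record is_signature (D : sig_data) : Prop := IsSignature {
  sgn_T : maximal_subtree (sT D);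
  sgn_T0 : vertex_reps (sT D) (sT0 D);
  sgn_S : edge_reps (sT0 D) (sS D);
  sgn_vrep : forall x, sv (sT0 D) (vrep D x) /\ vproj act (vrep D x) = x;
  sgn_erep : forall e, se (sS D) (erep D e) /\ eproj act (erep D e) = e;
  sgn_g : forall e, sv (sT0 D) (vact act (sg D e)^-1%g (orig (erep D e)));
  sgn_g1 : forall e, sv (sT0 D) (orig (erep D e)) -> sg D e = 1%g;
  sgn_eabs_rev : forall e, eabs D (erev e) = eabs D e;
  sgn_eabs_or : forall e, eabs D e = e \/ eabs D e = erev e;
  sgn_eabs : forall e, sv (sT0 D) (orig (erep D (eabs D e)));
  sgn_vgrp : forall x, vgrp (sG D) x = [set s | vact act s (vrep D x) = vrep D x];
  sgn_egrp : forall e, egrp (sG D) e = [set s | eact act s (erep D e) = erep D e];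
  sgn_gemb : forall e s, egrp (sG D) e s ->
    gemb (sG D) e s = ((sg D e)^-1 * s * sg D e)%g;
  sgn_theta_e : forall e, theta_e D e = theta (sg D e);
  sgn_mu_e : forall e, mu_e D e = mu (sg D e);
  sgn_theta_v : forall x s, vgrp (sG D) x s -> theta_v D x s = theta s;
  sgn_mu_v : forall x s, vgrp (sG D) x s -> mu_v D x s = mu s;
  sgn_X : forall x, sX D x = sval (vrep D x);
  sgn_dist : forall x p q, sX D x p -> sX D x q -> dist p q = zpair 0 (sdist D x p q);
  sgn_act : forall x s p, vgrp (sG D) x s -> sX D x p -> sact D x s p = a s p;
  sgn_eps : forall e, exists2 eps, is_edge_end (erep D e) eps
    & seps D e = end_image (a (sg D e)^-1%g) eps;
  sgn_delta : forall e,
    is_end_map (sX D (orig e)) (sdist D (orig e)) (seps D e) (sdelta D e);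
  sgn_delta_dist : forall e x y,
    sval (orig (erep D e)) x -> sval (orig (erev (erep D e))) y ->
    dist x y = zpair 1
      (- theta_e D e (sdelta D e (a (sg D e)^-1%g x))
       - theta_e D (erev e) (sdelta D (erev e) (a (sg D (erev e))^-1%g y)))
}.

Variable D : sig_data.

Local Notation G := (sG D).
Local Notation alpha := (gemb G).
(* $\theta_{\alpha_e(s)}$ and $\mu_{\alpha_e(s)}$ *)
Local Notation th e s := (theta_v D (orig e) (alpha e s)).
Local Notation mu_ e s := (mu_v D (orig e) (alpha e s)).

Definition sig_graph_of_groups : Prop :=
  [/\ maximal_subtree (sT D), vertex_reps (sT D) (sT0 D), edge_reps (sT0 D) (sS D),
      is_tree Xs /\
      is_bass_serre_tree G [set e | sv (sT0 D) (orig (erep D e))]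
        (sg D) act (vrep D) (erep D)
    & forall e, sv (sT0 D) (vact act (sg D e)^-1%g (orig (erep D e))) /\
        vrep D (orig e) = vact act (sg D e)^-1%g (orig (erep D e))].

Definition sig_homs : Prop := forall x s t, vgrp G x s -> vgrp G x t ->
  theta_v D x (s * t)%g = (theta_v D x s * theta_v D x t)%g.

Definition sig_trees : Prop := forall x, is_ltree (sX D x) (sdist D x).

Definition sig_actions : Prop := forall x,
  [/\ forall s p, vgrp G x s -> sX D x p -> sX D x (sact D x s p),
      forall p, sX D x p -> sact D x 1%g p = p,
      forall s t p, vgrp G x s -> vgrp G x t -> sX D x p ->
        sact D x (s * t)%g p = sact D x s (sact D x t p)
    & forall s p q, vgrp G x s -> sX D x p -> sX D x q ->
        sdist D x (sact D x s p) (sact D x s q) = theta_v D x s (sdist D x p q)].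

Definition sig_ends : Prop := forall e,
  is_end (sX D (orig e)) (sdist D (orig e)) (seps D e) /\
  is_end_map (sX D (orig e)) (sdist D (orig e)) (seps D e) (sdelta D e).

Definition sig_end_stabilisers : Prop := forall e,
  full_type (sX D (orig e)) (sdist D (orig e)) (seps D e) /\
  [set s | vgrp G (orig e) s /\
     end_image (sact D (orig e) s) (seps D e) = seps D e] = alpha e @` egrp G e.

Definition sig_end_orbits : Prop := forall e f, orig e = orig f ->
  (exists2 s, vgrp G (orig e) s &
     end_image (sact D (orig e) s) (seps D f) = seps D e) -> e = f.

Definition sig_theta : Prop :=
  (forall e s, egrp G e s ->
     theta_e D e * th e s * (theta_e D e)^-1 =
     theta_e D (erev e) * th (erev e) s * (theta_e D (erev e))^-1)%g /\
  (forall e, sg D e = 1%g -> theta_e D e = 1%g).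

Definition sig_mu : Prop :=
  [/\ forall e s, egrp G e s ->
        mu_e D e + theta_e D e (mu_ e s)
          - (theta_e D e * th e s * (theta_e D e)^-1)%g (mu_e D e)
        = mu_ (eabs D e) s,
      forall x s t, vgrp G x s -> vgrp G x t ->
        mu_v D x (s * t)%g = mu_v D x s + theta_v D x s (mu_v D x t)
    & forall e, sg D e = 1%g -> mu_e D e = 0].

Definition sig_delta : Prop := forall e s x y, egrp G e s ->
  sX D (orig e) x -> sX D (orig (erev e)) y ->
  theta_e D e (th e s (sdelta D e x)
    - sdelta D e (sact D (orig e) (alpha e s) x))
  + theta_e D (erev e) (th (erev e) s (sdelta D (erev e) y)
    - sdelta D (erev e) (sact D (orig (erev e)) (alpha (erev e) s) y))
  = mu_ (eabs D e) s.

End Signature.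

(* Main.v *)
Require Import Defs.
From Stdlib Require Import ZArith.
From HB Require Import structures.
From mathcomp Require Import all_boot all_order all_algebra.
From mathcomp Require Import boolp classical_sets functions.
From mathcomp Require Import zify ssrZ.

Set Implicit Arguments.
Unset Strict Implicit.
Unset Printing Implicit Defensive.
Import Order.TTheory GRing.Theory.
Local Open Scope classical_set_scope.
Local Open Scope ring_scope.

(** The first coordinate of the metric makes the set of fibres a tree X* with an
    ordinary graph structure, and everything in the statement comes from looking at
    [X] through the fibration X -> X*.

    Two translations make this elementary. A tree over an ordered abelian group is
    the same as a geodesic metric space with medians that satisfies the four-point
    condition ([ltree_median_tree], [median_tree_ltree]), so facts about segments
    become linear implications between distances, which [oag_lia] decides. And an
    end of full type is given by a Busemann function, the distance to a point at
    infinity ([bus_is_end], [bus_full_type], [bus_end_unique]).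

    Reduced walks in X* are geodesic, by parity and the four-point condition, so X*
    is a tree ([xs_is_tree]). Fibres inherit the four-point condition and the
    medians ([fibre_median_tree]). For an edge of X* the distance to a point over
    its far end is a Busemann function on the fibre over its origin, and its end is
    the end of the edge ([height_busemann], [is_edge_endP]). Distinct edges with
    the same origin have distinct ends ([edge_end_inj]), and the group permutes the
    ends as it permutes the edges ([edge_end_act]); this turns stabilisers and
    orbits of ends into those of edges. Since the distance across an edge is a sum
    of a function of either endpoint ([edge_cross]), negated heights are end maps
    with the required sum.

    The presentation of the group is the structure theorem of Bass and Serre
    ([bass_serre]): the tautological map from the Bass-Serre graph of the
    presentation to X* is locally injective and the graph is connected, so a
    reduced walk from a vertex to its translate by a kernel element has a closed
    reduced image in a tree, and the kernel is trivial. Trees of representatives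
    come from Zorn's lemma ([vertex_reps_ex], [edge_lift_ex]). The equations
    between scaling factors express that theta is a homomorphism and mu a cocycle
    ([thetaM], [muM]), and the last one compares the distance between translates of
    two points over the ends of an edge computed in two ways ([sgn_deltas]). *)

(** * Linear arithmetic in ordered abelian groups *)

Section OagTheory.
Variable L : oagType.
Implicit Types x y z : L.

Lemma oag_addr_ge0 x y : 0 <= x -> 0 <= y -> 0 <= x + y.
Proof. by move=> x0 y0; apply: le_trans y0 _; have := oag_leD2r y x0; rewrite add0r. Qed.

Lemma oag_subr_ge0 x y : (0 <= y - x) = (x <= y).
Proof.
apply/idP/idP => [/(oag_leD2r x)|/(oag_leD2r (- x))]; first by rewrite add0r subrK.
by rewrite subrr.
Qed.

Lemma oag_subr_gt0 x y : (0 < y - x) = (x < y).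
Proof. by rewrite !lt_def oag_subr_ge0 subr_eq0. Qed.

Lemma oag_nle x y : ~ (x <= y) -> y < x.
Proof.
move=> xy; rewrite lt_def; case/orP: (oag_total x y) => [//|yx].
by rewrite yx andbT; apply/eqP => exy; apply: xy; rewrite exy.
Qed.

Lemma oag_nlt x y : ~ (x < y) -> y <= x.
Proof.
move=> xy; case/orP: (oag_total x y) => [xy'|//].
case: (eqVneq x y) => [->//|nxy]; case: xy.
by rewrite lt_def eq_sym nxy.
Qed.

Lemma oag_addr_gt0 x y : 0 < x -> 0 <= y -> 0 < x + y.
Proof.
move=> x0 y0; apply: lt_le_trans x0 _.
by rewrite -oag_subr_ge0 addrC addKr.
Qed.

Lemma oag_mulrn_ge0 x n : 0 <= x -> 0 <= x *+ n.
Proof. by move=> x0; elim: n => [|n IHn]; rewrite ?mulr0n ?lexx // mulrS oag_addr_ge0. Qed.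

Lemma oag_mulrn_gt0 x n : (0 < n)%N -> 0 < x -> 0 < x *+ n.
Proof. by case: n => // n _ x0; rewrite mulrS oag_addr_gt0 ?oag_mulrn_ge0 // ltW. Qed.

Lemma oag_pos_ex : (exists l : L, l <> 0) -> exists l : L, 0 < l.
Proof.
move=> [l /eqP l0]; case/orP: (oag_total 0 l) => h; first by exists l; rewrite lt_def l0.
exists (- l); rewrite -[- l]add0r oag_subr_gt0 lt_def h andbT eq_sym //.
Qed.

End OagTheory.

(** Arguments about trees reduce to implications between linear constraints on
    distances. As an ordered abelian group need not be a ring or divisible, these
    are refuted by Fourier-Motzkin elimination with integer multipliers. A linear
    form is the list of its coefficients; a constraint asks a linear form to
    vanish, to be nonnegative or to be positive. *)
Section FourierMotzkin.

Inductive sign := Zero | NonNeg | Pos.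
Definition constraint : Type := sign * seq Z.

Definition is_zero (k : Z) : bool := Z.eqb k Z0.
Arguments is_zero : simpl never.

Fixpoint zadd (c c' : seq Z) : seq Z :=
  match c, c' with
  | [::], _ => c'
  | _, [::] => c
  | x :: c, x' :: c' => Z.add x x' :: zadd c c'
  end.
Definition zscale (k : Z) (c : seq Z) : seq Z := [seq Z.mul k x | x <- c].

Definition head_coef (l : constraint) : Z := head Z0 l.2.
Definition comb (s : sign) (k k' : Z) (l l' : constraint) : constraint :=
  (s, zadd (zscale k (behead l.2)) (zscale k' (behead l'.2))).

Definition sign_add (s s' : sign) : sign :=
  match s, s' with Pos, _ | _, Pos => Pos | NonNeg, _ | _, NonNeg => NonNeg | _, _ => Zero end.

Definition is_zero_sign (s : sign) := if s is Zero then true else false.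
Definition is_pos_sign (s : sign) := if s is Pos then true else false.

Fixpoint find_eq (ls : seq constraint) : option constraint :=
  if ls is l :: ls then
    if is_zero_sign l.1 && ~~ is_zero (head_coef l) then Some l else find_eq ls
  else None.

(** An equation containing the first variable removes it from all constraints;
    without one, every lower bound of the variable is added to every upper bound,
    with positive multipliers that cancel it. *)
Definition eliminate (ls : seq constraint) : seq constraint :=
  if find_eq ls is Some e then
    let h := head_coef e in
    [seq comb l.1 (Z.abs h) (Z.opp (Z.mul (Z.sgn h) (head_coef l))) l e | l <- ls]
  else
    [seq (l.1, behead l.2) | l <- ls & is_zero (head_coef l)]
    ++ flatten [seq [seq comb (sign_add p.1 n.1) (Z.opp (head_coef n)) (head_coef p) p n
                | n <- ls & Z.ltb (head_coef n) Z0] | p <- ls & Z.ltb Z0 (head_coef p)].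

Definition trivial_constraint (l : constraint) : bool :=
  ~~ is_pos_sign l.1 && all is_zero l.2.
Definition sign_eqb (s s' : sign) :=
  match s, s' with Zero, Zero | NonNeg, NonNeg | Pos, Pos => true | _, _ => false end.
Fixpoint coefs_eqb (c c' : seq Z) : bool :=
  match c, c' with
  | [::], [::] => true
  | x :: c, x' :: c' => Z.eqb x x' && coefs_eqb c c'
  | _, _ => false
  end.
(** Repeated constraints would multiply at each elimination step. *)
Fixpoint prune (ls : seq constraint) : seq constraint :=
  if ls is l :: ls then
    let r := prune ls in
    if trivial_constraint l || has (fun l' => sign_eqb l.1 l'.1 && coefs_eqb l.2 l'.2) r
    then r else l :: r
  else [::].

Fixpoint refute (n : nat) (ls : seq constraint) : bool :=
  has (fun l => is_pos_sign l.1 && all is_zero l.2) ls ||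
  if n is m.+1 then refute m (prune (eliminate ls)) else false.

Variable L : oagType.
Implicit Types v : seq L.

Definition zmul (x : L) (k : Z) : L := x *~ int_of_Z k.

Fixpoint lin_eval v (c : seq Z) {struct c} : L :=
  match c, v with k :: c, x :: v => zmul x k + lin_eval v c | _, _ => 0 end.

Definition sign_holds (s : sign) (x : L) : Prop :=
  match s with Zero => x = 0 | NonNeg => 0 <= x | Pos => 0 < x end.
Definition holds v (l : constraint) : Prop := sign_holds l.1 (lin_eval v l.2).

Let zeqbP k : is_zero k -> k = Z0. Proof. by move=> /Z.eqb_eq. Qed.
Let zltbP j k : Z.ltb j k -> Z.lt j k. Proof. by move=> /Z.ltb_lt. Qed.

Lemma zmulD x j k : zmul x (Z.add j k) = zmul x j + zmul x k.
Proof. by rewrite /zmul (raddfD int_of_Z j k) mulrzDr. Qed.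

Lemma zmulM x j k : zmul x (Z.mul j k) = zmul (zmul x k) j.
Proof. by rewrite /zmul (rmorphM int_of_Z j k) mulrC mulrzA. Qed.

Lemma zmulDl x y k : zmul (x + y) k = zmul x k + zmul y k.
Proof. by rewrite /zmul mulrzDl. Qed.

Lemma zmul0l k : zmul 0 k = 0. Proof. by rewrite /zmul mul0rz. Qed.

Lemma zmul0 x : zmul x Z0 = 0. Proof. by []. Qed.

Lemma zmulN1 x : zmul x (Zneg xH) = - x. Proof. by []. Qed.

Lemma lin_eval_add v c c' : lin_eval v (zadd c c') = lin_eval v c + lin_eval v c'.
Proof.
elim: c c' v => [|k c IHc] [|k' c'] [|x v] //=; rewrite ?add0r ?addr0 //.
by rewrite IHc zmulD addrACA.
Qed.

Lemma lin_eval_scale v k c : lin_eval v (zscale k c) = zmul (lin_eval v c) k.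
Proof.
elim: c v => [|j c IHc] [|x v] //=; rewrite ?zmul0l //.
by rewrite IHc zmulM zmulDl.
Qed.

Lemma lin_eval_all0 v c : all is_zero c -> lin_eval v c = 0.
Proof.
elim: c v => [|k c IHc] [|x v] //= /andP[/zeqbP -> c0].
by rewrite IHc // addr0.
Qed.

Lemma lin_eval_cons x v c :
  lin_eval (x :: v) c = zmul x (head Z0 c) + lin_eval v (behead c).
Proof. by case: c => [|k c] //=; rewrite addr0. Qed.

Lemma sign_holds_scale s x k : Z.lt Z0 k -> sign_holds s x -> sign_holds s (zmul x k).
Proof.
move=> k0; have [n n0 nE] : exists2 n, (0 < n)%N & int_of_Z k = n.
  by case: k k0 => // p _; exists (Pos.to_nat p) => //; apply/ssrnat.ltP/Pos2Nat.is_pos.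
rewrite /zmul nE -pmulrn; case: s => /= [->|x0|x0].
- by rewrite mul0rn.
- exact: oag_mulrn_ge0.
exact: oag_mulrn_gt0.
Qed.

Lemma sign_holds_add s s' x x' :
  sign_holds s x -> sign_holds s' x' -> sign_holds (sign_add s s') (x + x').
Proof.
case: s s' => [] [] /= hx hx'; rewrite ?hx ?hx' ?add0r ?addr0 //.
- exact: oag_addr_ge0.
- by rewrite addrC oag_addr_gt0.
- exact: oag_addr_gt0.
by rewrite oag_addr_gt0 // ltW.
Qed.

Fixpoint all_hold v (ls : seq constraint) : Prop :=
  if ls is l :: ls then holds v l /\ all_hold v ls else True.

Lemma all_hold_cat v ls ls' : all_hold v ls -> all_hold v ls' -> all_hold v (ls ++ ls').
Proof. by elim: ls => //= l ls IH [? ?] ?; split; auto. Qed.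

Lemma all_hold_filter v (P : pred constraint) ls : all_hold v ls -> all_hold v (filter P ls).
Proof. by elim: ls => //= l ls IH [? ?]; case: (P l) => //=; auto. Qed.

Lemma all_hold_map v v' (f : constraint -> constraint) (P : pred constraint) ls :
  (forall l, P l -> holds v l -> holds v' (f l)) ->
  all_hold v (filter P ls) -> all_hold v' (map f (filter P ls)).
Proof.
move=> ff; elim: ls => //= l ls IH; case: (boolP (P l)) => //= Pl [? ?].
by split; auto.
Qed.

Lemma find_eqP v ls e : all_hold v ls -> find_eq ls = Some e ->
  [/\ holds v e, e.1 = Zero & head_coef e <> Z0].
Proof.
elim: ls => //= l ls IH [hl hls]; case: ifP => [/andP[s0 h0]|_]; last exact: IH.
case=> <-; split=> //; first by case: (l.1) s0.
by move=> h00; rewrite h00 in h0.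
Qed.

Lemma comb_holds x v s k k' l l' :
  sign_holds s (zmul (lin_eval (x :: v) l.2) k + zmul (lin_eval (x :: v) l'.2) k') ->
  Z.add (Z.mul k (head_coef l)) (Z.mul k' (head_coef l')) = Z0 ->
  holds v (comb s k k' l l').
Proof.
move=> + kk; rewrite /holds /= lin_eval_add !lin_eval_scale !lin_eval_cons.
by rewrite !zmulDl addrACA -!zmulM -zmulD kk zmul0 add0r.
Qed.

Lemma all_hold_combine x v ps ns :
  all_hold (x :: v) ps -> all_hold (x :: v) ns ->
  all (fun l => Z.ltb Z0 (head_coef l)) ps ->
  all (fun l => Z.ltb (head_coef l) Z0) ns ->
  all_hold v (flatten [seq [seq comb (sign_add p.1 n.1) (Z.opp (head_coef n))
    (head_coef p) p n | n <- ns] | p <- ps]).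
Proof.
move=> + hns + ns0; elim: ps => // p ps IH [hp hps] /andP[/zltbP p0 ps0].
apply: all_hold_cat (IH hps ps0).
elim: ns hns ns0 {IH} => // n ns IHn [hn hns] /andP[/zltbP n0 ns0].
split; last exact: IHn.
apply: (@comb_holds x); last by lia.
by apply: sign_holds_add; apply: sign_holds_scale => //; lia.
Qed.

Lemma eliminate_hold x v ls : all_hold (x :: v) ls -> all_hold v (eliminate ls).
Proof.
move=> hls; rewrite /eliminate; case E: (find_eq ls) => [e|].
  have [he e0 h0] := find_eqP hls E.
  rewrite -[ls]filter_predT in hls *; apply: all_hold_map hls => l _ hl.
  apply: (@comb_holds x); last by lia.
  have -> : lin_eval (x :: v) e.2 = 0 by move: he; rewrite /holds e0.
  rewrite zmul0l addr0; apply: sign_holds_scale => //; lia.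
apply: all_hold_cat.
  apply: all_hold_map (all_hold_filter _ hls) => l /zeqbP l0.
  by rewrite /holds lin_eval_cons [head _ _]l0 zmul0 add0r.
apply: (@all_hold_combine x); first exact: all_hold_filter.
- exact: all_hold_filter.
- exact: filter_all.
exact: filter_all.
Qed.

Lemma prune_hold v ls : all_hold v ls -> all_hold v (prune ls).
Proof. by elim: ls => //= l ls IH [? ?]; case: ifP => _ /=; auto. Qed.

Lemma refute_sound v ls n : refute n ls -> size v = n -> ~ all_hold v ls.
Proof.
have now w ms : has (fun l => is_pos_sign l.1 && all is_zero l.2) ms ->
    ~ all_hold w ms.
  elim: ms => //= l ms IH /orP[/andP[lp l0] [hl _]|/IH lms [_ /lms]//].
  move: hl; rewrite /holds (lin_eval_all0 _ l0).
  by case: (l.1) lp => //=; rewrite ltxx.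
elim: n v ls => [|n IHn] [|x v] ls //=; first by rewrite orbF => /now + _; apply.
case/orP=> [/now nh _|rls [vn] hls]; first exact: nh.
exact: IHn rls vn (prune_hold (eliminate_hold hls)).
Qed.

Inductive lterm := LVar of nat | LZero | LAdd of lterm & lterm | LOpp of lterm.
Inductive latom := LEq of lterm & lterm | LLe of lterm & lterm | LLt of lterm & lterm.

Fixpoint lterm_eval v (t : lterm) : L :=
  match t with
  | LVar i => nth 0 v i
  | LZero => 0
  | LAdd t u => lterm_eval v t + lterm_eval v u
  | LOpp t => - lterm_eval v t
  end.
Definition latom_eval v (p : latom) : Prop :=
  match p with
  | LEq t u => lterm_eval v t = lterm_eval v u
  | LLe t u => lterm_eval v t <= lterm_eval v u
  | LLt t u => lterm_eval v t < lterm_eval v u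
  end.
Fixpoint latoms_eval v (ps : seq latom) : Prop :=
  if ps is p :: ps then latom_eval v p /\ latoms_eval v ps else True.

Fixpoint lterm_form (t : lterm) : seq Z :=
  match t with
  | LVar i => rcons (nseq i Z0) (Zpos xH)
  | LZero => [::]
  | LAdd t u => zadd (lterm_form t) (lterm_form u)
  | LOpp t => zscale (Zneg xH) (lterm_form t)
  end.
Definition lsub (t u : lterm) := lterm_form (LAdd u (LOpp t)).
Definition latom_constraint (p : latom) : constraint :=
  match p with
  | LEq t u => (Zero, lsub t u)
  | LLe t u => (NonNeg, lsub t u)
  | LLt t u => (Pos, lsub t u)
  end.

Lemma lterm_formE v t : lin_eval v (lterm_form t) = lterm_eval v t.
Proof.
elim: t => //= [i|t IHt u IHu|t IHt].
- elim: i v => [|i IHi] [|x v] //=; first by rewrite addr0.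
  by rewrite zmul0 add0r IHi.
- by rewrite lin_eval_add IHt IHu.
by rewrite lin_eval_scale IHt zmulN1.
Qed.

Lemma latom_constraintP v p : latom_eval v p -> holds v (latom_constraint p).
Proof.
case: p => t u; rewrite /holds /= lin_eval_add lin_eval_scale !lterm_formE.
- by move=> /= ->; rewrite zmulN1 subrr.
- by rewrite zmulN1 /= oag_subr_ge0.
by rewrite zmulN1 /= oag_subr_gt0.
Qed.

Lemma refute_latoms v ps :
  refute (size v) (map latom_constraint ps) -> latoms_eval v ps -> False.
Proof.
move=> /refute_sound /(_ erefl) nh hps; apply: nh.
by elim: ps hps => //= p ps IH [/latom_constraintP ? /IH ?].
Qed.

End FourierMotzkin.

Ltac oag_find x v :=
  lazymatch v with
  | x :: _ => constr:(0%N)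
  | _ :: ?v' => let n := oag_find x v' in constr:(n.+1)
  end.
Ltac oag_add_var x v :=
  match v with
  | _ => let n := oag_find x v in v
  | _ => constr:(x :: v)
  end.
Ltac oag_vars t v :=
  lazymatch t with
  | (?x + ?y)%R => let v := oag_vars x v in oag_vars y v
  | (- ?x)%R => oag_vars x v
  | 0%R => v
  | _ => oag_add_var t v
  end.
Ltac oag_reify t v :=
  lazymatch t with
  | (?x + ?y)%R => let x := oag_reify x v in let y := oag_reify y v in constr:(LAdd x y)
  | (- ?x)%R => let x := oag_reify x v in constr:(LOpp x)
  | 0%R => constr:(LZero)
  | _ => let n := oag_find t v in constr:(LVar n)
  end.
Ltac oag_same L T := let _ := constr:(erefl : (T : Type) = (oag_sort L : Type)) in idtac.
Ltac oag_revert L :=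
  repeat match goal with
  | H : is_true (?x <= _)%R |- _ => let T := type of x in oag_same L T; revert H
  | H : is_true (?x < _)%R |- _ => let T := type of x in oag_same L T; revert H
  | H : @eq ?T _ _ |- _ => oag_same L T; revert H
  end.
Ltac oag_goal_vars G v :=
  lazymatch G with
  | is_true (?x <= ?y)%R -> ?G =>
      let v := oag_vars x v in let v := oag_vars y v in oag_goal_vars G v
  | is_true (?x < ?y)%R -> ?G =>
      let v := oag_vars x v in let v := oag_vars y v in oag_goal_vars G v
  | ?x = ?y -> ?G =>
      let v := oag_vars x v in let v := oag_vars y v in oag_goal_vars G v
  | _ => v
  end.
Ltac oag_intro L v ps pf :=
  lazymatch goal with
  | |- is_true (?x <= ?y)%R -> _ =>
      let x := oag_reify x v in let y := oag_reify y v in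
      let H := fresh in intro H;
      oag_intro L v constr:(LLe x y :: ps) constr:(conj H pf)
  | |- is_true (?x < ?y)%R -> _ =>
      let x := oag_reify x v in let y := oag_reify y v in
      let H := fresh in intro H;
      oag_intro L v constr:(LLt x y :: ps) constr:(conj H pf)
  | |- ?x = ?y -> _ =>
      let x := oag_reify x v in let y := oag_reify y v in
      let H := fresh in intro H;
      oag_intro L v constr:(LEq x y :: ps) constr:(conj H pf)
  | |- False =>
      refine (@refute_latoms L v ps _ pf); vm_compute; reflexivity
  end.
Ltac oag_refute L :=
  oag_revert L;
  lazymatch goal with
  | |- ?G => let v := oag_goal_vars G (@nil (oag_sort L)) in oag_intro L v (@nil latom) I
  end.

(** The order being total, the negated goal is a constraint too, and is refuted
    together with all the hypotheses that compare elements of [L]. *)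
Ltac oag_lia L :=
  intros;
  lazymatch goal with
  | |- False => oag_refute L
  | |- is_true (_ <= _)%R =>
      apply: contrapT; let H := fresh in move=> /oag_nle H; oag_refute L
  | |- is_true (_ < _)%R =>
      apply: contrapT; let H := fresh in move=> /oag_nlt H; oag_refute L
  | |- _ = _ =>
      apply/eqP; rewrite eq_le; apply/andP; split; oag_lia L
  end.

(** * Trees over an ordered abelian group as median four-point spaces *)

Ltac split_ors := repeat match goal with H : _ \/ _ |- _ => destruct H end.

Lemma oabsP (L : oagType) (x : L) :
  (0 <= x /\ oabs x = x) \/ (x <= 0 /\ oabs x = - x).
Proof.
rewrite /oabs maxEle; have [h|h] := orP (oag_total x (- x)); rewrite ?h; last first.
  left; split; first by oag_lia L.
  by case: ifP => // h'; oag_lia L.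
by right; split=> //; oag_lia L.
Qed.

Section Trees.
Variables (L : oagType) (X : Type) (A : set X) (d : X -> X -> L).
Implicit Types (S : set X) (x y z u v w : X).

Definition between x u y : Prop := d x u + d u y = d x y.

(** Parametrising a segment by the distance from its first endpoint replaces the
    isometry from an interval by conditions on distances alone. *)
Record segment_spec x y S : Prop := SegmentSpec {
  seg_sub : S `<=` A;
  seg_left : S x;
  seg_right : S y;
  seg_le : forall u, S u -> d x u <= d x y;
  seg_lin : forall u v, S u -> S v -> d u v = d x u - d x v \/ d u v = d x v - d x u;
  seg_onto : forall t, 0 <= t -> t <= d x y -> exists2 u, S u & d x u = t
}.

(** An equivalent form of the tree axioms that only speaks of points and distances.
    It passes to fibres by inspection, and it makes statements about betweenness
    linear. *)
Record median_tree : Prop := MedianTree {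
  mt_metric : is_lmetric A d;
  mt_geodesic : forall x y t, A x -> A y -> 0 <= t -> t <= d x y ->
    exists2 u, A u & d x u = t /\ between x u y;
  mt_fourpoint : forall x y z w, A x -> A y -> A z -> A w ->
    d x y + d z w <= d x z + d y w \/ d x y + d z w <= d x w + d y z;
  mt_median : forall x y z, A x -> A y -> A z ->
    exists2 m, A m & [/\ between x m y, between x m z & between y m z]
}.

Section Metric.
Hypothesis M : is_lmetric A d.

Lemma dist_refl x : A x -> d x x = 0.
Proof. by move=> Ax; apply/(lmetric_eq0 M). Qed.
Lemma dist_eq0 x y : A x -> A y -> d x y = 0 -> x = y.
Proof. by move=> Ax Ay /(lmetric_eq0 M Ax Ay). Qed.

Lemma segment_spec_left x y S : segment_spec x y S -> A x.
Proof. by move=> sS; apply: (seg_sub sS); exact: (seg_left sS). Qed.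
Lemma segment_spec_right x y S : segment_spec x y S -> A y.
Proof. by move=> sS; apply: (seg_sub sS); exact: (seg_right sS). Qed.

Lemma segment_spec_between x y S u : segment_spec x y S -> S u -> between x u y.
Proof.
move=> sS Su; have := seg_lin sS Su (seg_right sS); have := seg_le sS Su.
have := lmetric_ge0 M (seg_sub sS Su) (segment_spec_right sS).
by rewrite /between => *; split_ors; oag_lia L.
Qed.

Lemma segment_spec_inj x y S u v : segment_spec x y S -> S u -> S v ->
  d x u = d x v -> u = v.
Proof.
move=> sS Su Sv uv; apply: dist_eq0; [exact: (seg_sub sS)..|].
by case: (seg_lin sS Su Sv) => *; oag_lia L.
Qed.

Lemma segment_spec_sym x y S : segment_spec x y S -> segment_spec y x S.
Proof.
move=> sS; have [sub Sx Sy le lin onto] := sS.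
have Ax := sub _ Sx; have Ay := sub _ Sy; have xy := lmetric_sym M Ax Ay.
have E u : S u -> d y u = d x y - d x u.
  move=> Su; have := segment_spec_between sS Su.
  by rewrite /between (lmetric_sym M (sub _ Su) Ay); oag_lia L.
split=> //.
- move=> u Su; rewrite E // -xy; have := lmetric_ge0 M Ax (sub _ Su); oag_lia L.
- by move=> u v Su Sv; rewrite !E //; case: (lin u v) => // ?; [right|left]; oag_lia L.
move=> t t0 ty; have [||u Su ut] := onto (d x y - t); [oag_lia L| oag_lia L|].
by exists u => //; rewrite E // ut; oag_lia L.
Qed.

Lemma segment_betweenP x y S : segment_between A d x y S <-> segment_spec x y S.
Proof.
split.
  move=> [a [b [f]]] /= [ab fA fd [fa fb] ->].
  pose I := [set t | a <= t <= b].
  have Ia : I a by rewrite /I /= lexx ab.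
  have Ib : I b by rewrite /I /= lexx ab.
  have dE t : I t -> d x (f t) = t - a.
    move=> It; rewrite -fa fd //; case/andP: It => at' _.
    by case: (oabsP (a - t)) => [] [? ->]; oag_lia L.
  have xyE : d x y = b - a by rewrite -fb dE.
  split=> //.
  - by exists a.
  - by exists b.
  - by move=> _ [t It <-]; rewrite dE // xyE; case/andP: It => ? ?; oag_lia L.
  - move=> _ _ [t It <-] [s Is <-]; rewrite fd // !dE //.
    by case: (oabsP (t - s)) => [] [? ->]; [left|right]; oag_lia L.
  move=> t t0 txy; have It : I (a + t).
    by apply/andP; split; oag_lia L.
  by exists (f (a + t)); [exists (a + t)|rewrite dE //; oag_lia L].
move=> sS; have Ax := segment_spec_left sS; have Ay := segment_spec_right sS.
have /choice[f fP] (t : L) : exists u, 0 <= t <= d x y -> S u /\ d x u = t.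
  case: (pselect (0 <= t <= d x y)) => [/andP[t0 ty]|nt]; last by exists x.
  by have [u Su <-] := seg_onto sS t0 ty; exists u.
exists 0, (d x y), f; split=> /=.
- exact: (lmetric_ge0 M Ax Ay).
- by move=> _ [t /fP[ft _] <-]; apply: (seg_sub sS).
- move=> s t /fP[fs sE] /fP[ft tE]; have := lmetric_ge0 M (seg_sub sS fs) (seg_sub sS ft).
  have := seg_lin sS fs ft; rewrite sE tE.
  by case: (oabsP (s - t)) => [] [? ->] *; split_ors; oag_lia L.
- have l0 := lmetric_ge0 M Ax Ay; split.
    have [|f0 E0] := fP 0; first by rewrite lexx.
    by apply/esym/dist_eq0 => //; apply: (seg_sub sS).
  have [|f1 E1] := fP (d x y); first by rewrite l0 lexx.
  exact: segment_spec_inj sS f1 (seg_right sS) E1.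
apply/seteqP; split=> [u Su|_ [t /fP[ft _] <-] //].
have tu : 0 <= d x u <= d x y.
  by rewrite (lmetric_ge0 M) ?(seg_le sS) //; exact: (seg_sub sS Su).
exists (d x u) => //; have [fu fuE] := fP _ tu.
exact: (segment_spec_inj sS fu Su fuE).
Qed.

Lemma is_segmentP S : is_segment A d S <-> exists x y, segment_spec x y S.
Proof. by split=> [] [x [y /segment_betweenP ?]]; exists x, y. Qed.

Lemma segment_spec_final x y S m : segment_spec x y S -> S m ->
  segment_spec m y [set u | S u /\ d x m <= d x u].
Proof.
move=> sS Sm; have Am := seg_sub sS Sm.
have E u : S u -> d x m <= d x u -> d m u = d x u - d x m.
  move=> Su mu; have := lmetric_ge0 M Am (seg_sub sS Su).
  by case: (seg_lin sS Sm Su) => *; oag_lia L.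
have yE := E _ (seg_right sS) (seg_le sS Sm).
split=> /=.
- by move=> u [Su _]; exact: (seg_sub sS Su).
- by split.
- by split; [exact: seg_right sS | exact: (seg_le sS Sm)].
- by move=> u [Su mu]; rewrite yE (E _ Su mu); have := seg_le sS Su; oag_lia L.
- move=> u v [Su mu] [Sv mv]; rewrite (E _ Su mu) (E _ Sv mv).
  by case: (seg_lin sS Su Sv) => *; [left|right]; oag_lia L.
move=> t t0; rewrite yE => ty.
have m0 : 0 <= d x m by apply: (lmetric_ge0 M) => //; exact: (segment_spec_left sS).
have [||u Su uE] := seg_onto sS (t := d x m + t); [oag_lia L | oag_lia L |].
have mu : d x m <= d x u by rewrite uE; oag_lia L.
by exists u => //; rewrite (E _ Su mu) uE; oag_lia L.
Qed.
End Metric.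

Section FromAxioms.
Hypothesis T : is_ltree A d.
Let M := ltree_metric T.

Let segmentE x y : A x -> A y -> exists S, segment_spec x y S.
Proof.
by move=> Ax Ay; have [S /(segment_betweenP M) ?] := ltree_segment T Ax Ay; exists S.
Qed.

(** The common part of the two segments is a segment which starts at [x]; let [m]
    be its other end. What remains of them meets in [m] only, so its union is a
    segment, and [y] and [z] lie on different sides of [m] on it. *)
Lemma segment_branch x y z S S' : segment_spec x y S -> segment_spec x z S' ->
  exists m, [/\ S m, S' m, forall u, S u -> d x u <= d x m -> S' u,
                forall u, S' u -> d x u <= d x m -> S u
              & (forall u, S u -> S' u -> d x u <= d x m) /\ between y m z].
Proof.
move=> sS sS'.
have /(is_segmentP M) := ltree_meet T ((segment_betweenP M _ _ _).2 sS)
  ((segment_betweenP M _ _ _).2 sS').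
have [Sx S'x] := (seg_left sS, seg_left sS').
move=> [m0 [m sI]]; wlog xm : m0 m sI / d x m0 <= d x m.
  move=> W; have [h|h] := orP (oag_total (d x m0) (d x m)); first exact: (W _ _ sI h).
  exact: (W _ _ (segment_spec_sym M sI) h).
have m0x : m0 = x.
  have [Sm0 _] := seg_left sI; have [Sm _] := seg_right sI.
  have Ix : (S `&` S') x by [].
  have [Ax [Am Am0]] := (seg_sub sS Sx, (seg_sub sS Sm, seg_sub sS Sm0)).
  apply/esym/(dist_eq0 M) => //.
  have := segment_spec_between M sI Ix; have := seg_lin sS Sm0 Sm.
  have := lmetric_sym M Ax Am0; have := lmetric_ge0 M Ax Am0.
  have := lmetric_ge0 M Am0 Am; rewrite /between => *; split_ors; oag_lia L.
move: sI; rewrite {m0 xm}m0x => sI; have [Sm S'm] := seg_right sI.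
have to u : A u -> d x u <= d x m -> exists2 v, (S `&` S') v & d x v = d x u.
  move=> Au um; have [v Iv vE] := seg_onto sI (lmetric_ge0 M (seg_sub sS Sx) Au) um.
  by exists v.
exists m; split=> //.
- move=> u Su um; have [v [Sv S'v] vE] := to u (seg_sub sS Su) um.
  by rewrite -(segment_spec_inj M sS Sv Su vE).
- move=> u S'u um; have [v [Sv S'v] vE] := to u (seg_sub sS' S'u) um.
  by rewrite -(segment_spec_inj M sS' S'v S'u vE).
split=> [u Su S'u|]; first exact: (seg_le sI).
have s1 := segment_spec_final M sS Sm; have s2 := segment_spec_final M sS' S'm.
set S1 := [set u | _] in s1; set S2 := [set u | _] in s2.
have I12 u : S1 u -> S2 u -> u = m.
  move=> [Su mu] [S'u _]; apply: (segment_spec_inj M sS Su Sm).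
  by apply/eqP; rewrite eq_le mu andbT; exact: (seg_le sI).
have /(is_segmentP M)[p [q sU]] : is_segment A d (S1 `|` S2).
  apply: (ltree_join T (x := m) (y := y) (z := z)); try exact/(segment_betweenP M).
  apply/seteqP; split=> [u [S1u S2u]|_ ->]; first exact: I12.
  by split; [exact: seg_left s1 | exact: (seg_left s2)].
(* If a and b were on the same side of m, then the point v of Sb as far from m
   as a would be a itself, which is only common to Sa and Sb if it is m. *)
have key a b Sa Sb : segment_spec m a Sa -> segment_spec m b Sb ->
    Sa `<=` S1 `|` S2 -> Sb `<=` S1 `|` S2 -> (forall u, Sa u -> Sb u -> u = m) ->
    d m a <= d m b -> between a m b.
  move=> sa sb aU bU ab leab; have Am := segment_spec_left sa.
  have Aa := segment_spec_right sa; have Ab := segment_spec_right sb.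
  have [v Sbv vE] := seg_onto sb (lmetric_ge0 M Am Aa) leab.
  have Av := seg_sub sb Sbv.
  have ma0 := lmetric_ge0 M Am Aa; have ab0 := lmetric_ge0 M Aa Ab.
  have av0 := lmetric_ge0 M Aa Av.
  have am := lmetric_sym M Aa Am; have mb0 := lmetric_ge0 M Am Ab.
  have vb := segment_spec_between M sb Sbv; have vb0 := lmetric_ge0 M Av Ab.
  have [Um Ua Ub Uv] : [/\ (S1 `|` S2) m, (S1 `|` S2) a, (S1 `|` S2) b & (S1 `|` S2) v].
    by split; [apply/aU/(seg_left sa)|apply/aU/(seg_right sa)
              |apply/bU/(seg_right sb)|exact/bU].
  have amb : d a v = 0 \/ between a m b.
    have := seg_lin sU Um Ua; have := seg_lin sU Um Ub; have := seg_lin sU Ua Ub.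
    have := seg_lin sU Um Uv; have := seg_lin sU Ua Uv; have := seg_lin sU Uv Ub.
    move: vb; rewrite /between => *; split_ors; solve [left; oag_lia L | right; oag_lia L].
  case: amb => // /(dist_eq0 M Aa Av) av.
  have -> : a = m by apply: ab; [exact: (seg_right sa)|rewrite av].
  by rewrite /between (dist_refl M Am) add0r.
have [le|le] := orP (oag_total (d m y) (d m z)).
  by apply: (key y z S1 S2) => // u ?; try by [left|right].
have [Am Ay Az] : [/\ A m, A y & A z].
  by split; [exact: (seg_sub sS Sm)|exact: (segment_spec_right sS)|exact: (segment_spec_right sS')].
have : between z m y.
  by apply: (key z y S2 S1) => // u ?; try by [left|right|move=> ?; exact: I12].
rewrite /between (lmetric_sym M Az Am) (lmetric_sym M Am Ay) (lmetric_sym M Az Ay).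
by rewrite addrC.
Qed.

Lemma segment_spec_unique x y S S' : segment_spec x y S -> segment_spec x y S' -> S = S'.
Proof.
move=> sS sS'; have [m [Sm S'm SS' S'S [_ ymy]]] := segment_branch sS sS'.
have [Ay Am] := (segment_spec_right sS, seg_sub sS Sm).
have my : m = y.
  apply: (dist_eq0 M) => //; move: ymy; rewrite /between (dist_refl M Ay).
  by rewrite (lmetric_sym M Ay Am); oag_lia L.
rewrite my in SS' S'S; apply/seteqP; split=> u Su.
  by apply: SS' => //; exact: (seg_le sS Su).
by apply: S'S => //; exact: (seg_le sS' Su).
Qed.

(** A point cutting a distance additively lies on the segment: the two partial
    segments meet only there, so their union is the segment. *)
Lemma between_segment_spec x y S u : segment_spec x y S -> A u -> between x u y -> S u.
Proof.
move=> sS Au xuy; have [Ax Ay] := (segment_spec_left sS, segment_spec_right sS).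
have [S1 s1] := segmentE Au Ax; have [S2 s2] := segmentE Au Ay.
have [m [S1m S2m _ _ [le xmy]]] := segment_branch s1 s2.
have Am := seg_sub s1 S1m.
have um0 : d u m = 0.
  have := segment_spec_between M s1 S1m; have := segment_spec_between M s2 S2m.
  move: xuy xmy; rewrite /between (lmetric_sym M Ax Au) (lmetric_sym M Ax Am); oag_lia L.
have /(is_segmentP M)[p [q sU]] : is_segment A d (S1 `|` S2).
  apply: (ltree_join T (x := u) (y := x) (z := y)); try exact/(segment_betweenP M).
  apply/seteqP; split=> [v [S1v S2v]|_ ->]; last first.
    by split; [exact: (seg_left s1)|exact: (seg_left s2)].
  have Av := seg_sub s1 S1v; apply/esym/(dist_eq0 M) => //.
  by have := lmetric_ge0 M Au Av; have := le _ S1v S2v; rewrite um0; oag_lia L.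
have UB v : (S1 `|` S2) v -> between x v y.
  move=> [|] Sv.
    have Av := seg_sub s1 Sv; have := segment_spec_between M s1 Sv; move: xuy.
    have := lmetric_triangle M Av Au Ay; have := lmetric_triangle M Ax Av Ay.
    rewrite /between (lmetric_sym M Ax Au) (lmetric_sym M Ax Av) (lmetric_sym M Av Au).
    oag_lia L.
  have Av := seg_sub s2 Sv; have := segment_spec_between M s2 Sv; move: xuy.
  have := lmetric_triangle M Ax Au Av; have := lmetric_triangle M Ax Av Ay.
  rewrite /between; oag_lia L.
have Ux : (S1 `|` S2) x by left; exact: (seg_right s1).
have Uy : (S1 `|` S2) y by right; exact: (seg_right s2).
suff sxy : segment_spec x y (S1 `|` S2).
  by rewrite (segment_spec_unique sS sxy); left; exact: (seg_left s1).
split=> //.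
- exact: (seg_sub sU).
- move=> v Uv; have := UB v Uv; have := lmetric_ge0 M (seg_sub sU Uv) Ay.
  rewrite /between; oag_lia L.
- move=> v w Uv Uw; have := UB v Uv; have := UB w Uw.
  have [Av Aw] := (seg_sub sU Uv, seg_sub sU Uw).
  have := seg_lin sU Uv Uw; have := seg_lin sU Ux Uv; have := seg_lin sU Ux Uw.
  have := seg_lin sU Uv Uy; have := seg_lin sU Uw Uy; have := seg_lin sU Ux Uy.
  have := lmetric_ge0 M Ax Av; have := lmetric_ge0 M Ax Aw; have := lmetric_ge0 M Ax Ay.
  have := lmetric_ge0 M Av Aw; have := lmetric_ge0 M Av Ay; have := lmetric_ge0 M Aw Ay.
  rewrite /between => *; split_ors; solve [left; oag_lia L | right; oag_lia L].
move=> t t0 ty; have [tu|ut] := orP (oag_total t (d x u)).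
  have [||v S1v vE] := seg_onto s1 (t := d x u - t).
  - oag_lia L.
  - by rewrite (lmetric_sym M Au Ax); oag_lia L.
  exists v; first by left.
  have := segment_spec_between M s1 S1v; have Av := seg_sub s1 S1v.
  by rewrite /between (lmetric_sym M Au Ax) (lmetric_sym M Av Ax) vE; oag_lia L.
move: xuy; rewrite /between => xuy.
have [||v S2v vE] := seg_onto s2 (t := t - d x u); [oag_lia L|oag_lia L|].
exists v; first by right.
have := segment_spec_between M s2 S2v; have := UB v (or_intror S2v).
by rewrite /between vE; oag_lia L.
Qed.

(** Among the branch points of three segments from [x], the lower of two lies on
    all three segments. This ultrametric inequality is the four-point condition,
    and a branch point is a median. *)
Lemma ltree_median_tree : median_tree.
Proof.
split.
- exact: M.
- move=> x y t Ax Ay t0 ty; have [S sS] := segmentE Ax Ay.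
  have [u Su uE] := seg_onto sS t0 ty; exists u; first exact: (seg_sub sS).
  by split=> //; exact: (segment_spec_between M sS Su).
- move=> x z y w Ax Az Ay Aw.
  have [Sy sy] := segmentE Ax Ay; have [Sz sz] := segmentE Ax Az.
  have [Sw sw] := segmentE Ax Aw.
  have [m1 [y1 z1 _ to1 [_ b1]]] := segment_branch sy sz.
  have [m2 [z2 w2 to2 _ [_ b2]]] := segment_branch sz sw.
  have [m3 [y3 w3 _ _ [le3 b3]]] := segment_branch sy sw.
  have [A1 A2 A3] : [/\ A m1, A m2 & A m3].
    by split; [exact: (seg_sub sy y1)|exact: (seg_sub sz z2)|exact: (seg_sub sy y3)].
  have le : d x m1 <= d x m3 \/ d x m2 <= d x m3.
    have [le|le] := orP (oag_total (d x m1) (d x m2)).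
      by left; apply: le3 => //; exact: to2.
    by right; apply: le3 => //; exact: to1.
  have := segment_spec_between M sy y1; have := segment_spec_between M sz z1.
  have := segment_spec_between M sz z2; have := segment_spec_between M sw w2.
  have := segment_spec_between M sy y3; have := segment_spec_between M sw w3.
  move: b1 b2 b3; rewrite /between (lmetric_sym M Ay A1) (lmetric_sym M Az A2).
  rewrite (lmetric_sym M Ay A3) (lmetric_sym M Az Ay) => *.
  by case: le => ?; [right|left]; oag_lia L.
move=> x y z Ax Ay Az; have [S sS] := segmentE Ax Ay; have [S' sS'] := segmentE Ax Az.
have [m [Sm S'm _ _ [_ b]]] := segment_branch sS sS'.
exists m; first exact: (seg_sub sS Sm).
by split=> //; [exact: (segment_spec_between M sS Sm)|exact: (segment_spec_between M sS' S'm)].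
Qed.

Lemma ltree_segE x y : A x -> A y -> seg A d x y = [set u | A u /\ between x u y].
Proof.
move=> Ax Ay; have [S sS] := segmentE Ax Ay; apply/seteqP; split=> u.
  move=> [S' /(segment_betweenP M) sS' S'u].
  by split; [exact: (seg_sub sS' S'u)|exact: (segment_spec_between M sS' S'u)].
move=> [Au xuy]; exists S; first exact/(segment_betweenP M).
exact: (between_segment_spec sS Au xuy).
Qed.
End FromAxioms.

Section Converse.
Hypothesis T : median_tree.
Let M := mt_metric T.

Let segment_spec_of x y : A x -> A y ->
  segment_spec x y [set u | A u /\ between x u y].
Proof.
move=> Ax Ay; split=> /=.
- by move=> u [].
- by split=> //; rewrite /between (dist_refl M Ax) add0r.
- by split=> //; rewrite /between (dist_refl M Ay) addr0.
- by move=> u [Au]; have := lmetric_ge0 M Au Ay; rewrite /between; oag_lia L.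
- move=> u v [Au xu] [Av xv]; move: xu xv; rewrite /between => xu xv.
  have := mt_fourpoint T Ax Ay Au Av; have := lmetric_triangle M Ax Av Au.
  have := lmetric_triangle M Ax Au Av; rewrite (lmetric_sym M Av Au).
  rewrite (lmetric_sym M Ay Av) (lmetric_sym M Ay Au) => ? ? [] ?.
    by left; oag_lia L.
  by right; oag_lia L.
by move=> t t0 ty; have [u Au [ut xuy]] := mt_geodesic T Ax Ay t0 ty; exists u.
Qed.

Lemma median_tree_segment x y S : segment_spec x y S ->
  S = [set u | A u /\ between x u y].
Proof.
move=> sS; have [Ax Ay] := (segment_spec_left sS, segment_spec_right sS).
apply/seteqP; split=> [u Su|u [Au xuy]].
  by split; [exact: (seg_sub sS Su)|exact: (segment_spec_between M sS Su)].
have uy : d x u <= d x y by have := lmetric_ge0 M Au Ay; move: xuy; rewrite /between; oag_lia L.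
have [v Sv vE] := seg_onto sS (lmetric_ge0 M Ax Au) uy.
suff -> : u = v by [].
apply: (segment_spec_inj M (segment_spec_of Ax Ay)) => //=.
by split; [exact: (seg_sub sS Sv)|exact: (segment_spec_between M sS Sv)].
Qed.

(** Here a segment is the set of all points that cut the distance of its endpoints
    additively, and two segments from [x] part at the median. *)
Lemma median_tree_ltree : is_ltree A d.
Proof.
split.
- exact: M.
- move=> x y Ax Ay; eexists; apply/(segment_betweenP M); exact: segment_spec_of.
- move=> x y z S S' /(segment_betweenP M) sS /(segment_betweenP M) sS'.
  have Ax := segment_spec_left sS; have Ay := segment_spec_right sS.
  have Az := segment_spec_right sS'.
  rewrite (median_tree_segment sS) (median_tree_segment sS').
  have [m Am [xmy xmz ymz]] := mt_median T Ax Ay Az.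
  apply/(is_segmentP M); exists x, m.
  suff -> : [set u | A u /\ between x u y] `&` [set u | A u /\ between x u z] =
            [set u | A u /\ between x u m] by exact: segment_spec_of.
  move: xmy xmz ymz; rewrite /between (lmetric_sym M Ay Am) => xmy xmz ymz.
  apply/seteqP; split=> u /=.
    move=> [[Au xuy] [_ xuz]]; split=> //.
    have := mt_fourpoint T Ax Am Ay Az.
    have := mt_fourpoint T Ax Au Ay Az; have := mt_fourpoint T Am Au Ay Az.
    have := mt_fourpoint T Ax Ay Au Am; have := mt_fourpoint T Ax Az Au Am.
    have := lmetric_triangle M Ax Au Am; have := lmetric_triangle M Ax Am Au.
    have := lmetric_triangle M Ay Au Az.
    have := lmetric_ge0 M Au Am; rewrite (lmetric_sym M Am Au).
    rewrite (lmetric_sym M Ay Am) (lmetric_sym M Az Am).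
    rewrite (lmetric_sym M Ay Au) (lmetric_sym M Az Au) => *; split_ors; oag_lia L.
  move=> [Au xum]; have := lmetric_triangle M Au Am Ay; have := lmetric_triangle M Au Am Az.
  have := lmetric_triangle M Ax Au Ay; have := lmetric_triangle M Ax Au Az.
  by move=> *; do 2!split=> //; oag_lia L.
move=> x y z S S' /(segment_betweenP M) sS /(segment_betweenP M) sS'.
have Ax := segment_spec_left sS; have Ay := segment_spec_right sS.
have Az := segment_spec_right sS'.
rewrite (median_tree_segment sS) (median_tree_segment sS') => I.
have [m Am [xmy xmz ymz]] := mt_median T Ax Ay Az.
have mx : m = x.
  suff : ([set u | A u /\ between x u y] `&` [set u | A u /\ between x u z]) m by rewrite I.
  by [].
rewrite {m}mx in Am xmy xmz ymz; move: ymz; rewrite /between => yxz.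
apply/(is_segmentP M); exists y, z.
suff -> : [set u | A u /\ between x u y] `|` [set u | A u /\ between x u z] =
          [set u | A u /\ between y u z] by exact: segment_spec_of.
have yx := lmetric_sym M Ay Ax.
apply/seteqP; split=> u /=.
  move=> [] [Au]; rewrite /between => h; split=> //; move: h;
  have := lmetric_triangle M Ay Ax Au; have := lmetric_triangle M Ay Au Az;
  have := lmetric_triangle M Au Ax Az;
  rewrite ?(lmetric_sym M Au Ax) ?(lmetric_sym M Au Ay); oag_lia L.
move=> [Au]; rewrite /between => yuz.
have := mt_fourpoint T Ay Az Au Ax.
have := lmetric_triangle M Ax Au Az; have := lmetric_triangle M Ax Au Ay.
have := lmetric_ge0 M Ax Au; have := lmetric_sym M Au Ay.
rewrite (lmetric_sym M Az Ax) (lmetric_sym M Az Au) (lmetric_sym M Au Ax).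
move=> uy xu0 t1 t2 [] h; [right|left]; split=> //; oag_lia L.
Qed.

End Converse.
End Trees.

(** * Ends given by Busemann functions *)

Section Busemann.
Variables (L : oagType) (X : Type) (A : set X) (d : X -> X -> L).
Hypothesis T : median_tree A d.
Let M := mt_metric T.
Let segE := ltree_segE (median_tree_ltree T).
Implicit Types (x y z u v w : X) (h : X -> L) (B C : set X).

(** A Busemann function measures the distance to a point at infinity, up to a
    constant: the conditions are those of a median tree for tuples in which one
    point has moved to infinity. *)
Record busemann h : Prop := Busemann {
  bus_lipschitz : forall u v, A u -> A v -> h u <= d u v + h v;
  bus_fourpoint : forall u v w, A u -> A v -> A w ->
    d u v + h w <= d u w + h v \/ d u v + h w <= d v w + h u;
  bus_onto : forall x t, A x -> 0 <= t ->
    exists2 z, A z & d x z = t /\ d x z + h z = h x;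
  bus_median : forall x y, A x -> A y ->
    exists2 w, A w & [/\ between d x w y, d x w + h w = h x & d y w + h w = h y]
}.

Definition bus_ray h x : set X := [set z | A z /\ d x z + h z = h x].
Definition bus_end h : set (X * set X) := [set s | A s.1 /\ s.2 = bus_ray h s.1].

(** The endpoint condition keeps [x] from lying between two other points, so the
    distance from [x] orders a linear subtree starting there. *)
Lemma linear_from_dist x B y z : linear_from A d x B -> B y -> B z ->
  d y z = d x y - d x z \/ d y z = d x z - d x y.
Proof.
move=> [[BA _ _] [phi lin] [Bx ex]] By Bz.
have [Ax Ay Az] : [/\ A x, A y & A z] by split; exact: BA.
have [sum|//] : d y z = d x y + d x z \/
    (d y z = d x y - d x z \/ d y z = d x z - d x y).
  have := lin _ _ Bx By; have := lin _ _ Bx Bz; have := lin _ _ By Bz.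
  have := oabsP (phi x - phi y); have := oabsP (phi x - phi z).
  have := oabsP (phi y - phi z); do 3 case=> [] [? ->]; move=> *;
  by [left; oag_lia L|right; left; oag_lia L|right; right; oag_lia L].
have /(ex _ _ By Bz) : seg A d y z x.
  by rewrite segE //; split=> //; rewrite /between (lmetric_sym M Ay Ax).
move: sum; rewrite (lmetric_sym M Ax Ay) => sum [] E; rewrite E in sum *.
  by right; rewrite (dist_refl M Ay); oag_lia L.
by left; rewrite (dist_refl M Az); oag_lia L.
Qed.

Section Ray.
Variable h : X -> L.
Hypothesis H : busemann h.
Local Notation R := (bus_ray h).

Let Rx x : A x -> R x x.
Proof. by move=> Ax; split; rewrite ?(dist_refl M Ax) ?add0r. Qed.

Let R_dist x y z : A x -> R x y -> R x z -> d y z = h y - h z \/ d y z = h z - h y.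
Proof.
move=> Ax [Ay xy] [Az xz].
have := bus_fourpoint H Ay Az Ax; have := bus_lipschitz H Ay Az.
have := bus_lipschitz H Az Ay.
rewrite (lmetric_sym M Az Ay) (lmetric_sym M Ay Ax) (lmetric_sym M Az Ax) => ? ? [] ?.
  by right; oag_lia L.
by left; oag_lia L.
Qed.

Let R_linear_from x : A x -> linear_from A d x (R x).
Proof.
move=> Ax; split.
- split=> [z []//||y z Ry Rz u]; first by exists x; exact: Rx.
  have [[Ay xy] [Az xz]] := (Ry, Rz); rewrite segE // => -[Au].
  have := bus_lipschitz H Au Ay; have := bus_lipschitz H Au Az.
  have := bus_lipschitz H Ay Au; have := bus_lipschitz H Az Au.
  have := bus_lipschitz H Ax Au; have := lmetric_triangle M Ax Ay Au.
  have := lmetric_triangle M Ax Az Au; rewrite /between (lmetric_sym M Au Ay).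
  rewrite (lmetric_sym M Au Az) => *; split=> //.
  by case: (R_dist Ax Ry Rz) => ?; oag_lia L.
- exists h => y z Ry Rz; have := R_dist Ax Ry Rz; have := lmetric_ge0 M Ry.1 Rz.1.
  by case: (oabsP (h y - h z)) => [] [? ->] ? [] ?; oag_lia L.
split=> [|y z Ry Rz]; first exact: Rx.
have [[Ay xy] [Az xz]] := (Ry, Rz); rewrite segE // => -[_].
have [y0 z0] := (lmetric_ge0 M Ax Ay, lmetric_ge0 M Ax Az).
have := R_dist Ax Ry Rz; rewrite /between (lmetric_sym M Ay Ax) => -[] ? ?.
  by left; apply: (dist_eq0 M) => //; oag_lia L.
by right; apply: (dist_eq0 M) => //; oag_lia L.
Qed.

(** The ray already realises every distance from its origin, and in a linear
    subtree this distance determines the point. *)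
Lemma bus_is_ray x : A x -> is_ray A d x (R x).
Proof.
move=> Ax; split=> [|C lC RC]; first exact: R_linear_from.
apply/seteqP; split=> // c Cc; have Ac : A c by case: lC => [[CA _ _] _ _]; exact: CA.
have [z Az [xz Rz]] := bus_onto H Ax (lmetric_ge0 M Ax Ac).
have zR : R x z by [].
suff -> : c = z by [].
apply: (dist_eq0 M) => //.
by case: (linear_from_dist lC Cc (RC _ zR)) => ?; oag_lia L.
Qed.

(** Two rays towards the end merge at the median of their origins and the end. *)
Lemma bus_ray_equiv x y : A x -> A y -> ray_equiv A d (x, R x) (y, R y).
Proof.
move=> Ax Ay; have [w Aw [xwy wx wy]] := bus_median H Ax Ay.
exists w => /=.
have tailE z : A z -> d z w + h w = h z -> ray_tail A d (z, R z) w = R w.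
  move=> Az zw; apply/seteqP; split=> [u [[Au Ru]]|u [Au Ru]] /=.
    by rewrite segE // => -[_]; rewrite /between /= => *; split=> //; oag_lia L.
  have := lmetric_triangle M Az Aw Au; have := bus_lipschitz H Az Au.
  move=> *; split; first by split=> //; oag_lia L.
  by rewrite segE //; split=> //; rewrite /between /=; oag_lia L.
suff IE : R x `&` R y = R w by rewrite IE !tailE //; split=> //; exact: bus_is_ray.
apply/seteqP; split=> u /= => [[[Au ux] [_ uy]]|[Au uw]].
  split=> //; have := bus_fourpoint H Aw Au Ax.
  have := bus_lipschitz H Aw Au; have := lmetric_triangle M Ax Au Ay.
  move: xwy; rewrite /between (lmetric_sym M Au Ay) (lmetric_sym M Aw Ay).
  by rewrite (lmetric_sym M Au Ax) (lmetric_sym M Aw Ax) => *; split_ors; oag_lia L.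
have := bus_lipschitz H Ax Au; have := bus_lipschitz H Ay Au.
have := lmetric_triangle M Ax Aw Au; have := lmetric_triangle M Ay Aw Au.
by move=> *; split; split=> //; oag_lia L.
Qed.

Hypothesis L_neq0 : exists l : L, l <> 0.

(** Each point [b] of the ray lies before any sufficiently distant point of the
    common final part, and that point lies before the end. *)
Lemma ray_equiv_bus x s : A x -> is_ray A d s.1 s.2 ->
  ray_equiv A d (x, R x) s -> s.2 = R s.1.
Proof.
case: s => y B /= Ax [lB maxB] [w /= [[[_ _ [Iw _]] _] tx ts]].
have [[BA _ _] _ [By _]] := lB; have Ay := BA _ By.
apply/esym/maxB => [|b Bb]; first exact: R_linear_from.
have [[Aw wx] Bw] := Iw; have Ab := BA _ Bb.
have [l lpos] := oag_pos_ex L_neq0.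
(* The excess l separates z from w, as the four-point argument requires. *)
have [|z Az [wz zw]] := bus_onto H Aw (t := d y b + l).
  by rewrite oag_addr_ge0 ?(lmetric_ge0 M) // ltW.
have Iz : (R x `&` B) z.
  rewrite tx; have := bus_lipschitz H Ax Az; have := lmetric_triangle M Ax Aw Az.
  move=> *; split=> /=; first by split=> //; oag_lia L.
  by rewrite segE //; split=> //; rewrite /between /=; oag_lia L.
have Bz := Iz.2; move: (Iz); rewrite ts => -[_] /=; rewrite segE // => -[_].
have := linear_from_dist lB Bb Bz.
have := bus_fourpoint H Ay Az Aw; have := bus_fourpoint H Ay Az Ab.
have := bus_lipschitz H Ay Ab; have := bus_lipschitz H Ay Az.
have := bus_lipschitz H Ab Az.
have := lmetric_ge0 M Ay Ab; have := lmetric_ge0 M Ay Aw.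
have := lmetric_triangle M Ay Ab Az.
rewrite /between (lmetric_sym M Az Aw) (lmetric_sym M Az Ab) => *; split=> //.
by split_ors; oag_lia L.
Qed.

Lemma bus_is_end : is_end A d (bus_end h).
Proof.
have [x Ax] := lmetric_neq0 M; exists (x, R x) => /=.
split; first exact: bus_is_ray.
apply/seteqP; split=> [[y B] [/= Ay ->]|s [rs xs]].
  by split; [exact: bus_is_ray|exact: bus_ray_equiv].
split; last exact: ray_equiv_bus xs.
by case: rs => [[[BA _ _] _ [Bs _]] _]; exact: BA.
Qed.

Lemma bus_ray_to x : A x -> ray_to (bus_end h) x = R x.
Proof.
move=> Ax; apply/seteqP; split=> [z [_ [/= _ ->]]//|z Rz].
by exists (R x).
Qed.

Lemma bus_full_type : full_type A d (bus_end h).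
Proof.
move=> x Ax; rewrite bus_ray_to //; apply/seteqP; split=> [_ [z [Az _] <-]|t t0].
  exact: (lmetric_ge0 M Ax Az).
by have [z Az [<- zx]] := bus_onto H Ax t0; exists z.
Qed.

(** Every ray of the class is contained in the prescribed ray from its origin,
    hence equal to it by maximality. *)
Lemma bus_end_unique eps : is_end A d eps ->
  (forall x, A x -> ray_to eps x = R x) -> eps = bus_end h.
Proof.
move=> [r [_ epsE]] rayE.
have sub x B : eps (x, B) -> A x /\ B = R x.
  move=> exB; have [lB maxB] : is_ray A d x B by move: exB; rewrite epsE => -[].
  have [[BA _ _] _ [Bx _]] := lB; have Ax := BA _ Bx.
  split=> //; apply/esym/maxB; first exact: R_linear_from.
  by rewrite -(rayE _ Ax) => z Bz; exists B.
apply/seteqP; split=> [[x B] /sub|[x B] [/= Ax ->]] //.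
have : ray_to eps x x by rewrite rayE //; exact: Rx.
by move=> [C exC _]; have [_ <-] := sub _ _ exC.
Qed.

End Ray.
End Busemann.

(** * The tree of fibres and the ends of its edges *)

Section ZLexFacts.
Variable L0 : oagType.
Implicit Types x y : zlex L0.

Lemma zlex_eqP x y : x.1 = y.1 -> x.2 = y.2 -> x = y.
Proof. by case: x y => [? ?] [? ?] /= -> ->. Qed.

Lemma zlex_fstD x y : (x + y).1 = x.1 + y.1. Proof. by []. Qed.
Lemma zlex_sndD x y : (x + y).2 = x.2 + y.2. Proof. by []. Qed.

Lemma zlex_le_fst x y : x <= y -> x.1 <= y.1.
Proof. by rewrite zlex_leE => /andP[]. Qed.

Lemma zlex_le_snd x y : x.1 = y.1 -> (x <= y) = (x.2 <= y.2).
Proof. by move=> E; rewrite zlex_leE E lexx. Qed.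

Lemma zlex_lt_fst x y : x.1 < y.1 -> x <= y.
Proof. by move=> xy; rewrite zlex_leE (ltW xy) leNgt xy. Qed.
End ZLexFacts.

Section FibresAndEdges.
Variables (L0 : oagType) (X : ltree (zlex L0)).
Local Notation d := (@dist _ X).
Local Notation Xs := (xs_graph X).
Local Notation fibd := (@fibre_dist L0 X).
Implicit Types (x y z : X) (v w : xs_vert X) (e f : edge Xs).

Lemma dist_median_tree : median_tree setT d.
Proof. exact: (ltree_median_tree (ltreeP X)). Qed.
Let M := mt_metric dist_median_tree.

Lemma dist_self x : d x x = 0. Proof. exact: (dist_refl M). Qed.
Lemma dist_sym x y : d x y = d y x. Proof. exact: (lmetric_sym M). Qed.
Lemma dist_tri x y z : d x z <= d x y + d y z. Proof. exact: (lmetric_triangle M). Qed.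
Lemma dist_ge0 x y : 0 <= d x y. Proof. exact: (lmetric_ge0 M). Qed.
Lemma dist_4pt (x y z w : X) :
  d x y + d z w <= d x z + d y w \/ d x y + d z w <= d x w + d y z.
Proof. exact: (mt_fourpoint dist_median_tree). Qed.
Lemma dist_mid x y z : exists m, [/\ between d x m y, between d x m z & between d y m z].
Proof.
by have [m] := mt_median dist_median_tree (I : setT x) (I : setT y) (I : setT z); exists m.
Qed.

Lemma dist1_ge0 x y : 0 <= (d x y).1.
Proof. exact: zlex_le_fst (dist_ge0 x y). Qed.

Lemma xs_in v x y : sval v x -> (sval v y <-> (d x y).1 = 0).
Proof.
move=> vx; split; first exact: xs_dist_same.
move=> xy; case: v vx => V /= [z Vz]; rewrite Vz /fibre /= => zx.
have := dist1_triangle z x y; have := dist1_ge0 z y; lia.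
Qed.

Lemma xs_vert_eq v w x : sval v x -> sval w x -> v = w.
Proof.
move=> vx wx; case: v w vx wx => [V vP] [W wP] vx wx; apply: eq_exist.
apply/seteqP; split=> y.
  by move=> /(xs_in (v := exist _ V vP) y vx) /(xs_in (v := exist _ W wP) y wx).
by move=> /(xs_in (v := exist _ W wP) y wx) /(xs_in (v := exist _ V vP) y vx).
Qed.

Lemma xs_dist_eq0 v w : xs_dist v w = 0 -> v = w.
Proof.
move=> vw; apply: (@xs_vert_eq _ _ (xs_repr w)); last exact: xs_repr_in.
by apply/(xs_in _ (xs_repr_in v)).
Qed.

Lemma xs_dist_ge0 v w : 0 <= xs_dist v w. Proof. exact: dist1_ge0. Qed.

Lemma xs_dist_sym v w : xs_dist v w = xs_dist w v. Proof. exact: dist1_sym. Qed.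

Lemma xs_dist_4pt (u v w t : xs_vert X) :
  xs_dist u v + xs_dist w t <= xs_dist u w + xs_dist v t \/
  xs_dist u v + xs_dist w t <= xs_dist u t + xs_dist v w.
Proof.
by case: (dist_4pt (xs_repr u) (xs_repr v) (xs_repr w) (xs_repr t)) => /zlex_le_fst;
  [left|right].
Qed.

(** Medians make the perimeter of a triangle even. *)
Lemma xs_dist_even (u v w : xs_vert X) :
  exists k : int, xs_dist u v + xs_dist v w + xs_dist u w = k + k.
Proof.
have [m [uv uw vw]] := dist_mid (xs_repr u) (xs_repr v) (xs_repr w).
exists ((d (xs_repr u) m).1 + (d m (xs_repr v)).1 + (d m (xs_repr w)).1).
rewrite /xs_dist -uv -uw -vw !zlex_fstD (dist1_sym (xs_repr v) m); lia.
Qed.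

Lemma xs_edge_dist e : xs_dist (orig e) (orig (erev e)) = 1.
Proof. exact: (svalP e). Qed.

Lemma xs_edge_eq e f : orig e = orig f -> orig (erev e) = orig (erev f) -> e = f.
Proof.
case: e f => [[v w] vw] [[v' w'] vw'] /=; rewrite /xs_orig /= => vv ww.
by apply: eq_exist; rewrite vv ww.
Qed.

Lemma xs_edge_ex v w : xs_dist v w = 1 -> exists e : edge Xs, orig e = v /\ orig (erev e) = w.
Proof. by move=> vw; exists (exist (fun p => xs_dist p.1 p.2 = 1) (v, w) vw). Qed.

(** Backtracking is the only way to stop moving away: two successive edges of a
    reduced walk span distance 2 by parity, and the four-point condition
    propagates this along the walk. *)
Lemma reduced_walk_dist (u w : vert Xs) p :
  reduced p -> walk (full_subgraph Xs) u p w -> xs_dist u w = (size p)%:Z.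
Proof.
have [n] := ubnP (size p); elim: n p u => // n IHn [|e p] u pn red.
  by move=> [_ ->]; rewrite /xs_dist dist1_refl.
move=> [_ eu wp].
have red' : reduced p by move=> p1 f p2 E; apply: (red (e :: p1) f p2); rewrite E.
have IHp := IHn p _ pn red' wp.
case: p pn red red' wp IHp => [|f p] pn red red'.
  by move=> [_ <-] _; rewrite -eu xs_edge_dist.
move=> [_ fe wp] IHp.
have red'' : reduced p.
  by move=> p1 g p2 E; apply: (red' (f :: p1) g p2); rewrite E.
have IHp' := IHn p _ (ltnW pn) red'' wp.
have uf : u <> orig (erev f).
  move=> uf; apply: (red [::] e p); congr (_ :: _ :: _).
  by apply: xs_edge_eq; rewrite ?erevK // -uf.
have d1 := xs_edge_dist e; have d2 := xs_edge_dist f; rewrite eu -fe in d1.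
have [k K] := xs_dist_even u (orig f) (orig (erev f)).
have ne0 : xs_dist u (orig (erev f)) <> 0 by move=> /xs_dist_eq0.
have := xs_dist_4pt (orig f) w u (orig (erev f)).
have := xs_dist_4pt u w (orig f) (orig (erev f)).
have := xs_dist_ge0 u (orig (erev f)); have := xs_dist_sym w (orig (erev f)).
have := xs_dist_sym w u; have := xs_dist_sym (orig f) u.
have := xs_dist_4pt u (orig (erev f)) (orig f) (orig f).
have ff : xs_dist (orig f) (orig f) = 0 by rewrite /xs_dist dist1_refl.
have := xs_dist_sym (orig f) (orig (erev f)).
by rewrite -fe in IHp; move: (xs_dist_sym w (orig f)) IHp IHp' d1 d2 K ne0 ff => /=; lia.
Qed.

Lemma xs_walk v w : exists p, walk (full_subgraph Xs) v p w.
Proof.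
have [n vw] : exists n : nat, xs_dist v w = n%:Z.
  by have := xs_dist_ge0 v w; case: (xs_dist v w) => // n _; exists n.
elim: n v vw => [|n IHn] v vw; first by exists [::]; split=> //; exact: xs_dist_eq0.
have [u vu uw] : exists2 u, xs_dist v u = 1 & xs_dist u w = n%:Z.
  case: n {IHn} vw => [|n] vw.
    by exists w => //; rewrite /xs_dist dist1_refl.
  (* The point of the segment at distance (1, 0) lies in an adjacent fibre. *)
  have [||z _ [vz zw]] := mt_geodesic dist_median_tree (x := xs_repr v) (y := xs_repr w)
      (t := zpair 1 0) I I.
  - exact: zlex_lt_fst.
  - by apply: zlex_lt_fst; move: vw; rewrite /xs_dist /= => ->.
  exists (xs_proj z).
    by rewrite (@xs_distE _ _ _ _ (xs_repr v) z) ?vz //; [exact: xs_repr_in|exact: dist1_refl].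
  rewrite (@xs_distE _ _ _ _ z (xs_repr w)); last exact: xs_repr_in.
    have := congr1 fst zw; rewrite zlex_fstD vz; move: vw; rewrite /xs_dist => -> /=; lia.
  exact: dist1_refl.
have [e [ev eu]] := xs_edge_ex vu; have [p pP] := IHn u uw.
by exists (e :: p); split=> //; rewrite eu.
Qed.

Lemma xs_is_tree : is_tree Xs.
Proof.
split; first by have [x _] := lmetric_neq0 M; exists (xs_proj x).
  by move=> v w _ _; exact: xs_walk.
move=> u p red /(reduced_walk_dist red); rewrite /xs_dist dist1_refl.
by case: p red.
Qed.

Section Fibre.
Variables (v : xs_vert X) (d0 : X -> X -> L0).
Hypothesis d0E : forall x y, sval v x -> sval v y -> d x y = zpair 0 (d0 x y).

Let d0_snd x y : sval v x -> sval v y -> d0 x y = (d x y).2.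
Proof. by move=> vx vy; rewrite d0E. Qed.

(** A point that cuts a distance in 0 x Λ0 additively stays in the fibre, since
    first coordinates are nonnegative. *)
Lemma fibre_median_tree : median_tree (sval v) d0.
Proof.
split.
- split.
  + by exists (xs_repr v); exact: xs_repr_in.
  + by move=> x y vx vy; have := dist_ge0 x y; rewrite d0E // zlex_le_snd.
  + move=> x y vx vy; split=> [xy|->]; last by rewrite d0_snd // dist_self.
    by apply: (dist_eq0 M) => //; rewrite d0E // xy.
  + by move=> x y vx vy; rewrite !d0_snd // dist_sym.
  move=> x y z vx vy vz; have := dist_tri x y z.
  by rewrite !d0E // zlex_le_snd //= addr0.
- move=> x y t vx vy t0 txy.
  have [||z _ [xz xzy]] := mt_geodesic dist_median_tree (x := x) (y := y)
    (t := zpair 0 t) I I.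
  - by rewrite zlex_le_snd.
  - by rewrite d0E // zlex_le_snd.
  have vz : sval v z by apply/(xs_in _ vx); rewrite xz.
  exists z => //; rewrite /between !d0_snd // xz; split=> //.
  by rewrite -xzy xz zlex_sndD.
- move=> x y z w vx vy vz vw; have := dist_4pt x y z w.
  by rewrite !d0E // !zlex_le_snd //= !addr0.
move=> x y z vx vy vz; have [m [xy xz yz]] := dist_mid x y z.
have vm : sval v m.
  apply/(xs_in _ vx); have := congr1 fst xy; rewrite zlex_fstD [d x y]d0E //=.
  have := dist1_ge0 x m; have := dist1_ge0 m y; lia.
by exists m => //; rewrite /between !d0_snd // -xy -xz -yz.
Qed.
End Fibre.

Lemma fibre_distE v x y : sval v x -> sval v y -> d x y = zpair 0 (fibd x y).
Proof. by move=> vx vy; apply: zlex_eqP => //=; exact: xs_dist_same vx vy. Qed.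

(** ** Busemann functions of edges *)

Lemma edge_dist e x y : sval (orig e) x -> sval (orig (erev e)) y -> (d x y).1 = 1.
Proof. by move=> ex ey; rewrite -(xs_distE ex ey) xs_edge_dist. Qed.

(** Of the three sums in the four-point condition the third is smaller, as its
    first coordinate is 0 instead of 2. *)
Lemma edge_cross e x x' y y' :
  sval (orig e) x -> sval (orig e) x' -> sval (orig (erev e)) y ->
  sval (orig (erev e)) y' -> d x y + d x' y' = d x y' + d x' y.
Proof.
move=> ex ex' ey ey'; have xx := xs_dist_same ex ex'; have yy := xs_dist_same ey ey'.
have := dist_4pt x y x' y'; have := dist_4pt x y' x' y.
rewrite (dist_sym y x') (dist_sym y' x') (dist_sym y' y).
have G z z' : sval (orig (erev e)) z -> sval (orig (erev e)) z' ->
    ~ (d x z + d x' z' <= d x x' + d y y').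
  by move=> ez ez' /zlex_le_fst; rewrite !zlex_fstD xx yy (edge_dist ex ez) (edge_dist ex' ez').
case=> [/G[]//|h1] [/G[]//|h2].
by apply/eqP; rewrite eq_le h1 h2.
Qed.

(** The distance of [x] to a point over the far end of [e], which plays the part
    of a point at infinity of the fibre. *)
Definition height e x : L0 := (d x (xs_repr (orig (erev e)))).2.
Definition edge_end e : set (X * set X) := bus_end (sval (orig e)) fibd (height e).

Let dist_height e x : sval (orig e) x ->
  d x (xs_repr (orig (erev e))) = zpair 1 (height e x).
Proof. by move=> ex; apply: zlex_eqP => //=; apply: edge_dist ex (xs_repr_in _). Qed.

(** These are the properties of [X] for tuples containing the far point; the first
    coordinates 1 of its distances to the fibre cancel. *)
Lemma height_busemann e d0 :
  (forall x y, sval (orig e) x -> sval (orig e) y -> d x y = zpair 0 (d0 x y)) ->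
  busemann (sval (orig e)) d0 (height e).
Proof.
move=> d0E; set y0 := xs_repr (orig (erev e)).
have hE x : sval (orig e) x -> d x y0 = zpair 1 (height e x) by exact: dist_height.
split.
- move=> u v eu ev; have := dist_tri u v y0.
  by rewrite (d0E _ _ eu ev) (hE _ eu) (hE _ ev) zlex_le_snd.
- move=> u v w eu ev ew; have := dist_4pt u v w y0.
  rewrite (d0E _ _ eu ev) (d0E _ _ eu ew) (d0E _ _ ev ew) (hE _ eu) (hE _ ev) (hE _ ew).
  rewrite !zlex_le_snd //= [height e u + _]addrC.
  by case=> h; [left|right]; rewrite // addrC.
- move=> x t ex t0; have [||z _ [xz xzy]] := mt_geodesic dist_median_tree (x := x) (y := y0)
    (t := zpair 0 t) I I.
  - by rewrite zlex_le_snd.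
  - by apply: zlex_lt_fst; rewrite hE.
  have ez : sval (orig e) z by apply/(xs_in _ ex); rewrite xz.
  have E : d0 x z = t by move: xz; rewrite (d0E _ _ ex ez) => -[].
  exists z => //; split=> //; have := congr1 snd xzy.
  by rewrite zlex_sndD (d0E _ _ ex ez) (hE _ ex) (hE _ ez).
move=> x y ex ey; have [w [xy xw yw]] := dist_mid x y y0.
have ew : sval (orig e) w.
  apply/(xs_in _ ex); have := congr1 fst xy; rewrite zlex_fstD (d0E _ _ ex ey) /=.
  have := dist1_ge0 x w; have := dist1_ge0 w y; lia.
exists w => //; split.
- have := congr1 snd xy.
  by rewrite zlex_sndD (d0E _ _ ex ew) (d0E _ _ ew ey) (d0E _ _ ex ey).
- by have := congr1 snd xw; rewrite zlex_sndD (d0E _ _ ex ew) (hE _ ex) (hE _ ew).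
by have := congr1 snd yw; rewrite zlex_sndD (d0E _ _ ey ew) (hE _ ey) (hE _ ew).
Qed.

Lemma edge_rayP e x y z : sval (orig e) x -> sval (orig (erev e)) y ->
  bus_ray (sval (orig e)) fibd (height e) x z <->
  sval (orig e) z /\ between d x z y.
Proof.
move=> ex ey; set y0 := xs_repr (orig (erev e)).
have ey0 : sval (orig (erev e)) y0 := xs_repr_in _.
split=> -[ez zP]; split=> //.
  have zP0 : between d x z y0.
    rewrite /between (fibre_distE ex ez) !dist_height //.
    by apply: zlex_eqP => //=; rewrite zlex_sndD.
  have := edge_cross ex ez ey ey0; move: zP0; rewrite /between => h1 h2.
  oag_lia (zlex L0).
have zP0 : between d x z y0.
  by have := edge_cross ex ez ey ey0; move: zP; rewrite /between => h1 h2; oag_lia (zlex L0).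
by have := congr1 snd zP0; rewrite zlex_sndD (fibre_distE ex ez) !dist_height.
Qed.

(** Rays and ends only depend on the values of the metric on the fibre. *)
Lemma edge_endE e d0 :
  (forall x y, sval (orig e) x -> sval (orig e) y -> d x y = zpair 0 (d0 x y)) ->
  edge_end e = bus_end (sval (orig e)) d0 (height e).
Proof.
move=> d0E; have E x y : sval (orig e) x -> sval (orig e) y -> fibd x y = d0 x y.
  by move=> ex ey; rewrite /fibre_dist d0E.
have R x : sval (orig e) x -> bus_ray (sval (orig e)) fibd (height e) x =
    bus_ray (sval (orig e)) d0 (height e) x.
  by move=> ex; apply/seteqP; split=> z [ez zP]; split=> //; rewrite ?E // -?E.
by apply/seteqP; split=> -[x B] [/= ex ->]; split=> //=; rewrite R.
Qed.

Hypothesis L0_neq0 : exists l : L0, l <> 0.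

(** The edge prescribes the rays, and these determine the end. *)
Lemma is_edge_endP e eps : is_edge_end e eps <-> eps = edge_end e.
Proof.
have T := fibre_median_tree (@fibre_distE (orig e)).
have H := height_busemann (@fibre_distE (orig e)).
have segE x y : seg [set: X] d x y = [set u | between d x u y].
  rewrite (ltree_segE (ltreeP X)) //; apply/seteqP; split=> u; [by case|by split].
have rayE x y : sval (orig e) x -> sval (orig (erev e)) y ->
    seg [set: X] d x y `&` sval (orig e) = bus_ray (sval (orig e)) fibd (height e) x.
  move=> ex ey; rewrite segE; apply/seteqP; split=> u.
    by move=> [/= xu eu]; apply/(edge_rayP _ ex ey).
  by move/(edge_rayP _ ex ey) => [].
split=> [[Ee eP]|->].
  apply: (bus_end_unique T H Ee) => x ex.
  by rewrite -(eP _ _ ex (xs_repr_in _)) rayE //; exact: xs_repr_in.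
split; first exact: bus_is_end.
by move=> x y ex ey; rewrite rayE // bus_ray_to.
Qed.

(** Two edges with the same origin leave the fibre along different rays, since
    the segment between points over their far ends turns in the fibre. *)
Lemma edge_end_inj e f : orig e = orig f -> edge_end e = edge_end f -> e = f.
Proof.
move=> ef EE; apply: contrapT => nef.
have nd : orig (erev e) <> orig (erev f) by move=> h; apply: nef; exact: xs_edge_eq.
set y := xs_repr (orig (erev e)); set z := xs_repr (orig (erev f)).
set x := xs_repr (orig e).
have ey : sval (orig (erev e)) y := xs_repr_in _.
have fz : sval (orig (erev f)) z := xs_repr_in _.
have ex : sval (orig e) x := xs_repr_in _.
have fx : sval (orig f) x by rewrite -ef.
have [m [xmy xmz ymz]] := dist_mid x y z.
have xy1 := edge_dist ex ey; have xz1 := edge_dist fx fz.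
have yz0 : (d y z).1 <> 0.
  by move=> h; apply: nd; apply: (@xs_vert_eq _ _ z) => //; apply/(xs_in _ ey).
have em : sval (orig e) m.
  apply/(xs_in _ ex); have := congr1 fst xmy; have := congr1 fst xmz.
  have := congr1 fst ymz; rewrite !zlex_fstD xy1 xz1 (dist1_sym y m).
  have := dist1_ge0 x m; have := dist1_ge0 m y; have := dist1_ge0 m z; lia.
have [l l0] := oag_pos_ex L0_neq0.
(* The segment from y to z turns at m; a point further along the first ray is
   not on the second. *)
have [u eu [mu uR]] := bus_onto (height_busemann (@fibre_distE (orig e))) em (ltW l0).
have eRu : bus_ray (sval (orig e)) fibd (height e) m u by [].
have fRu : bus_ray (sval (orig f)) fibd (height f) m u.
  have : edge_end e (m, bus_ray (sval (orig e)) fibd (height e) m) by [].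
  by rewrite EE => -[_ <-].
have fm : sval (orig f) m by rewrite -ef.
have [_ muy] := (edge_rayP u em ey).1 eRu.
have [_ muz] := (edge_rayP u fm fz).1 fRu.
have : d m u = 0.
  move: muy muz ymz; have := dist_tri y u z; have := dist_ge0 m u.
  rewrite /between (dist_sym y m) (dist_sym y u) => *; oag_lia (zlex L0).
by rewrite (fibre_distE em eu) mu => -[l00]; rewrite l00 ltxx in l0.
Qed.

Section Equivariance.
Variables (Gamma : groupType) (beta : {multiplicative Gamma -> oaut (zlex L0)}).
Variable a : affine_action beta X.

Lemma between_act g x y z : between d (a g x) (a g y) (a g z) <-> between d x y z.
Proof.
rewrite /between !aact_affine -oautD; split=> [|->] //.
exact: (can_inj (@oautK _ (beta g))).
Qed.

Lemma edge_end_act g e : end_image (a g) (edge_end e) = edge_end (eact (xs_action a) g e).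
Proof.
set e' := eact _ g e.
have Eo v x : sval (vact (xs_action a) g v) (a g x) <-> sval v x.
  split=> [[x' vx' /(can_inj (aactK a g)) <-]//|vx]; by exists x.
have Oe : orig e' = vact (xs_action a) g (orig e) by rewrite eact_orig.
have Oe' : orig (erev e') = vact (xs_action a) g (orig (erev e)) by rewrite eact_rev eact_orig.
set y := xs_repr (orig (erev e)); have ey : sval (orig (erev e)) y := xs_repr_in _.
have ey' : sval (orig (erev e')) (a g y) by rewrite Oe'; apply/Eo.
have rayE x : sval (orig e) x ->
    a g @` bus_ray (sval (orig e)) fibd (height e) x =
    bus_ray (sval (orig e')) fibd (height e') (a g x).
  move=> ex; have ex' : sval (orig e') (a g x) by rewrite Oe; apply/Eo.
  apply/seteqP; split=> [_ [z /(edge_rayP _ ex ey)[ez xzy] <-]|z'].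
    by apply/(edge_rayP _ ex' ey'); split; [rewrite Oe; apply/Eo|apply/between_act].
  move=> /(edge_rayP _ ex' ey')[]; rewrite Oe => -[z ez <-] /between_act xzy.
  by exists z => //; apply/(edge_rayP _ ex ey).
apply/seteqP; split=> [_ [[x B] [/= ex ->] <-]|[x' B] []].
  by split; [rewrite Oe; apply/Eo|exact: rayE].
move=> /[swap]; rewrite [X in X -> _]/= => ->; rewrite Oe => -[x ex /= <-].
by exists (x, bus_ray (sval (orig e)) fibd (height e) x); rewrite //= rayE.
Qed.
End Equivariance.

End FibresAndEdges.

(** * Walks and quotient graphs *)

Section Walks.
Variables (Y : graph) (T : subgraph Y).
Implicit Types (u v w : vert Y) (e : edge Y) (p : seq (edge Y)).

Lemma walk_start u p v : walk T u p v -> sv T u.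
Proof. by case: p => [|e p] [] // Te <- _; exact: se_orig. Qed.

Lemma walk_end u p v : walk T u p v -> sv T v.
Proof. by elim: p u => [|e p IHp] u; [move=> [? <-]|move=> [_ _ /IHp]]. Qed.

Lemma walk_cat u p q v : walk T u (p ++ q) v <-> exists2 w, walk T u p w & walk T w q v.
Proof.
elim: p u => [|e p IHp] u /=.
  by split=> [uv|[_ [_ <-]] //]; exists u => //; split=> //; exact: walk_start uv.
by split=> [[Te eu /IHp[w ? ?]]|[w [Te eu pw] wq]]; [exists w|split=> //; apply/IHp; exists w].
Qed.

Lemma walk_sym u p v : walk T u p v -> exists q, walk T v q u.
Proof.
elim: p u => [|e p IHp] u; first by move=> [Tu uv]; exists [::]; rewrite /= -uv.
move=> [Te eu /IHp[q vq]]; exists (q ++ [:: erev e]); apply/walk_cat.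
exists (orig (erev e)) => //; split=> //; first exact: se_rev.
by rewrite erevK; split=> //; exact: se_orig.
Qed.

Lemma walk_reduce u p v : walk T u p v -> exists2 q, reduced q & walk T u q v.
Proof.
have [n] := ubnP (size p); elim: n p => // n IHn p pn puv.
have [red|] := pselect (reduced p); first by exists p.
move=> /existsNP[p1 /existsNP[e /existsNP[p2 /contrapT pE]]].
apply: (IHn (p1 ++ p2)); first by move: pn; rewrite pE !size_cat /=; lia.
move: puv; rewrite pE => /walk_cat[w p1w [_ ew [_ _]]]; rewrite erevK ew => p2v.
by apply/walk_cat; exists w.
Qed.

End Walks.

Section Quotient.
Variables (Gamma : groupType) (Z : graph) (a : gaction Gamma Z).
Hypothesis a_wi : without_inversions a.
Local Notation Y := (quotient_graph a_wi).

Lemma vactK h : cancel (vact a h) (vact a h^-1%g).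
Proof. by move=> v; rewrite -vactM mulVg vact1. Qed.
Lemma vactVK h : cancel (vact a h^-1%g) (vact a h).
Proof. by move=> v; rewrite -vactM mulgV vact1. Qed.
Lemma eactK h : cancel (eact a h) (eact a h^-1%g).
Proof. by move=> v; rewrite -eactM mulVg eact1. Qed.
Lemma eactVK h : cancel (eact a h^-1%g) (eact a h).
Proof. by move=> v; rewrite -eactM mulgV eact1. Qed.

Lemma vproj_act h v : vproj a (vact a h v) = vproj a v.
Proof.
apply: eq_exist; apply/seteqP; split=> _ [k _ <-]; first by exists (k * h)%g; rewrite ?vactM.
by exists (k * h^-1)%g => //; rewrite vactM vactK.
Qed.

Lemma eproj_act h e : eproj a (eact a h e) = eproj a e.
Proof.
apply: eq_exist; apply/seteqP; split=> _ [k _ <-]; first by exists (k * h)%g; rewrite ?eactM.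
by exists (k * h^-1)%g => //; rewrite eactM eactK.
Qed.

Lemma vproj_eq v w : vproj a v = vproj a w -> exists h, vact a h v = w.
Proof.
move=> /(congr1 sval) /= /seteqP[_ /(_ w)] []; first by exists 1%g; rewrite ?vact1.
by move=> h _ <-; exists h.
Qed.

Lemma eproj_eq e f : eproj a e = eproj a f -> exists h, eact a h e = f.
Proof.
move=> /(congr1 sval) /= /seteqP[_ /(_ f)] []; first by exists 1%g; rewrite ?eact1.
by move=> h _ <-; exists h.
Qed.

Lemma orig_eproj e : orig (eproj a e : edge Y) = vproj a (orig e).
Proof. by apply: eq_exist; exact: orig_eorbit. Qed.

Lemma erev_eproj e : erev (eproj a e : edge Y) = eproj a (erev e).
Proof. by apply: eq_exist; exact: rev_eorbit. Qed.

Lemma eproj_surj (E : qedge a) : exists e, eproj a e = E.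
Proof. by case: E => O [e eO]; exists e; apply: eq_exist. Qed.
Lemma vproj_surj (x : qvert a) : exists v, vproj a v = x.
Proof. by case: x => O [v vO]; exists v; apply: eq_exist. Qed.
End Quotient.

(** * The universal property of a presentation *)

Section Presented.
Variables (A : Type) (R : word A -> word A -> Prop) (Gamma : groupType) (f : A -> Gamma).

Definition letter_val (l : A * bool) : Gamma := if l.2 then (f l.1)^-1%g else f l.1.
Definition word_val (u : word A) : Gamma := foldr (fun l h => letter_val l * h)%g 1%g u.

Lemma word_val_cat u v : word_val (u ++ v) = (word_val u * word_val v)%g.
Proof. by elim: u => [|l u IHu] /=; rewrite ?mul1g // IHu mulgA. Qed.

Hypothesis fR : forall u v, R u v -> word_val u = word_val v.

Lemma word_val_eq u v : pres_eq R u v -> word_val u = word_val v.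
Proof.
elim=> {u v} [//|u v _ -> //|u v w _ -> _ -> //|u u' v v' _ uu _ vv|x b|u v /fR//].
  by rewrite !word_val_cat uu vv.
by case: b; rewrite /= /letter_val /= mulg1 ?mulVg ?mulgV.
Qed.

Definition pres_hom (p : presented R) : Gamma := word_val (prepr p).

Lemma pres_hom_cls u : pres_hom (pcls R u) = word_val u.
Proof. by apply: word_val_eq; exact: prepr_eq. Qed.

Lemma pres_homM : {morph pres_hom : p q / (p * q)%g >-> (p * q)%g}.
Proof.
by elim/presW=> u; elim/presW=> v; rewrite -[(_ * _)%g]pcls_cat !pres_hom_cls word_val_cat.
Qed.

HB.instance Definition _ := isMultiplicative.Build (presented R) Gamma pres_hom pres_homM.

Lemma pres_hom_ex : exists Phi : {multiplicative presented R -> Gamma},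
  forall x, Phi (pgen R x) = f x.
Proof. by exists pres_hom => x; rewrite [LHS]pres_hom_cls /= mulg1. Qed.

End Presented.

Section Homs.
Variables (P Q : groupType) (Phi : {multiplicative P -> Q}).
Lemma hom1 : Phi 1%g = 1%g.
Proof. by apply: (@mulgI _ (Phi 1%g)); rewrite -gmulfM !mulg1. Qed.
Lemma homV x : Phi x^-1%g = (Phi x)^-1%g.
Proof. by apply: (@mulgI _ (Phi x)); rewrite -gmulfM !mulgV hom1. Qed.
End Homs.

Section Cosets.
Variables (P : groupType) (H : set P).
Hypothesis sH : is_subgroup H.

Lemma lcos_eq w w' : lcos w H = lcos w' H <-> H (w^-1 * w')%g.
Proof.
have [H1 HM HV] := sH; split=> [E|Hw].
  have : lcos w' H w' by exists 1%g; rewrite ?mulg1.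
  by rewrite -E => -[h Hh <-]; rewrite mulKg.
apply/seteqP; split=> _ [h Hh <-].
  exists ((w^-1 * w')^-1 * h)%g; first by apply: HM => //; exact: HV.
  by rewrite invgM invgK !mulgA mulgV mul1g.
exists (w^-1 * w' * h)%g; first exact: HM.
by rewrite !mulgA mulgV mul1g.
Qed.
End Cosets.

(** * The structure theorem for groups acting on trees *)

Lemma inj_surj_bij (S T : Type) (f : S -> T) :
  injective f -> (forall y, exists x, f x = y) -> bijective f.
Proof. by move=> f_inj /choice[h hK]; exists h => // x; apply: f_inj. Qed.

Section BassSerre.
Variables (Gamma : groupType) (Z : graph) (a : gaction Gamma Z).
Hypothesis a_wi : without_inversions a.
Local Notation Y := (quotient_graph a_wi).
Variables (G : graph_of_groups Gamma Y) (g : edge Y -> Gamma) (T0 : subgraph Z).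
Variables (vrep : vert Y -> vert Z) (erep : edge Y -> edge Z).
Local Notation triv := [set e | sv T0 (orig (erep e))].

Hypothesis Z_tree : is_tree Z.
Hypothesis T0_tree : is_subtree T0.
Hypothesis vrep_T0 : forall x, sv T0 (vrep x).
Hypothesis vrepK : forall x, vproj a (vrep x) = x.
Hypothesis erepK : forall e, eproj a (erep e) = e.
Hypothesis erep_rev : forall e, erep (erev e) = erev (erep e).
Hypothesis erep_T0 : forall f, se T0 f -> erep (eproj a f) = f.
Hypothesis g_orig : forall e, vact a (g e) (vrep (orig e)) = orig (erep e).
Hypothesis g_triv : forall e, triv e -> g e = 1%g.
Hypothesis triv_or : forall e, triv e \/ triv (erev e).
Hypothesis vgrpE : forall x, vgrp G x = [set s | vact a s (vrep x) = vrep x].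
Hypothesis egrpE : forall e, egrp G e = [set s | eact a s (erep e) = erep e].
Hypothesis gembE : forall e s, egrp G e s -> gemb G e s = ((g e)^-1 * s * g e)%g.

Local Notation P := (pi1 G triv).
Local Notation B := (bs_graph G triv).
Local Notation b := (bs_action G triv).
Local Notation vsub := (@pi1_vsub Gamma Y G triv).
Local Notation esub := (@pi1_esub Gamma Y G triv).
Local Notation pe := (pi1_edge G triv).

Definition gen_val (x : pi1_gen G) : Gamma :=
  match x with inl p => (sval p).2 | inr e => g e end.

Lemma gen_val_rel u v : pi1_rel triv u v -> word_val gen_val u = word_val gen_val v.
Proof.
case=> [x s t xs xt xst|e s es fs Ge|e /g_triv te]; rewrite /= /letter_val /= ?mulg1 ?te //.
rewrite !gembE ?egrp_rev //.
by rewrite !mulgA !mulgV !mul1g -!mulgA !mulgV !mulg1.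
Qed.

Section Iso.
Variable Phi : {multiplicative P -> Gamma}.
Hypothesis Phi_gen : forall x, Phi (pgen (pi1_rel triv) x) = gen_val x.

Lemma Phi_vgrp x s (xs : vgrp G x s) : Phi (pi1_vgrp triv xs) = s.
Proof. exact: (Phi_gen (vgen xs)). Qed.
Lemma Phi_edge e : Phi (pe e) = g e.
Proof. exact: (Phi_gen (egen G e)). Qed.

Lemma pe_triv e : triv e -> pe e = 1%g.
Proof. by move=> te; apply/pclsP/pres_rel; exact: pi1_rel_triv. Qed.

Lemma vsub_subgroup x : is_subgroup (vsub x).
Proof.
have [H1 HM HV] := vgrp_subgroup G x; split.
- by exists 1%g, H1; rewrite pi1_vgrp1.
- move=> _ _ [s [xs ->]] [t [xt ->]].
  by exists (s * t)%g, (HM _ _ xs xt); exact: pi1_vgrpM.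
move=> _ [s [xs ->]]; exists s^-1%g, (HV _ xs).
apply: (@mulgI _ (pi1_vgrp triv xs)); rewrite mulgV.
have x1 : vgrp G x (s * s^-1)%g by rewrite mulgV.
by rewrite (pi1_vgrpM triv xs (HV _ xs) x1) -(pi1_vgrp1 triv H1); apply: pi1_vgrp_eq; rewrite mulgV.
Qed.

Lemma esub_subgroup e : is_subgroup (esub e).
Proof.
have [H1 HM HV] := egrp_subgroup G e.
have [V1 VM VV] := vsub_subgroup (orig e).
have E1 : gemb G e 1%g = 1%g.
  by apply: (@mulgI _ (gemb G e 1%g)); rewrite -gembM // !mulg1.
have emb s t (es : egrp G e s) (et : egrp G e t) (est : egrp G e (s * t)%g) :
    (pi1_vgrp triv (gemb_in es) * pi1_vgrp triv (gemb_in et))%g =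
    pi1_vgrp triv (gemb_in est).
  have k : vgrp G (orig e) (gemb G e s * gemb G e t)%g by rewrite -gembM //; exact: gemb_in.
  by rewrite (pi1_vgrpM triv (gemb_in es) (gemb_in et) k); apply: pi1_vgrp_eq; rewrite gembM.
have emb1 (e1 : egrp G e 1%g) : pi1_vgrp triv (gemb_in e1) = 1%g.
  apply: (@mulgI _ (pi1_vgrp triv (gemb_in e1))); rewrite mulg1.
  have e11 : egrp G e (1 * 1)%g by rewrite mulg1.
  by rewrite (emb _ _ e1 e1 e11); apply: pi1_vgrp_eq; rewrite mulg1.
split.
- by exists 1%g, H1; rewrite emb1 mulg1 mulgV.
- move=> _ _ [s [es ->]] [t [et ->]]; exists (s * t)%g, (HM _ _ es et).
  by rewrite -(emb _ _ es et) !mulgA -[(_ * (pe e)^-1 * pe e)%g]mulgA mulVg mulg1.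
move=> _ [s [es ->]]; exists s^-1%g, (HV _ es).
rewrite !invgM invgK mulgA; congr (_ * _ * _)%g.
apply: (@mulgI _ (pi1_vgrp triv (gemb_in es))); rewrite mulgV.
have e1 : egrp G e (s * s^-1)%g by rewrite mulgV.
rewrite (emb _ _ es (HV _ es) e1) -(emb1 H1); apply: pi1_vgrp_eq; rewrite mulgV //.
Qed.

Lemma Phi_vsub x w : vsub x w -> vact a (Phi w) (vrep x) = vrep x.
Proof. by move=> [s [xs ->]]; rewrite Phi_vgrp; move: (xs); rewrite vgrpE. Qed.

Lemma Phi_esub e w : esub e w -> eact a (Phi w) (erep e) = erep e.
Proof.
move=> [s [es ->]]; rewrite !gmulfM homV Phi_edge Phi_vgrp gembE //.
by rewrite !mulgA mulgV mul1g -!mulgA mulgV mulg1; move: (es); rewrite egrpE.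
Qed.

(** ** The Bass-Serre graph and its map to the tree *)

Definition bv w x : vert B := vact b w (bs_vbase G triv x).
Definition be w e : edge B := eact b w (bs_ebase G triv e).

Lemma bv_eq w w' x : bv w x = bv w' x <-> vsub x (w^-1 * w')%g.
Proof.
split=> [/(congr1 sval)[] /(lcos_eq (vsub_subgroup x))//|h].
by apply: eq_exist; congr pair; apply/(lcos_eq (vsub_subgroup x)).
Qed.

Lemma be_eq w w' e : be w e = be w' e <-> esub e (w^-1 * w')%g.
Proof.
split=> [/(congr1 sval)[] /(lcos_eq (esub_subgroup e))//|h].
by apply: eq_exist; congr pair; apply/(lcos_eq (esub_subgroup e)).
Qed.

Lemma bvP (v : vert B) : exists w, v = bv w (sval v).1.
Proof. by case: v => [[x C] [w /= wC]]; exists w; apply: eq_exist; rewrite /= -wC. Qed.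
Lemma beP (E : edge B) : exists w, E = be w (sval E).1.
Proof. by case: E => [[e C] [w /= wC]]; exists w; apply: eq_exist; rewrite /= -wC. Qed.

Lemma bv_act h w x : vact b h (bv w x) = bv (h * w)%g x.
Proof. by rewrite /bv vactM. Qed.
Lemma be_act h w e : eact b h (be w e) = be (h * w)%g e.
Proof. by rewrite /be eactM. Qed.

Lemma orig_be w e : orig (be w e) = bv (w * pe e)%g (orig e).
Proof. by apply: eq_exist; congr pair; exact: bs_orig_cosetE. Qed.

Lemma erev_be w e : erev (be w e) = be w (erev e).
Proof. by apply: eq_exist; rewrite /= pi1_esub_rev. Qed.

Definition Pv (v : vert B) : vert Z := vact a (Phi (sval (cid (bvP v)))) (vrep (sval v).1).
Definition Pe (E : edge B) : edge Z := eact a (Phi (sval (cid (beP E)))) (erep (sval E).1).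

Lemma PvE w x : Pv (bv w x) = vact a (Phi w) (vrep x).
Proof.
rewrite /Pv; case: (cid _) => w' /= /bv_eq/Phi_vsub; rewrite gmulfM homV vactM => h.
by rewrite -[in RHS]h vactVK.
Qed.

Lemma PeE w e : Pe (be w e) = eact a (Phi w) (erep e).
Proof.
rewrite /Pe; case: (cid _) => w' /= /be_eq/Phi_esub; rewrite gmulfM homV eactM => h.
by rewrite -[in RHS]h eactVK.
Qed.

Lemma orig_Pe E : orig (Pe E) = Pv (orig E).
Proof.
have [w ->] := beP E; move: (sval E).1 => e.
by rewrite PeE orig_be PvE eact_orig gmulfM vactM Phi_edge g_orig.
Qed.

Lemma erev_Pe E : erev (Pe E) = Pe (erev E).
Proof.
have [w ->] := beP E; move: (sval E).1 => e.
by rewrite erev_be !PeE eact_rev erep_rev.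
Qed.

(** Two edges of the Bass-Serre graph with the same origin differ by an element
    of a conjugated vertex group, on which [Phi] is injective. *)
Lemma Pe_local_inj E E' : orig E = orig E' -> Pe E = Pe E' -> E = E'.
Proof.
have [w ->] := beP E; have [w' ->] := beP E'.
move: (sval E).1 (sval E').1 => e e' oE PE.
have ee : e = e'.
  by move: PE; rewrite !PeE => /(congr1 (eproj a)); rewrite !eproj_act !erepK.
rewrite -{e'}ee in oE PE *; apply/be_eq.
move: oE; rewrite !orig_be => /bv_eq[s [xs wE]].
have ww : (w^-1 * w')%g = (pe e * pi1_vgrp triv xs * (pe e)^-1)%g.
  by rewrite -wE invgM !mulgA mulgV mul1g -!mulgA mulgV mulg1.
have : eact a (Phi (w^-1 * w')%g) (erep e) = erep e.
  by move: PE; rewrite !PeE gmulfM homV eactM => <-; rewrite eactK.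
rewrite ww !gmulfM homV Phi_edge Phi_vgrp => st.
have es : egrp G e (g e * s * (g e)^-1)%g by rewrite egrpE.
exists _, es; congr (_ * _ * _)%g; apply: pi1_vgrp_eq.
by rewrite gembE // !mulgA mulVg mul1g -mulgA mulVg mulg1.
Qed.

Lemma Pe_walk u p v : walk (full_subgraph B) u p v ->
  walk (full_subgraph Z) (Pv u) (map Pe p) (Pv v).
Proof.
elim: p u => [|E p IHp] u; first by move=> [_ ->].
by move=> [_ <- /IHp Epv]; split; rewrite ?orig_Pe // erev_Pe orig_Pe.
Qed.

Lemma Pe_reduced u p v : reduced p -> walk (full_subgraph B) u p v -> reduced (map Pe p).
Proof.
move=> red puv p1 f p2; elim: p u red puv p1 => [|E p IHp] u red /= puv [|f1 p1] //=.
  case: p red puv {IHp} => [|F p] // red [_ _ [_ FE _]] [<- Pf _].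
  have EF : erev E = F.
    by apply: Pe_local_inj; rewrite ?FE // -erev_Pe Pf.
  by apply: (red [::] E p); rewrite EF.
move=> [_ pE]; case: puv => _ _ puv; apply: IHp puv _ pE.
by move=> q1 F q2 qE; apply: (red (E :: q1) F q2); rewrite qE.
Qed.

(** ** Connectedness of the Bass-Serre graph *)

Definition conn (u v : vert B) : Prop := exists p, walk (full_subgraph B) u p v.

Lemma conn_refl u : conn u u. Proof. by exists [::]. Qed.
Lemma conn_trans u v w : conn u v -> conn v w -> conn u w.
Proof. by move=> [p up] [q vq]; exists (p ++ q); apply/walk_cat; exists v. Qed.
Lemma conn_sym u v : conn u v -> conn v u.
Proof. by move=> [p /walk_sym]. Qed.
Lemma conn_edge E : conn (orig E) (orig (erev E)).
Proof. by exists [:: E]. Qed.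
Lemma conn_act h u v : conn u v -> conn (vact b h u) (vact b h v).
Proof.
move=> [p]; elim: p u => [|E p IHp] u; first by move=> [_ ->]; exact: conn_refl.
move=> [_ <- /IHp]; apply: conn_trans; rewrite -!eact_orig -eact_rev; exact: conn_edge.
Qed.

Lemma conn_be w e : conn (bv (w * pe e)%g (orig e)) (bv (w * pe (erev e))%g (orig (erev e))).
Proof. by rewrite -!orig_be -erev_be; exact: conn_edge. Qed.

Lemma conn_base x y : conn (bv 1%g x) (bv 1%g y).
Proof.
have walkT0 u p v : walk T0 u p v -> conn (bv 1%g (vproj a u)) (bv 1%g (vproj a v)).
  elim: p u => [|f p IHp] u; first by move=> [_ ->]; exact: conn_refl.
  move=> [Tf <- /IHp]; apply: conn_trans.
  have t1 : triv (eproj a f) by rewrite /= erep_T0 //; exact: se_orig.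
  have t2 : triv (erev (eproj a f : edge Y)).
    by rewrite erev_eproj /= erep_T0; [apply: se_orig|]; exact: se_rev.
  have := conn_be 1%g (eproj a f); rewrite !pe_triv // mulg1.
  by rewrite orig_eproj erev_eproj orig_eproj.
have [_ Tconn _] := T0_tree.
by have [p /walkT0] := Tconn _ _ (vrep_T0 x) (vrep_T0 y); rewrite !vrepK.
Qed.

Lemma conn_bv w x y : conn (bv w x) (bv w y).
Proof. by have := conn_act w (conn_base x y); rewrite !bv_act mulg1. Qed.

(** It suffices to move the base vertex by generators. Elements of a vertex group
    fix some base vertex, and the edge [e] joins translates of base vertices by
    [pe e] and [pe (erev e)], one of which is trivial. *)
Lemma conn_act_base w x : conn (bv 1%g x) (bv w x).
Proof.
have comp w1 w2 : conn (bv 1%g x) (bv w1 x) -> conn (bv 1%g x) (bv w2 x) ->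
    conn (bv 1%g x) (bv (w1 * w2)%g x).
  move=> c1 c2; apply: conn_trans c1 _.
  by have := conn_act w1 c2; rewrite !bv_act mulg1.
have gen z : conn (bv 1%g x) (bv (pgen (pi1_rel triv) z) x).
  case: z => [[[y s] /= ys]|e].
    apply: conn_trans (conn_bv _ y x); apply: conn_trans (conn_bv _ x y) _.
    suff -> : bv 1%g y = bv (pi1_vgrp triv ys) y by exact: conn_refl.
    by apply/bv_eq; rewrite invg1 mul1g; exists s, ys.
  rewrite -/(pe e); case: (triv_or e) => te; first by rewrite pe_triv //; exact: conn_refl.
  have := conn_be 1%g e; rewrite (pe_triv te) !mul1g => /conn_sym c.
  apply: conn_trans (conn_bv _ x (orig (erev e))) _.
  exact: conn_trans c (conn_bv _ (orig e) x).
elim/presW: w; elim=> [|[z c] u IHu]; first exact: conn_refl.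
rewrite -cat1s pcls_cat; apply: comp => //.
case: c; last exact: gen.
rewrite (pcls_winv _ [:: (z, false)]).
have := conn_act (pgen (pi1_rel triv) z)^-1%g (gen z).
by rewrite !bv_act mulg1 mulVg => /conn_sym.
Qed.

(** A reduced walk in the Bass-Serre graph from the base vertex to its translate by
    a kernel element has a closed reduced image in the tree, so it is empty; and
    [Phi] is injective on the stabiliser of the base vertex. *)
Lemma Phi_ker w : Phi w = 1%g -> w = 1%g.
Proof.
move=> w1; have [[v0 _] _ _] := T0_tree; pose x := vproj a v0.
have [p /walk_reduce[q red q_walk]] := conn_act_base w x.
have [_ _ circ] := Z_tree.
have := Pe_walk q_walk; rewrite !PvE w1 hom1 => qz.
have q0 : q = [::] by have := circ _ _ (Pe_reduced red q_walk) qz; case: (q).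
move: q_walk; rewrite q0 => -[_ /bv_eq]; rewrite invg1 mul1g => -[s [xs wE]].
rewrite wE; move: w1; rewrite wE Phi_vgrp => s1.
have [x1 _ _] := vgrp_subgroup G x.
by rewrite -(pi1_vgrp1 triv x1); exact: pi1_vgrp_eq.
Qed.

Lemma Phi_inj w w' : Phi w = Phi w' -> w = w'.
Proof.
move=> ww; apply: (@mulgI _ w^-1%g); rewrite mulVg; apply/esym/Phi_ker.
by rewrite gmulfM homV ww mulVg.
Qed.

(** The translates of the representatives under the image of [Phi] contain the
    neighbours of their members: an edge leaving [Phi w] applied to a
    representative is the translate of an edge representative, by an element that
    is determined up to a vertex group. *)
Lemma Pv_surj v : exists w x, v = vact a (Phi w) (vrep x).
Proof.
have [[v0 _] _ _] := T0_tree; pose u := vrep (vproj a v0).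
have [_ Zconn _] := Z_tree; have [p] := Zconn u v I I.
have : exists w x, u = vact a (Phi w) (vrep x) by exists 1%g, (vproj a v0); rewrite hom1 vact1.
elim: p u => [|f p IHp] u; first by move=> h [_ <-].
move=> [w [x uE]] [_ fu]; apply: IHp.
have [h fE] : exists h, eact a h (erep (eproj a f)) = f by apply: eproj_eq; rewrite erepK.
set e : edge Y := eproj a f in fE.
have ox : orig e = x.
  by rewrite -[x]vrepK -(vproj_act a (Phi w)) -uE -fu -fE eact_orig vproj_act -orig_eproj erepK.
have stab : vgrp G x ((Phi w)^-1 * h * g e)%g.
  rewrite vgrpE /= !vactM -{1}ox g_orig -eact_orig fE fu uE vactK //.
exists (w * pi1_vgrp triv stab * (pe e)^-1 * pe (erev e))%g, (orig (erev e)).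
rewrite !gmulfM homV !Phi_edge Phi_vgrp vactM g_orig erep_rev.
by rewrite !mulgA mulgV mul1g -mulgA mulgV mulg1 -eact_orig -eact_rev fE.
Qed.

Lemma Phi_surj h : exists w, Phi w = h.
Proof.
have [[v0 _] _ _] := T0_tree; pose x := vproj a v0.
have [w [y E]] := Pv_surj (vact a h (vrep x)).
have xy : x = y by rewrite -[x]vrepK -[y]vrepK -(vproj_act a h) E vproj_act.
rewrite -{y}xy in E.
have stab : vgrp G x ((Phi w)^-1 * h)%g by rewrite vgrpE /= vactM E vactK.
by exists (w * pi1_vgrp triv stab)%g; rewrite gmulfM Phi_vgrp mulgA mulgV mul1g.
Qed.

Lemma Phi_bij : bijective Phi.
Proof. exact: (inj_surj_bij Phi_inj Phi_surj). Qed.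

Lemma Pv_bij : bijective Pv.
Proof.
apply: inj_surj_bij => [v v'|v].
  have [w ->] := bvP v; have [w' ->] := bvP v'.
  move: (sval v).1 (sval v').1 => x x'; rewrite !PvE => E.
  have xx : x = x' by rewrite -[x]vrepK -[x']vrepK -(vproj_act a (Phi w)) E vproj_act.
  rewrite -{x'}xx in E *; apply/bv_eq.
  have stab : vgrp G x (Phi (w^-1 * w')%g) by rewrite vgrpE /= gmulfM homV vactM -E vactK.
  by exists _, stab; apply: Phi_inj; rewrite Phi_vgrp.
by have [w [x ->]] := Pv_surj v; exists (bv w x); rewrite PvE.
Qed.

Lemma Pe_bij : bijective Pe.
Proof.
apply: inj_surj_bij => [E E'|f].
  have [w ->] := beP E; have [w' ->] := beP E'.
  move: (sval E).1 (sval E').1 => e e'; rewrite !PeE => EE.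
  have ee : e = e' by rewrite -[e]erepK -[e']erepK -(eproj_act a (Phi w)) EE eproj_act.
  rewrite -{e'}ee in EE *; apply/be_eq.
  have es : egrp G e (Phi (w^-1 * w')%g) by rewrite egrpE /= gmulfM homV eactM -EE eactK.
  exists _, es; apply: Phi_inj; rewrite [in RHS]gmulfM [in RHS]gmulfM homV Phi_edge Phi_vgrp.
  by rewrite gembE // !mulgA mulgV mul1g -!mulgA mulgV mulg1.
have [h <-] : exists h, eact a h (erep (eproj a f)) = f by apply: eproj_eq; rewrite erepK.
by have [w <-] := Phi_surj h; exists (be w (eproj a f)); rewrite PeE.
Qed.

End Iso.

Theorem bass_serre : is_bass_serre_tree G triv g a vrep erep.
Proof.
have [Phi Phi_gen] := pres_hom_ex gen_val_rel.
exists Phi; split.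
- exact: Phi_bij Phi_gen.
- by move=> x s xs; exact: Phi_vgrp.
- by move=> e; exact: Phi_edge.
exists (Pv Phi), (Pe Phi); split.
- by split; [exact: Pv_bij Phi_gen|exact: Pe_bij Phi_gen].
- by move=> E; split; [exact: orig_Pe|exact: erev_Pe].
- by move=> w v; have [u ->] := bvP v; rewrite bv_act !PvE // gmulfM vactM.
- by move=> w E; have [u ->] := beP E; rewrite be_act !PeE // gmulfM eactM.
split=> [x|e].
  have -> : bs_vbase G triv x = bv 1%g x by rewrite /bv vact1.
  by rewrite PvE // hom1 vact1.
have -> : bs_ebase G triv e = be 1%g e by rewrite /be eact1.
by rewrite PeE // hom1 eact1.
Qed.

End BassSerre.

(** * The scaling automorphisms as a cocycle *)

Section Cocycle.
Variables (L0 : oagType) (Gamma : groupType).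
Variable beta : {multiplicative Gamma -> oaut (zlex L0)}.
Variables (theta : Gamma -> oaut L0) (mu : Gamma -> L0).
Hypothesis betaE : forall (g : Gamma) (l : L0),
  beta g (zpair 1 l) = zpair 1 (theta g l + mu g).

Lemma beta_zpair0 g l : beta g (zpair 0 l) = zpair 0 (theta g l).
Proof.
have -> : zpair 0 l = zpair 1 l - zpair 1 0 by apply: zlex_eqP; rewrite /= ?subr0.
rewrite oautD oautN !betaE oaut0 add0r.
by apply: zlex_eqP; rewrite /= ?subrr // addrK.
Qed.

Lemma thetaM g h : theta (g * h)%g = (theta g * theta h)%g.
Proof.
apply: oautP => l; have := beta_zpair0 (g * h)%g l.
by rewrite gmulfM /= !beta_zpair0 => -[].
Qed.

Lemma muM g h : mu (g * h)%g = mu g + theta g (mu h).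
Proof.
have := betaE (g * h)%g 0.
by rewrite gmulfM /= !betaE !oaut0 !add0r => -[]; rewrite addrC.
Qed.

Lemma theta1 : theta 1%g = 1%g.
Proof. by apply: (@mulgI _ (theta 1%g)); rewrite -thetaM !mulg1. Qed.

Lemma mu1 : mu 1%g = 0.
Proof. by apply: (@addrI _ (mu 1%g)); rewrite -{2}[mu 1%g]/((1%g : oaut L0) (mu 1%g)) -theta1 -muM mulg1 addr0. Qed.

Lemma thetaV g : theta g^-1%g = (theta g)^-1%g.
Proof. by apply: (@mulgI _ (theta g)); rewrite -thetaM !mulgV theta1. Qed.
End Cocycle.

(** * Properties of a signature *)

Lemma end_image_eq (X : Type) (f f' : X -> X) (A : set X) (eps : set (X * set X)) :
  (forall x B, eps (x, B) -> A x /\ B `<=` A) -> (forall x, A x -> f x = f' x) ->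
  end_image f eps = end_image f' eps.
Proof.
have sub (k k' : X -> X) : (forall x B, eps (x, B) -> A x /\ B `<=` A) ->
    (forall x, A x -> k x = k' x) -> end_image k eps `<=` end_image k' eps.
  move=> epsA kk _ [[x B] exB <-]; have [Ax BA] := epsA _ _ exB.
  exists (x, B) => //=; rewrite kk //; congr pair.
  by apply/seteqP; split=> _ [b Bb <-]; exists b => //; rewrite kk //; exact: BA.
by move=> epsA ff; apply/seteqP; split; apply: sub => // x Ax; rewrite ff.
Qed.

Section Signature.
Variables (L0 : oagType) (Gamma : groupType).
Variable beta : {multiplicative Gamma -> oaut (zlex L0)}.
Variables (theta : Gamma -> oaut L0) (mu : Gamma -> L0).
Hypothesis betaE : forall (g : Gamma) (l : L0),
  beta g (zpair 1 l) = zpair 1 (theta g l + mu g).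
Hypothesis L0_neq0 : exists l : L0, l <> 0.
Variables (X : ltree (zlex L0)) (a : affine_action beta X).
Hypothesis a_wi : without_inversions (xs_action a).
Local Notation Xs := (xs_graph X).
Local Notation act := (xs_action a).
Local Notation Ys := (quotient_graph a_wi).
Variable D : sig_data a_wi.
Hypothesis S : is_signature theta mu D.
Local Notation G := (sG D).
Local Notation alpha := (gemb G).
Implicit Types (e f : edge Ys) (s t : Gamma).

Lemma sgn_T0_inj u v : sv (sT0 D) u -> sv (sT0 D) v -> vproj act u = vproj act v -> u = v.
Proof. by have [_ [_ inj _] _] := sgn_T0 S => Tu Tv; apply: inj; exact/mem_set. Qed.

Lemma sgn_S_inj (e f : edge Xs) : se (sS D) e -> se (sS D) f -> eproj act e = eproj act f -> e = f.
Proof. by have [_ _ [_ inj _] _] := sgn_S S => Te Tf; apply: inj; exact/mem_set. Qed.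

Lemma sgn_erep_rev e : erep D (erev e) = erev (erep D e).
Proof.
have [Se eE] := sgn_erep S e; have [Se' eE'] := sgn_erep S (erev e).
apply: sgn_S_inj => //; first exact: se_rev.
by rewrite eE' -[in LHS]eE; exact: erev_eproj.
Qed.

Lemma sgn_erep_T0 (f : edge Xs) : se (sT0 D) f -> erep D (eproj act f) = f.
Proof.
move=> Tf; have [Se eE] := sgn_erep S (eproj act f).
by have [_ [_ sub] _ _] := sgn_S S; apply: sgn_S_inj => //; exact: sub.
Qed.

Lemma sgn_vrep_orig e : vact act (sg D e)^-1%g (orig (erep D e)) = vrep D (orig e).
Proof.
have [Tv vE] := sgn_vrep S (orig e); apply: sgn_T0_inj => //; first exact: (sgn_g S e).
rewrite vproj_act vE; have [_ eE] := sgn_erep S e.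
by rewrite -[in RHS]eE; apply/esym/(orig_eproj a_wi).
Qed.

Lemma sgn_g_orig e : vact act (sg D e) (vrep D (orig e)) = orig (erep D e).
Proof. by rewrite -sgn_vrep_orig vactVK. Qed.

Lemma sgn_graph_of_groups : sig_graph_of_groups D.
Proof.
split; [exact: (sgn_T S)|exact: (sgn_T0 S)|exact: (sgn_S S)| |].
  split; first exact: xs_is_tree.
  apply: (bass_serre (T0 := sT0 D)).
  - exact: xs_is_tree.
  - by have [] := sgn_T0 S.
  - by move=> x; have [] := sgn_vrep S x.
  - by move=> x; have [] := sgn_vrep S x.
  - by move=> e; have [] := sgn_erep S e.
  - exact: sgn_erep_rev.
  - exact: sgn_erep_T0.
  - exact: sgn_g_orig.
  - exact: (sgn_g1 S).
  - move=> e; rewrite /= sgn_erep_rev.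
    by have [_ _ _ ends] := sgn_S S; apply: ends; have [] := sgn_erep S e.
  - exact: (sgn_vgrp S).
  - exact: (sgn_egrp S).
  exact: (sgn_gemb S).
by move=> e; split; [exact: (sgn_g S e)|rewrite sgn_vrep_orig].
Qed.

Lemma sgn_homs : sig_homs D.
Proof.
move=> x s t xs xt; have [_ HM _] := vgrp_subgroup G x.
by rewrite !(sgn_theta_v S) ?(thetaM betaE) //; exact: HM.
Qed.

Lemma sgn_distE x p q : sval (vrep D x) p -> sval (vrep D x) q ->
  dist p q = zpair 0 (sdist D x p q).
Proof. by rewrite -(sgn_X S) => xp xq; rewrite (sgn_dist S xp xq). Qed.

Lemma sgn_trees : sig_trees D.
Proof.
move=> x; rewrite (sgn_X S); apply: median_tree_ltree.
by apply: fibre_median_tree => p q; exact: sgn_distE.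
Qed.

Lemma sgn_act_in x s p : vgrp G x s -> sX D x p -> sX D x (a s p).
Proof.
rewrite (sgn_vgrp S) (sgn_X S) => sx xp.
by rewrite -[vrep D x](sx : vact act s _ = _); exists p.
Qed.

Lemma sgn_actions : sig_actions D.
Proof.
move=> x; have [H1 HM _] := vgrp_subgroup G x; split.
- by move=> s p xs xp; rewrite (sgn_act S) //; exact: sgn_act_in.
- by move=> p xp; rewrite (sgn_act S) // aact1.
- move=> s t p xs xt xp; rewrite !(sgn_act S) ?aactM //; first exact: sgn_act_in.
  exact: HM.
move=> s p q xs xp xq; rewrite !(sgn_act S) // (sgn_theta_v S) //.
have := aact_affine a s p q; rewrite (sgn_dist S xp xq) (beta_zpair0 betaE).
by rewrite (sgn_dist S (sgn_act_in xs xp) (sgn_act_in xs xq)) => -[].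
Qed.

(** ** Ends *)

Definition local_edge e : edge Xs := eact act (sg D e)^-1%g (erep D e).

Lemma orig_local_edge e : orig (local_edge e) = vrep D (orig e).
Proof. by rewrite -sgn_vrep_orig eact_orig. Qed.

Lemma sgn_epsE e : seps D e = edge_end (local_edge e).
Proof. by have [eps /(is_edge_endP L0_neq0) -> ->] := sgn_eps S e; exact: edge_end_act. Qed.

Lemma sgn_eps_bus e :
  median_tree (sX D (orig e)) (sdist D (orig e)) /\
  exists2 h, busemann (sX D (orig e)) (sdist D (orig e)) h
           & seps D e = bus_end (sX D (orig e)) (sdist D (orig e)) h.
Proof.
rewrite (sgn_X S) sgn_epsE -orig_local_edge.
have dE p q : sval (orig (local_edge e)) p -> sval (orig (local_edge e)) q ->
    dist p q = zpair 0 (sdist D (orig e) p q).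
  by rewrite orig_local_edge; exact: sgn_distE.
split; first exact: fibre_median_tree dE.
exists (height (local_edge e)); first exact: height_busemann dE.
exact: edge_endE.
Qed.

Lemma sgn_ends : sig_ends D.
Proof.
move=> e; split; last by move=> x y; exact: (sgn_delta S).
by have [T [h H ->]] := sgn_eps_bus e; exact: bus_is_end.
Qed.

Lemma sgn_eps_act x e s : orig e = x -> vgrp G x s ->
  end_image (sact D x s) (seps D e) = edge_end (eact act s (local_edge e)).
Proof.
move=> ex xs; rewrite sgn_epsE -edge_end_act.
apply: (@end_image_eq _ _ _ (sX D x)) => [p B [xp BE]|p xp]; last exact: (sgn_act S).
rewrite (BE : B = _); rewrite orig_local_edge -(sgn_X S) ex in xp *.
by split=> // q [].
Qed.

Lemma local_edge_fix e s :
  eact act s (local_edge e) = local_edge e <-> egrp G e (sg D e * s * (sg D e)^-1)%g.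
Proof.
have -> : egrp G e (sg D e * s * (sg D e)^-1)%g =
    (eact act (sg D e * s * (sg D e)^-1)%g (erep D e) = erep D e).
  by rewrite (sgn_egrp S).
rewrite !eactM -/(local_edge e); split=> [->|h]; first exact: eactVK.
by apply: (can_inj (eactK act (sg D e))); rewrite h eactVK.
Qed.

(** The edges that issue from a vertex are distinguished by their ends, so an
    element fixes the end iff it fixes the edge. *)
Lemma sgn_end_stabilisers : sig_end_stabilisers D.
Proof.
move=> e; split.
  by have [T [h H ->]] := sgn_eps_bus e; exact: bus_full_type.
apply/seteqP; split=> s /=.
  move=> [xs]; rewrite (sgn_eps_act (erefl _) xs) sgn_epsE => /(edge_end_inj L0_neq0) fixs.
  have es : egrp G e (sg D e * s * (sg D e)^-1)%g.
    apply/local_edge_fix/fixs; rewrite eact_orig orig_local_edge.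
    by move: xs; rewrite (sgn_vgrp S).
  exists (sg D e * s * (sg D e)^-1)%g => //.
  by rewrite (sgn_gemb S) // !mulgA mulVg mul1g -mulgA mulVg mulg1.
move=> [t et <-]; have xs := gemb_in et; split=> //.
rewrite (sgn_eps_act (erefl _) xs) sgn_epsE; congr edge_end.
apply/local_edge_fix; rewrite (sgn_gemb S) //.
by rewrite !mulgA mulgV mul1g -mulgA mulgV mulg1.
Qed.

Lemma sgn_end_orbits : sig_end_orbits D.
Proof.
move=> e f ef [s xs]; rewrite (sgn_eps_act (esym ef) xs) sgn_epsE.
move=> /(edge_end_inj L0_neq0) E.
have /(congr1 (eproj act)) : eact act s (local_edge f) = local_edge e.
  apply: E; rewrite eact_orig !orig_local_edge -ef.
  by move: xs; rewrite (sgn_vgrp S).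
rewrite /local_edge !eproj_act.
by have [_ ->] := sgn_erep S e; have [_ ->] := sgn_erep S f.
Qed.

(** ** Equations *)

Lemma sgn_conj e s : egrp G e s -> (sg D e * alpha e s = s * sg D e)%g.
Proof. by move=> es; rewrite (sgn_gemb S) // !mulgA mulgV mul1g. Qed.

Lemma sgn_theta_alpha e s : egrp G e s ->
  theta_v D (orig e) (alpha e s) = theta (alpha e s).
Proof. by move=> es; apply: (sgn_theta_v S); exact: gemb_in. Qed.

Lemma sgn_mu_alpha e s : egrp G e s -> mu_v D (orig e) (alpha e s) = mu (alpha e s).
Proof. by move=> es; apply: (sgn_mu_v S); exact: gemb_in. Qed.

Lemma sgn_theta_conj e s : egrp G e s ->
  (theta_e D e * theta_v D (orig e) (alpha e s) * (theta_e D e)^-1)%g = theta s.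
Proof.
move=> es; rewrite (sgn_theta_e S) sgn_theta_alpha // -(thetaM betaE) sgn_conj //.
by rewrite (thetaM betaE) -mulgA mulgV mulg1.
Qed.

Lemma sgn_theta : sig_theta D.
Proof.
split=> [e s es|e g1]; last by rewrite (sgn_theta_e S) g1 (theta1 betaE).
by rewrite !sgn_theta_conj // egrp_rev.
Qed.

(** The generator of [eabs D e] is trivial, so its embedding is the inclusion. *)
Lemma sgn_mu_abs e s : egrp G e s -> mu_v D (orig (eabs D e)) (alpha (eabs D e) s) = mu s.
Proof.
move=> es; have es' : egrp G (eabs D e) s.
  by case: (sgn_eabs_or S e) => ->; rewrite ?egrp_rev.
rewrite sgn_mu_alpha // (sgn_gemb S) // (sgn_g1 S) ?invg1 ?mul1g ?mulg1 //.
exact: (sgn_eabs S e).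
Qed.

Lemma sgn_mu : sig_mu D.
Proof.
split=> [e s es|x s t xs xt|e g1].
- rewrite sgn_theta_conj // sgn_mu_abs // (sgn_mu_e S) (sgn_theta_e S) sgn_mu_alpha //.
  by rewrite -(muM betaE) sgn_conj // (muM betaE) addrK.
- have [_ HM _] := vgrp_subgroup G x.
  by rewrite !(sgn_mu_v S) ?(sgn_theta_v S) ?(muM betaE) //; exact: HM.
by rewrite (sgn_mu_e S) g1 (mu1 betaE).
Qed.

Lemma sgn_fibre_act e p : sX D (orig e) p -> sval (orig (erep D e)) (a (sg D e) p).
Proof.
rewrite (sgn_X S) -sgn_g_orig => xp; by exists p.
Qed.

(** Move the two points into the fibres over the ends of [erep D e]. The distance
    between their images under [s] is given by the end maps, and also by the
    affine action of [s] on their distance; compare second coordinates. *)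
Lemma sgn_deltas : sig_delta D.
Proof.
move=> e s x y es ex ey; have es' : egrp G (erev e) s by rewrite egrp_rev.
have [xs ys] := (gemb_in es, gemb_in es').
rewrite sgn_mu_abs // !(sgn_act S) // !sgn_theta_alpha //.
have dE p q : sX D (orig e) p -> sX D (orig (erev e)) q ->
    dist (a (sg D e) p) (a (sg D (erev e)) q) =
    zpair 1 (- theta_e D e (sdelta D e p) - theta_e D (erev e) (sdelta D (erev e) q)).
  move=> ep eq; have := sgn_delta_dist S (sgn_fibre_act ep).
  move=> /(_ (a (sg D (erev e)) q)); rewrite -sgn_erep_rev => /(_ (sgn_fibre_act eq)).
  by rewrite !aactK.
have := aact_affine a s (a (sg D e) x) (a (sg D (erev e)) y).
rewrite -!aactM -!sgn_conj // !aactM dE //; last first.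
- exact: sgn_act_in.
- exact: sgn_act_in.
rewrite dE // betaE => -[].
have thE f (t : L0) : egrp G f s -> theta s (theta_e D f t) =
    theta_e D f (theta (alpha f s) t).
  move=> fs; rewrite (sgn_theta_e S).
  by have := congr1 (fun h : oaut L0 => h t) (thetaM betaE (sg D f) (alpha f s));
     rewrite sgn_conj // (thetaM betaE).
rewrite !oautD !oautN !thE //.
move: (theta_e D e _) (theta_e D e _) (theta_e D (erev e) _) (theta_e D (erev e) _).
move=> u v w z; oag_lia L0.
Qed.
End Signature.

(** * Trees of representatives *)

Section Subtrees.
Variable Z : graph.
Implicit Types (T : subgraph Z) (u v w : vert Z) (e f : edge Z) (V : set (vert Z)).

Lemma walk_sub T T' u p v : sub_subgraph T T' -> walk T u p v -> walk T' u p v.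
Proof.
move=> [sv_sub se_sub]; elim: p u => [|e p IHp] u; first by move=> [? ?]; split=> //; exact: sv_sub.
by move=> [Te eu /IHp]; split=> //; exact: se_sub.
Qed.

Lemma sub_full T : sub_subgraph T (full_subgraph Z). Proof. by []. Qed.

Fact induced_orig V e : V (orig e) /\ V (orig (erev e)) -> V (orig e).
Proof. by case. Qed.
Fact induced_rev V e : V (orig e) /\ V (orig (erev e)) ->
  V (orig (erev e)) /\ V (orig (erev (erev e))).
Proof. by rewrite erevK => -[]. Qed.
Definition induced V : subgraph Z :=
  @Subgraph Z V [set e | V (orig e) /\ V (orig (erev e))]
    (@induced_orig V) (@induced_rev V).

Lemma induced_sub V W : V `<=` W -> sub_subgraph (induced V) (induced W).
Proof. by move=> VW; split=> // e [? ?]; split; exact: VW. Qed.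

(** The choice depends on the set only, so that it is the same for an edge and its
    reverse when the set is symmetric. *)
Definition pick (T : Type) (P : set T) (P0 : exists x, P x) : T := sval (cid P0).

Lemma pickP (T : Type) (P : set T) (P0 : exists x, P x) : P (pick P0).
Proof. exact: (svalP (cid P0)). Qed.

Lemma pick_eq (T : Type) (P Q : set T) P0 Q0 : P = Q -> @pick T P P0 = @pick T Q Q0.
Proof. by move=> PQ; case: _ / PQ Q0 => Q0; rewrite (Prop_irrelevance P0 Q0). Qed.

Hypothesis Z_tree : is_tree Z.

Lemma tree_edge_eq e f : orig e = orig f -> orig (erev e) = orig (erev f) -> e = f.
Proof.
move=> ef ef'; have [_ _ circ] := Z_tree; apply: contrapT => nef.
have red : reduced [:: e; erev f].
  move=> [|g p1] h p2 E; last by have := congr1 size E; rewrite /= size_cat /=; lia.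
  by case: E => <- fh _; apply: nef; rewrite -[f]erevK fh erevK.
have closed : walk (full_subgraph Z) (orig e) [:: e; erev f] (orig e).
  by rewrite /= erevK -ef'.
by have := circ _ _ red closed.
Qed.

Lemma subtreeI T : sv T !=set0 ->
  (forall u v, sv T u -> sv T v -> exists p, walk T u p v) -> is_subtree T.
Proof.
move=> T0 Tconn; split=> // u p red up; have [_ _ circ] := Z_tree.
exact: circ red (walk_sub (sub_full T) up).
Qed.

End Subtrees.

Section Representatives.
Variables (Gamma : groupType) (Z : graph) (a : gaction Gamma Z).
Hypothesis a_wi : without_inversions a.
Hypothesis Z_tree : is_tree Z.
Local Notation Y := (quotient_graph a_wi).
Implicit Types (V : set (vert Z)).

(** The vertex sets of subtrees that embed into the quotient. *)
Definition partial_reps V : Prop :=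
  (forall u v, V u -> V v -> vproj a u = vproj a v -> u = v) /\
  (forall u v, V u -> V v -> exists p, walk (induced V) u p v).

Lemma partial_reps_add V e : partial_reps V -> V (orig e) ->
  (forall u, V u -> vproj a u <> vproj a (orig (erev e))) ->
  partial_reps (V `|` [set orig (erev e)]).
Proof.
move=> [inj con] Ve new; set w := orig (erev e) in new *; set W := _ `|` _.
have VW : V `<=` W by left.
have We : se (induced W) e by split; [left|right].
have toW u : V u -> exists p, walk (induced W) u p w.
  move=> Vu; have [p up] := con _ _ Vu Ve; exists (p ++ [:: e]); apply/walk_cat.
  by exists (orig e); [exact: walk_sub (induced_sub VW) up|split=> //; split=> //; right].
split=> u v.
  move=> [Vu|->] [Vv|->] //; first exact: inj.
    by move=> /new.
  by move=> /esym /new.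
move=> [Vu|->] [Vv|->].
- by have [p up] := con _ _ Vu Vv; exists p; exact: walk_sub (induced_sub VW) up.
- exact: toW.
- by have [p /walk_sym] := toW _ Vv.
by exists [::]; split=> //; right.
Qed.

(** If a maximal such set missed an orbit, then a walk towards that orbit would
    cross an edge leaving the translates of the set; a translate of this edge could
    be added. *)
Lemma vertex_reps_ex : exists V, [/\ partial_reps V, V !=set0 &
  forall v, exists2 u, V u & vproj a u = vproj a v].
Proof.
have [F Fsub Ftot|V [[inj con] maxV]] := @Zorn_bigcup _ [set V | partial_reps V].
  have dir u v : (\bigcup_(W in F) W) u -> (\bigcup_(W in F) W) v ->
      exists W, [/\ F W, W u & W v].
    move=> [W1 F1 W1u] [W2 F2 W2v]; case: (Ftot _ _ F1 F2) => h.
      by exists W2; split=> //; exact: h.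
    by exists W1; split=> //; exact: h.
  split=> u v Fu Fv; have [W [FW Wu Wv]] := dir _ _ Fu Fv; have [inj con] := Fsub _ FW.
    exact: inj.
  have [p up] := con _ _ Wu Wv; exists p.
  by apply: walk_sub up; apply: induced_sub => z Wz; exists W.
have [[v0 _] Zconn _] := Z_tree.
have [u0 V0] : V !=set0.
  apply: contrapT => V0; apply: (maxV [set v0]).
    by split=> [v Vv|/(_ v0 (erefl _)) Vv]; case: V0; [exists v|exists v0].
  split=> u v -> -> //; by exists [::].
exists V; split=> //; first by exists u0.
move=> v; have [p] := Zconn u0 v I I.
have : exists2 u, V u & vproj a u = vproj a u0 by exists u0.
elim: p (u0) => [|e p IHp] u; first by move=> h [_ <-].
move=> [u' Vu' uu'] [_ eu]; apply: IHp; apply: contrapT => new.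
have [h hu] := vproj_eq (esym uu').
apply: (maxV (V `|` [set orig (erev (eact a h e))])); last first.
  apply: partial_reps_add => //; first by rewrite eact_orig eu hu.
  move=> z Vz; rewrite eact_rev eact_orig vproj_act => zE.
  by apply: new; exists z.
split=> [z|/(_ (orig (erev (eact a h e))))]; first by left.
move=> /(_ (or_intror (erefl _))) Vh; apply: new.
by exists (orig (erev (eact a h e))) => //; rewrite eact_rev eact_orig vproj_act.
Qed.

Section FromVertices.
Variable V : set (vert Z).
Hypothesis V_reps : partial_reps V.
Hypothesis V_neq0 : V !=set0.
Hypothesis V_all : forall v, exists2 u, V u & vproj a u = vproj a v.
Local Notation T0 := (induced V).

Lemma T0_subtree : is_subtree T0.
Proof. by have [_ con] := V_reps; exact: subtreeI. Qed.

Lemma T0_vinj u v : V u -> V v -> vproj a u = vproj a v -> u = v.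
Proof. by have [inj _] := V_reps; exact: inj. Qed.

Lemma T0_einj e f : se T0 e -> se T0 f -> eproj a e = eproj a f -> e = f.
Proof.
move=> [Ve Ve'] [Vf Vf'] /eproj_eq[h hE].
apply: tree_edge_eq => //; apply: T0_vinj => //.
  by rewrite -hE eact_orig vproj_act.
by rewrite -hE eact_rev eact_orig vproj_act.
Qed.

Fact quotient_tree_orig (e : edge Y) :
  (eproj a @` se T0) e -> [set: vert Y] (orig e). Proof. by []. Qed.
Fact quotient_tree_rev (e : edge Y) : (eproj a @` se T0) e -> (eproj a @` se T0) (erev e).
Proof. by move=> [f Tf <-]; exists (erev f); [exact: se_rev|rewrite -(erev_eproj a_wi)]. Qed.
Definition quotient_tree : subgraph Y := Subgraph quotient_tree_orig quotient_tree_rev.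
Local Notation T := quotient_tree.

Lemma vproj_V (x : vert Y) : exists2 v, V v & vproj a v = x.
Proof. by have [v <-] := vproj_surj x; exact: V_all. Qed.

Lemma walk_vproj u p v : walk T0 u p v -> walk T (vproj a u) (map (eproj a) p) (vproj a v).
Proof.
elim: p u => [|e p IHp] u; first by move=> [_ ->].
move=> [Te <- /IHp ev]; split; first by exists e.
  exact: (orig_eproj a_wi).
by rewrite (erev_eproj a_wi) (orig_eproj a_wi).
Qed.

Lemma walk_lift x p y : walk T x p y -> exists u q v,
  [/\ walk T0 u q v, map (eproj a) q = p, vproj a u = x & vproj a v = y].
Proof.
elim: p x => [|e p IHp] x.
  by move=> [_ <-]; have [v Vv vx] := vproj_V x; exists v, [::], v; split.
move=> [[f Tf <-] <- /IHp[u [q [v [uq <- ux vy]]]]].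
exists (orig f), (f :: q), v; split=> //; last exact/esym/(orig_eproj a_wi).
split=> //; suff -> : orig (erev f) = u by [].
apply: T0_vinj; [exact: Tf.2|exact: walk_start uq|].
by rewrite ux (erev_eproj a_wi) (orig_eproj a_wi).
Qed.

Lemma quotient_subtree : is_subtree T.
Proof.
have [_ con circ] := T0_subtree; split.
- by have [v _] := V_neq0; exists (vproj a v).
- move=> x y _ _; have [u Vu <-] := vproj_V x; have [v Vv <-] := vproj_V y.
  by have [p /walk_vproj] := con _ _ Vu Vv; exists (map (eproj a) p).
move=> x p red /walk_lift[u [q [v [uq pE ux vx]]]].
have uv : u = v by apply: T0_vinj; [exact: walk_start uq|exact: walk_end uq|rewrite ux].
rewrite -uv in uq; rewrite -pE (circ u q) // => p1 e p2 qE.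
apply: (red (map (eproj a) p1) (eproj a e) (map (eproj a) p2)).
by rewrite -pE qE !map_cat (erev_eproj a_wi).
Qed.

(** The tree contains all vertices, so a further edge would form a circuit with
    the reduced walk between its ends. *)
Lemma quotient_maximal : maximal_subtree T.
Proof.
split=> [|T' [_ _ circ] [svT seT]]; first exact: quotient_subtree.
split=> // e T'e; apply: contrapT => nTe; have [_ con _] := quotient_subtree.
have [p /walk_reduce[q red ep]] := con (orig (erev e)) (orig e) I I.
have redeq : reduced (e :: q).
  move=> [|f p1] g p2 [] ee qE; last exact: red qE.
  apply: nTe; rewrite ee -[g]erevK; apply: se_rev.
  by move: ep; rewrite qE => -[].
have closed : walk T' (orig e) (e :: q) (orig e) by split=> //; exact: walk_sub ep.
by have := circ _ _ redeq closed.
Qed.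

(** ** Edge representatives *)

Definition edge_or (e : edge Y) : edge Y :=
  pick (ex_intro [set f | f = e \/ f = erev e] e (or_introl (erefl _))).

Lemma edge_orP e : edge_or e = e \/ edge_or e = erev e.
Proof. exact: (pickP (ex_intro [set f | f = e \/ f = erev e] _ _)). Qed.

Lemma edge_or_rev e : edge_or (erev e) = edge_or e.
Proof.
apply: pick_eq; apply/seteqP; split=> f [] h; [right|left|right|left] => //.
  exact: etrans h (erevK e).
exact: etrans h (esym (erevK e)).
Qed.

Lemma oriented_lift_ex : exists F : edge Y -> edge Z, forall e,
  [/\ eproj a (F e) = e, V (orig (F e)) & se T e -> se T0 (F e)].
Proof.
have lift e : exists f, [/\ eproj a f = e, V (orig f) & se T e -> se T0 f].
  case: (pselect (se T e)) => [Te|nTe].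
    by have [f Tf fe] := Te; exists f; split=> //; exact: Tf.1.
  have [f fe] := eproj_surj e; have [u Vu uf] := V_all (orig f).
  have [h hu] := vproj_eq (esym uf); exists (eact a h f).
  by split; rewrite ?eproj_act // eact_orig hu.
by have /choice[F FP] := lift; exists F.
Qed.

Lemma edge_lift_ex : exists l : edge Y -> edge Z,
  [/\ forall e, eproj a (l e) = e, forall e, l (erev e) = erev (l e),
      forall e, V (orig (l e)) \/ V (orig (l (erev e)))
    & forall f, se T0 f -> l (eproj a f) = f].
Proof.
have [F FP] := oriented_lift_ex.
pose l e := if `[< edge_or e = e >] then F e else erev (F (erev e)).
have lT e : edge_or e = e -> l e = F e by move=> h; rewrite /l asboolT.
have lF e : edge_or e <> e -> l e = erev (F (erev e)) by move=> h; rewrite /l asboolF.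
have or_rev e : edge_or e = e -> edge_or (erev e) <> erev e.
  by move=> h; rewrite edge_or_rev h => /esym/erev_neq.
have or_rev' e : edge_or e <> e -> edge_or (erev e) = erev e.
  by move=> h; rewrite edge_or_rev; case: (edge_orP e).
have lproj e : eproj a (l e) = e.
  have [h|h] := pselect (edge_or e = e); first by rewrite lT //; have [] := FP e.
  rewrite lF // -(erev_eproj a_wi); have [E _ _] := FP (erev e).
  by rewrite E; exact: (@erevK Y e).
exists l; split=> //.
- move=> e; have [h|h] := pselect (edge_or e = e).
    rewrite (lF _ (or_rev _ h)) (lT _ h); congr (erev (F _)); exact: (@erevK Y e).
  by rewrite (lT _ (or_rev' _ h)) (lF _ h) erevK.
- move=> e; have [h|h] := pselect (edge_or e = e).
    by left; rewrite (lT _ h); have [] := FP e.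
  by right; rewrite (lT _ (or_rev' _ h)); have [] := FP (erev e).
move=> f Tf; apply: T0_einj => //.
have Te : se T (eproj a f) by exists f.
have [h|h] := pselect (edge_or (eproj a f) = eproj a f).
  by rewrite (lT _ h); have [_ _ E] := FP (eproj a f); exact: E.
rewrite (lF _ h); apply: se_rev; have [_ _ E] := FP (erev (eproj a f : edge Y)).
by apply: E; exact: (se_rev Te).
Qed.

Variable l : edge Y -> edge Z.
Hypothesis l_proj : forall e, eproj a (l e) = e.
Hypothesis l_rev : forall e, l (erev e) = erev (l e).
Hypothesis l_or : forall e, V (orig (l e)) \/ V (orig (l (erev e))).
Hypothesis l_T0 : forall f, se T0 f -> l (eproj a f) = f.

Fact edge_tree_orig e : range l e -> (V `|` range (orig \o l)) (orig e).
Proof. by move=> [f _ <-]; right; exists f. Qed.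
Fact edge_tree_rev e : range l e -> range l (erev e).
Proof. by move=> [f _ <-]; exists (erev f). Qed.
Definition edge_tree : subgraph Z := Subgraph edge_tree_orig edge_tree_rev.
Local Notation S := edge_tree.

Lemma T0_sub_S : sub_subgraph T0 S.
Proof. by split=> [v|f Tf]; [left|exists (eproj a f) => //; exact: l_T0]. Qed.

Lemma edge_subtree : is_subtree S.
Proof.
have toV u : sv S u -> exists2 v, V v & exists p, walk S u p v.
  have selfV v : V v -> exists2 w, V w & exists p, walk S v p w.
    by move=> Vv; exists v => //; exists [::]; split=> //; left.
  move=> [|[e _ <-]]; first exact: selfV.
  have [Ve|Ve] := l_or e; first exact: selfV.
  rewrite l_rev in Ve; exists (orig (erev (l e))) => //; exists [:: l e].
  by split; [exists e| |split=> //; left].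
apply: subtreeI => //; first by have [v Vv] := V_neq0; exists v; left.
move=> u v Su Sv; have [u' Vu' [p up]] := toV _ Su; have [v' Vv' [q /walk_sym[q' qv]]] := toV _ Sv.
have [_ con] := V_reps; have [r ur] := con _ _ Vu' Vv'.
exists (p ++ r ++ q'); apply/walk_cat; exists u' => //; apply/walk_cat; exists v' => //.
exact: walk_sub T0_sub_S ur.
Qed.

Lemma edge_tree_bij : set_bij (se S) [set: edge Y] (eproj a).
Proof.
split=> // [e f|e _]; last by exists (l e); [exists e|exact: l_proj].
by rewrite !inE => -[e' _ <-] [f' _ <-]; rewrite !l_proj => ->.
Qed.

Lemma T0_vbij : set_bij V [set: vert Y] (vproj a).
Proof.
split=> // [u v|x _]; first by rewrite !inE => Vu Vv; exact: T0_vinj.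
by have [v Vv <-] := vproj_V x; exists v.
Qed.

Lemma T0_ebij : set_bij (se T0) (se T) (eproj a).
Proof.
split=> [e Te|e f|e [f Tf <-]]; [by exists e| |by exists f].
by rewrite !inE => Te Tf; exact: T0_einj.
Qed.

Lemma edge_abs_ex : exists m : edge Y -> edge Y, [/\ forall e, m (erev e) = m e,
  forall e, m e = e \/ m e = erev e & forall e, V (orig (l (m e)))].
Proof.
pose P e := [set f | (f = e \/ f = erev e) /\ V (orig (l f))].
have P0 e : exists f, P e f.
  by case: (l_or e) => Ve; [exists e|exists (erev e)]; split=> //; [left|right].
exists (fun e => pick (P0 e)); split=> e; try by have [] := pickP (P0 e).
apply: pick_eq; apply/seteqP; split=> f [[] h Vf]; split=> //; [right|left|right|left] => //.
  exact: etrans h (erevK e).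
exact: etrans h (esym (erevK e)).
Qed.

Lemma translation_ex : exists g : edge Y -> Gamma, forall e,
  V (vact a (g e)^-1%g (orig (l e))) /\ (V (orig (l e)) -> g e = 1%g).
Proof.
suff /choice[g gP] : forall e, exists h, V (vact a h^-1%g (orig (l e))) /\
    (V (orig (l e)) -> h = 1%g) by exists g.
move=> e; have [Ve|nVe] := pselect (V (orig (l e))).
  by exists 1%g; rewrite invg1 vact1.
have [u Vu /vproj_eq[h hE]] := V_all (orig (l e)).
by exists h; split=> //; rewrite -hE vactK.
Qed.

End FromVertices.
End Representatives.

(** * Existence of signatures *)

Section StabiliserGroups.
Variables (Gamma : groupType) (Z : graph) (a : gaction Gamma Z).
Hypothesis a_wi : without_inversions a.
Local Notation Y := (quotient_graph a_wi).
Variables (g : edge Y -> Gamma) (vrep : vert Y -> vert Z) (erep : edge Y -> edge Z).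
Hypothesis erep_rev : forall e, erep (erev e) = erev (erep e).
Hypothesis g_orig : forall e, vact a (g e)^-1%g (orig (erep e)) = vrep (orig e).

Definition vstab (x : vert Y) : set Gamma := [set s | vact a s (vrep x) = vrep x].
Definition estab (e : edge Y) : set Gamma := [set s | eact a s (erep e) = erep e].

Fact vstab_subgroup x : is_subgroup (vstab x).
Proof.
split=> [|s t xs xt|s xs]; rewrite /vstab /mkset; first exact: vact1.
  by rewrite vactM xt.
by rewrite -[in LHS]xs vactK.
Qed.

Fact estab_subgroup e : is_subgroup (estab e).
Proof.
split=> [|s t xs xt|s xs]; rewrite /estab /mkset; first exact: eact1.
  by rewrite eactM xt.
by rewrite -[in LHS]xs eactK.
Qed.

Fact estab_rev e : estab (erev e) = estab e.
Proof.
apply/seteqP; split=> s; rewrite /estab /mkset erep_rev -eact_rev; last by move=> ->.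
exact: (can_inj (@erevK Z)).
Qed.

Definition translate e s := ((g e)^-1 * s * g e)%g.

Fact translate_in e s : estab e s -> vstab (orig e) (translate e s).
Proof.
move=> es; rewrite /vstab /mkset -g_orig !vactM vactVK -eact_orig.
by rewrite (es : eact a s _ = _).
Qed.

Fact translateM e s t : estab e s -> estab e t ->
  translate e (s * t)%g = (translate e s * translate e t)%g.
Proof. by rewrite /translate !mulgA mulgK. Qed.

Fact translate_inj e s t : estab e s -> estab e t -> translate e s = translate e t -> s = t.
Proof. by move=> _ _ /mulIg/mulgI. Qed.

Definition stabiliser_groups : graph_of_groups Gamma Y :=
  GraphOfGroups vstab_subgroup estab_subgroup estab_rev translate_in translateM translate_inj.
End StabiliserGroups.

Section Existence.
Variables (L0 : oagType) (Gamma : groupType).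
Variable beta : {multiplicative Gamma -> oaut (zlex L0)}.
Variables (theta : Gamma -> oaut L0) (mu : Gamma -> L0).
Hypothesis betaE : forall (g : Gamma) (l : L0),
  beta g (zpair 1 l) = zpair 1 (theta g l + mu g).
Hypothesis L0_neq0 : exists l : L0, l <> 0.
Variables (X : ltree (zlex L0)) (a : affine_action beta X).
Local Notation Xs := (xs_graph X).
Local Notation act := (xs_action a).

Lemma fibre_dist_act g (v : xs_vert X) p q : sval v p -> sval v q ->
  fibre_dist (a g p) (a g q) = theta g (fibre_dist p q).
Proof.
move=> vp vq; have := aact_affine a g p q.
by rewrite (fibre_distE vp vq) (beta_zpair0 betaE) /fibre_dist => ->.
Qed.

Section EndMaps.
Variables (e : edge Xs) (g : Gamma) (c : L0).
Let f := eact act g^-1%g e.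

(** Along a ray towards the end of [e] the height drops by the distance covered,
    so its negative is an end map; it is carried over to the translated fibre,
    where [g] rescales the metric. *)
Definition edge_end_map (x : X) : L0 := (theta g)^-1%g (c - height e (a g x)).

Lemma edge_end_mapP : is_end_map (sval (orig f)) (@fibre_dist L0 X)
  (end_image (a g^-1%g) (edge_end e)) edge_end_map.
Proof.
move=> x y fx [B [[x' R] [ex' RE] [xE BE]] By].
move: By; rewrite -BE (RE : R = _) => -[y' [ey' hy'] <-].
rewrite -xE /edge_end_map !aactVK -oautN -oautD.
rewrite (fibre_dist_act _ (ex' : sval (orig e) x') ey') (thetaV betaE); congr (_ _).
by move: hy' => /= <-; oag_lia L0.
Qed.
End EndMaps.

Hypothesis a_wi : without_inversions act.
Local Notation Ys := (quotient_graph a_wi).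

Theorem signature_ex : exists D : sig_data a_wi, is_signature theta mu D.
Proof.
have Xs_tree := xs_is_tree X.
have [V [Vr V0 Vall]] := vertex_reps_ex act Xs_tree.
have [l [lE lrev lor lT0]] := edge_lift_ex a_wi Xs_tree Vr Vall.
have [m [mrev mor mV]] := edge_abs_ex lor.
have [g gP] := translation_ex Vall l.
have /choice[vrep vrepP] (x : qvert act) : exists v, V v /\ vproj act v = x.
  by have [v] := vproj_V Vall (x : vert Ys); exists v.
have g_orig (e : edge Ys) : vact act (g e)^-1%g (orig (l e)) = vrep (orig e).
  have [Vg _] := gP e; have [Vv vE] := vrepP (orig e).
  apply: (T0_vinj Vr) => //; rewrite vproj_act vE -[in RHS](lE e).
  exact/esym/(orig_eproj a_wi).
have fibE (e : edge Ys) : sval (orig (eact act (g e)^-1%g (l e))) = sval (vrep (orig e)).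
  by rewrite eact_orig g_orig.
(* The heights of points over both ends of an edge add up to their distance and
   that of the base points; the latter is charged to one orientation. *)
pose c (e : edge Ys) : L0 := if `[< m e = e >] then 0 else height (l e) (xs_repr (orig (l e))).
pose delta (e : edge Ys) := edge_end_map (l e) (g e) (c e).
have deltaE (e : edge Ys) x y : sval (orig (l e)) x -> sval (orig (erev (l e))) y ->
    dist x y = zpair 1 (- theta (g e) (delta e (a (g e)^-1%g x))
      - theta (g (erev e)) (delta (erev e) (a (g (erev e))^-1%g y))).
  move=> ex ey; rewrite /delta.
  have thK h (t : L0) : theta h ((theta h)^-1%g t) = t.
    by rewrite -[LHS]/((theta h * (theta h)^-1)%g t) mulgV.
  set x0 := xs_repr (orig (l e)); set y0 := xs_repr (orig (erev (l e))).
  have cE : c e + c (erev e) = (dist x0 y0).2.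
    rewrite /c mrev /height lrev erevK -/x0 -/y0 (dist_sym y0 x0).
    have ne : erev e <> e by exact: erev_neq.
    case: (mor e) => ->.
      by rewrite asboolT // asboolF ?add0r // => /esym.
    by rewrite asboolF // asboolT ?addr0.
  have hE : height (l (erev e)) y = (dist y x0).2 by rewrite /height lrev erevK.
  rewrite /edge_end_map !aactVK !thK hE; move: (c e) (c (erev e)) cE => k k' kE.
  apply: zlex_eqP => /=; first exact: edge_dist ex ey.
  have := congr1 snd (edge_cross ex (xs_repr_in _) ey (xs_repr_in _)).
  rewrite !zlex_sndD -/x0 -/y0 -kE (dist_sym x0 y) -/(height (l e) x) => ?.
  oag_lia L0.
pose D := @SigData _ _ _ _ a a_wi (quotient_tree a_wi V) (induced V) (edge_tree V lrev)
  vrep l (stabiliser_groups lrev g_orig) g m (theta \o g) (mu \o g)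
  (fun _ => theta) (fun _ => mu) (fun x => sval (vrep x)) (fun _ => @fibre_dist L0 X)
  (fun _ => a) (fun e => end_image (a (g e)^-1%g) (edge_end (l e)))
  delta.
exists D; split; do ?by [].
- exact: (quotient_maximal a_wi Xs_tree Vr V0 Vall).
- split; [exact: (T0_subtree Xs_tree Vr V0)|exact: (T0_vbij a_wi Vr Vall)|].
  exact: (T0_ebij a_wi Xs_tree Vr).
- split; [exact: (edge_subtree Xs_tree Vr V0 lrev lor lT0)|exact: (T0_sub_S lrev lT0)| |].
    exact: (edge_tree_bij V lE lrev).
  by move=> _ [e _ <-]; have := lor e; rewrite lrev.
- by move=> e; split; [exists e|exact: lE].
- by move=> e; have [] := gP e.
- by move=> e; have [] := gP e.
- by move=> x p q xp xq; exact: fibre_distE xp xq.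
- by move=> e; exists (edge_end (l e)) => //; apply/is_edge_endP.
- by move=> e; have := @edge_end_mapP (l e) (g e) (c e); rewrite fibE.
Qed.
End Existence.

Theorem theorem2p1 (L0 : oagType) (L0_neq0 : exists l : L0, l <> 0)
    (Gamma : groupType)
    (beta : {multiplicative Gamma -> oaut (zlex L0)})
    (theta : Gamma -> oaut L0) (mu : Gamma -> L0)
    (betaE : forall (g : Gamma) (l : L0),
       beta g (zpair 1 l) = zpair 1 (theta g l + mu g))
    (X : ltree (zlex L0))
    (a : affine_action beta X)
    (a_wi : without_inversions (xs_action a)) :
  (exists D : sig_data a_wi, is_signature theta mu D) /\
  (forall D : sig_data a_wi, is_signature theta mu D ->
     [/\ sig_graph_of_groups D, sig_homs D, sig_trees D, sig_actions D
       & sig_ends D] /\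
     [/\ sig_end_stabilisers D, sig_end_orbits D, sig_theta D, sig_mu D
       & sig_delta D]).
Proof.
split=> [|D sgnD]; first exact: (signature_ex betaE L0_neq0).
split; split.
- exact: (sgn_graph_of_groups sgnD).
- exact: (sgn_homs betaE sgnD).
- exact: (sgn_trees sgnD).
- exact: (sgn_actions betaE sgnD).
- exact: (sgn_ends L0_neq0 sgnD).
- exact: (sgn_end_stabilisers L0_neq0 sgnD).
- exact: (sgn_end_orbits L0_neq0 sgnD).
- exact: (sgn_theta betaE sgnD).
- exact: (sgn_mu betaE sgnD).
exact: (sgn_deltas betaE sgnD).
Qed.
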